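(* Let $n\ge 2$. There is a $\mathbb{Z}[\delta^{\pm1}]$-algebra isomorphism $$\phi:\mathrm{Br}(\mathrm{C}_n)\longrightarrow \mathrm{SBr}(\mathrm{A}_{2n-1})$$ determined by $\phi(r_0)=R_n$, $\phi(e_0)=E_n$, and $\phi(r_i)=R_{n-i}R_{n+i}$, $\phi(e_i)=E_{n-i}E_{n+i}$ for $0<i<n$. In particular, $\mathrm{Br}(\mathrm{C}_n)$ is a free $\mathbb{Z}[\delta^{\pm1}]$-module of rank $a_{2n}$, where the sequence $(a_m)_{m\ge0}$ is defined by $a_0=a_1=1$ and $a_m=a_{m-1}+2(m-1)a_{m-2}$ for $m>1$.
   Context: Let $R$ be a commutative ring with an invertible element $\delta$, and $n\ge1$. The Brauer algebra of type $\mathrm{C}_n$, $\mathrm{Br}(\mathrm{C}_n,R,\delta)$, is the unital associative $R$-algebra generated by $r_0,\dots,r_{n-1},e_0,\dots,e_{n-1}$ subject to the following relations, where for distinct $i,j\in\{0,\dots,n-1\}$ we write $i\sim j$ if $|i-j|=1$ and $i\nsim j$ otherwise: $r_i^2=1$ and $r_ie_i=e_ir_i=e_i$ for all $i$; $e_i^2=\delta^2e_i$ for $i>0$; $e_0^2=\delta e_0$; $r_ir_j=r_jr_i$, $e_ir_j=r_je_i$, $e_ie_j=e_je_i$ for $i\nsim j$; $r_ir_jr_i=r_jr_ir_j$, $r_jr_ie_j=e_ie_j$, $r_ie_jr_i=r_je_ir_j$ for $i\sim j$ with $i,j>0$; and $r_1r_0r_1r_0=r_0r_1r_0r_1$, $r_1r_0e_1=r_0e_1$,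 $r_1e_0r_1e_0=e_0e_1e_0$, $r_1r_0r_1e_0=e_0r_1r_0r_1$, $e_1r_0e_1=\delta e_1$, $e_1e_0e_1=\delta e_1$, $e_1r_0r_1=e_1r_0$, $e_1e_0r_1=e_1e_0$. Write $\mathrm{Br}(\mathrm{C}_n)=\mathrm{Br}(\mathrm{C}_n,\mathbb{Z}[\delta^{\pm1}],\delta)$. $\mathrm{Br}(\mathrm{A}_{2n-1})$ denotes the classical Brauer algebra on $2n$ strands over $\mathbb{Z}[\delta^{\pm1}]$: it is free with basis the Brauer diagrams, i.e. perfect matchings of the $4n$ dots $(j,1),(j,0)$, $1\le j\le 2n$, with multiplication by concatenation (placing one diagram on top of the other) where each closed loop formed is replaced by a factor $\delta$. $R_j$ ($1\le j\le 2n-1$) is the diagram joining $(j,1)$ to $(j+1,0)$, $(j+1,1)$ to $(j,0)$ and $(k,1)$ to $(k,0)$ for $k\ne j,j+1$; $E_j$ is the diagram joining $(j,1)$ to $(j+1,1)$, $(j,0)$ to $(j+1,0)$ and $(k,1)$ to $(k,0)$ for $k\neq j,j+1$. A Brauer diagram is symmetric if it is invariant under the reflection $(j,\epsilon)\mapsto(2n+1-j,\epsilon)$ of the dots. $\mathrm{SBr}(\mathrm{A}_{2n-1})$ is the $\mathbb{Z}[\delta^{\pm1}]$-linear span of the symmetric Brauer diagrams. *)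

(* Defs.v *)
From HB Require Import structures.
From mathcomp Require Import all_boot all_order all_algebra.
From Stdlib Require Import ClassicalEpsilon.
Set Implicit Arguments. Unset Strict Implicit. Unset Printing Implicit Defensive.

(* Part 1: the base ring Z[delta^{+-1}], realised as the
   subring { p / X^k | p in Z[X], k in N } of the fraction field Q(X) of Z[X],
   with delta := X. *)
Import Order.TTheory GRing.Theory Num.Theory.
Local Open Scope ring_scope.

Notation Fr := {fraction {poly int}}.
Definition is_laurent (x : Fr) : Prop :=
  exists (p : {poly int}) (k : nat), x = tofrac p / tofrac ('X ^+ k).
Definition laurentb (x : Fr) : bool :=
  if excluded_middle_informative (is_laurent x) then true else false.
Lemma laurentbP x : reflect (is_laurent x) (laurentb x).
Proof. rewrite /laurentb; case: excluded_middle_informative => h; by constructor. Qed.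

Lemma Xk_neq0 k : tofrac ('X ^+ k : {poly int}) != 0 :> Fr.
Proof. by rewrite tofrac_eq0 expf_neq0 // polyX_eq0. Qed.

Lemma div_sub_aux (F : fieldType) (P Q a b : F) : a != 0 -> b != 0 ->
  P / a - Q / b = (P * b - Q * a) / (a * b).
Proof.
move=> ha hb; rewrite mulrBl invfM [a^-1 * _]mulrC !mulrA mulfK //.
by rewrite -[Q * a * b^-1]mulrAC mulfK.
Qed.

Fact laurent_subring : subring_closed laurentb.
Proof.
split.
- by apply/laurentbP; exists 1, 0%N; rewrite expr0 !tofrac1 divr1.
- move=> x y /laurentbP[p [k ->]] /laurentbP[q [l ->]]; apply/laurentbP.
  exists (p * 'X^l - q * 'X^k), (k + l)%N.
  set P := tofrac p; set Q := tofrac q; set A := tofrac ('X^k : {poly int}); set B := tofrac ('X^l : {poly int}).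
  have -> : tofrac ('X^(k+l) : {poly int}) = A * B by rewrite exprD tofracM.
  have -> : tofrac (p * 'X^l - q * 'X^k) = P * B - Q * A by rewrite tofracB !tofracM.
  have hk : A != 0 := Xk_neq0 k. have hl : B != 0 := Xk_neq0 l.
  exact: (@div_sub_aux _ P Q A B hk hl).
- move=> x y /laurentbP[p [k ->]] /laurentbP[q [l ->]]; apply/laurentbP.
  exists (p * q), (k + l)%N.
  set P := tofrac p; set Q := tofrac q; set A := tofrac ('X^k : {poly int}); set B := tofrac ('X^l : {poly int}).
  have -> : tofrac ('X^(k+l) : {poly int}) = A * B by rewrite exprD tofracM.
  have -> : tofrac (p * q) = P * Q by rewrite tofracM.
  exact: (@mulf_div _ P A Q B).
Qed.
HB.instance Definition _ := GRing.isSubringClosed.Build Fr laurentb laurent_subring.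

Record laurent := Laurent { lval : Fr; _ : laurentb lval }.
HB.instance Definition _ := [isSub for lval].
HB.instance Definition _ := [Choice of laurent by <:].
HB.instance Definition _ := [SubChoice_isSubComNzRing of laurent by <:].

Lemma X_laurent : laurentb (tofrac ('X : {poly int})).
Proof. by apply/laurentbP; exists 'X, 0%N; rewrite expr0 tofrac1 divr1. Qed.
Definition delta : laurent := Laurent X_laurent.

(* The dot (j,eps) of the paper (1 <= j <= m, eps in {0,1}) is encoded as
   (k, b) : 'I_m * bool with k = j - 1 and b = true iff eps = 1 (top row). *)
Definition dot (m : nat) := ('I_m * bool)%type.

(* A (candidate) matching is a function on dots; a Brauer diagram is a
   fixed-point-free involution, i.e. a perfect matching of the 2m dots. *)
Definition bfun (m : nat) := {ffun dot m -> dot m}.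
Definition is_diagram m (f : bfun m) : bool :=
  [forall x : dot m, (f (f x) == x) && (f x != x)].
Definition diagram (m : nat) := {f : bfun m | is_diagram f}.

(* R_j and E_j (1 <= j <= m-1), with the paper's 1-based index j. *)
Definition Rfun m (j : nat) : bfun m := [ffun x : dot m =>
  if x.1.+1 == j then (insubd x.1 x.1.+1, ~~ x.2)
  else if val x.1 == j then (insubd x.1 x.1.-1, ~~ x.2)
  else (x.1, ~~ x.2)].
Definition Efun m (j : nat) : bfun m := [ffun x : dot m =>
  if x.1.+1 == j then (insubd x.1 x.1.+1, x.2)
  else if val x.1 == j then (insubd x.1 x.1.-1, x.2)
  else (x.1, ~~ x.2)].
Definition Idfun m : bfun m := [ffun x : dot m => (x.1, ~~ x.2)].

Definition refl_dot m (x : dot m) : dot m := (rev_ord x.1, x.2).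
Definition is_symmetric m (f : bfun m) : bool :=
  [forall x : dot m, f (refl_dot x) == refl_dot (f x)].

(* Concatenation of a (on top) and b (below): the bottom row of a is glued
   to the top row of b (the "middle row", indexed by 'I_m).
   [follow a b fuel useA k]: we stand at middle dot k and next travel along an
   arc of a (useA = true) or of b (useA = false) until we reach an outer dot. *)
Fixpoint follow m (a b : bfun m) (fuel : nat) (useA : bool) (k : 'I_m) : dot m :=
  match fuel with
  | 0 => (k, true)
  | fuel'.+1 =>
    if useA then
      let y := a (k, false) in if y.2 then y else follow a b fuel' false y.1
    else
      let y := b (k, true) in if y.2 then follow a b fuel' true y.1 else y
  end.

Definition compose m (a b : bfun m) : bfun m := [ffun x : dot m =>
  if x.2 then
    let y := a x in if y.2 then y else follow a b m.*2.+2 false y.1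
  else
    let y := b x in if y.2 then follow a b m.*2.+2 true y.1 else y].

(* closed loops: connected components of the middle row (w.r.t. the arcs of
   a and b joining middle dots) none of whose dots is joined to an outer dot *)
Definition mid_edge m (a b : bfun m) : rel 'I_m := fun k k' =>
  [|| a (k, false) == (k', false), a (k', false) == (k, false),
      b (k, true) == (k', true) | b (k', true) == (k, true)].
Definition touches_outer m (a b : bfun m) (k : 'I_m) : bool :=
  (a (k, false)).2 || ~~ (b (k, true)).2.
Definition in_loop m (a b : bfun m) : pred 'I_m := fun k =>
  [forall k', connect (mid_edge a b) k k' ==> ~~ touches_outer a b k'].
Definition nloops m (a b : bfun m) : nat := n_comp (mid_edge a b) (in_loop a b).

(* Br(A_{m-1}) over Z[delta^{+-1}]: the free module on the Brauer diagrams,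
   an element being its coefficient function. *)
Definition br (m : nat) := {ffun diagram m -> laurent}.
Definition bunit m (f : bfun m) : br m := [ffun d : diagram m => (val d == f)%:R].
Definition bscale m (c : laurent) (x : br m) : br m := [ffun d => c * x d].
Definition bone m : br m := bunit (Idfun m).
(* multiplication: bilinear extension of  a . b = delta^(#loops) (a o b) *)
Definition bmul m (x y : br m) : br m := [ffun d : diagram m =>
  \sum_(a : diagram m) \sum_(b : diagram m)
     (compose (val a) (val b) == val d)%:R *
       (x a * y b * delta ^+ nloops (val a) (val b))].

Definition in_SBr m (x : br m) : Prop :=
  forall d : diagram m, x d != 0 -> is_symmetric (val d).

(* Part 3: Br(C_n) = free algebra on r_0..r_{n-1}, e_0..e_{n-1} modulo the
   two-sided ideal generated by the defining relations. *)

Definition gen (n : nat) := ('I_n * bool)%type.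
Definition rr n (i : 'I_n) : gen n := (i, false).
Definition ee n (i : 'I_n) : gen n := (i, true).
Definition word n := seq (gen n).
(* elements of the free algebra: formal linear combinations of words *)
Definition fsum n := seq (laurent * word n).
Definition coef n (s : fsum n) (w : word n) : laurent := \sum_(p <- s | p.2 == w) p.1.
Definition fw n (c : laurent) (w : word n) : fsum n := [:: (c, w)].
Definition fscale n (c : laurent) (s : fsum n) : fsum n := [seq (c * p.1, p.2) | p <- s].
Definition fmul n (s t : fsum n) : fsum n := [seq (p.1 * q.1, p.2 ++ q.2) | p <- s, q <- t].
Definition fone n : fsum n := fw 1 [::].
Definition fwrap n (u : word n) (s : fsum n) (v : word n) : fsum n :=
  [seq (p.1, u ++ p.2 ++ v) | p <- s].

Definition adj n (i j : 'I_n) : bool := (i.+1 == j) || (j.+1 == i).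
Definition nadj n (i j : 'I_n) : bool := (i != j) && ~~ adj i j.

Inductive Cn_rel (n : nat) : fsum n -> fsum n -> Prop :=
| rel_rr (i : 'I_n) : Cn_rel (fw 1 [:: rr i; rr i]) (fw 1 [::])
| rel_re (i : 'I_n) : Cn_rel (fw 1 [:: rr i; ee i]) (fw 1 [:: ee i])
| rel_er (i : 'I_n) : Cn_rel (fw 1 [:: ee i; rr i]) (fw 1 [:: ee i])
| rel_ee (i : 'I_n) : (0 < val i)%N -> Cn_rel (fw 1 [:: ee i; ee i]) (fw (delta ^+ 2) [:: ee i])
| rel_ee0 (i : 'I_n) : val i = 0%N -> Cn_rel (fw 1 [:: ee i; ee i]) (fw delta [:: ee i])
| rel_comm_rr (i j : 'I_n) : nadj i j -> Cn_rel (fw 1 [:: rr i; rr j]) (fw 1 [:: rr j; rr i])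
| rel_comm_er (i j : 'I_n) : nadj i j -> Cn_rel (fw 1 [:: ee i; rr j]) (fw 1 [:: rr j; ee i])
| rel_comm_ee (i j : 'I_n) : nadj i j -> Cn_rel (fw 1 [:: ee i; ee j]) (fw 1 [:: ee j; ee i])
| rel_braid (i j : 'I_n) : adj i j -> (0 < val i)%N -> (0 < val j)%N ->
    Cn_rel (fw 1 [:: rr i; rr j; rr i]) (fw 1 [:: rr j; rr i; rr j])
| rel_rre (i j : 'I_n) : adj i j -> (0 < val i)%N -> (0 < val j)%N ->
    Cn_rel (fw 1 [:: rr j; rr i; ee j]) (fw 1 [:: ee i; ee j])
| rel_rer (i j : 'I_n) : adj i j -> (0 < val i)%N -> (0 < val j)%N ->
    Cn_rel (fw 1 [:: rr i; ee j; rr i]) (fw 1 [:: rr j; ee i; rr j])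
| rel_C1 (i0 i1 : 'I_n) : val i0 = 0%N -> val i1 = 1%N ->
    Cn_rel (fw 1 [:: rr i1; rr i0; rr i1; rr i0]) (fw 1 [:: rr i0; rr i1; rr i0; rr i1])
| rel_C2 (i0 i1 : 'I_n) : val i0 = 0%N -> val i1 = 1%N ->
    Cn_rel (fw 1 [:: rr i1; rr i0; ee i1]) (fw 1 [:: rr i0; ee i1])
| rel_C3 (i0 i1 : 'I_n) : val i0 = 0%N -> val i1 = 1%N ->
    Cn_rel (fw 1 [:: rr i1; ee i0; rr i1; ee i0]) (fw 1 [:: ee i0; ee i1; ee i0])
| rel_C4 (i0 i1 : 'I_n) : val i0 = 0%N -> val i1 = 1%N ->
    Cn_rel (fw 1 [:: rr i1; rr i0; rr i1; ee i0]) (fw 1 [:: ee i0; rr i1; rr i0; rr i1])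
| rel_C5 (i0 i1 : 'I_n) : val i0 = 0%N -> val i1 = 1%N ->
    Cn_rel (fw 1 [:: ee i1; rr i0; ee i1]) (fw delta [:: ee i1])
| rel_C6 (i0 i1 : 'I_n) : val i0 = 0%N -> val i1 = 1%N ->
    Cn_rel (fw 1 [:: ee i1; ee i0; ee i1]) (fw delta [:: ee i1])
| rel_C7 (i0 i1 : 'I_n) : val i0 = 0%N -> val i1 = 1%N ->
    Cn_rel (fw 1 [:: ee i1; rr i0; rr i1]) (fw 1 [:: ee i1; rr i0])
| rel_C8 (i0 i1 : 'I_n) : val i0 = 0%N -> val i1 = 1%N ->
    Cn_rel (fw 1 [:: ee i1; ee i0; rr i1]) (fw 1 [:: ee i1; ee i0]).

Definition in_ideal n (x : fsum n) : Prop :=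
  exists (N : nat) (c : 'I_N -> laurent) (u v : 'I_N -> word n)
         (l r : 'I_N -> fsum n),
    (forall i, Cn_rel (l i) (r i)) /\
    forall w : word n, coef x w =
      \sum_(i < N) c i * (coef (fwrap (u i) (l i) (v i)) w
                          - coef (fwrap (u i) (r i) (v i)) w).

Definition fsub n (x y : fsum n) : fsum n := x ++ fscale (-1) y.
Definition fcomb n N (c : 'I_N -> laurent) (b : 'I_N -> fsum n) : fsum n :=
  flatten [seq fscale (c i) (b i) | i <- enum 'I_N].

Definition gimg n (g : gen n) : br n.*2 :=
  let i := val g.1 in
  if g.2 then
    (if i == 0%N then bunit (Efun n.*2 n)
     else bmul (bunit (Efun n.*2 (n - i))) (bunit (Efun n.*2 (n + i))))
  else
    (if i == 0%N then bunit (Rfun n.*2 n)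
     else bmul (bunit (Rfun n.*2 (n - i))) (bunit (Rfun n.*2 (n + i)))).
Definition phiw n (w : word n) : br n.*2 := foldr (fun g acc => bmul (gimg g) acc) (bone _) w.
Definition phi n (s : fsum n) : br n.*2 := \sum_(p <- s) bscale p.1 (phiw p.2).

Fixpoint aseq (m : nat) : nat :=
  match m with
  | 0 => 1
  | 1 => 1
  | (p.+1 as q).+1 => (aseq q + 2 * q * aseq p)%N
  end.

(* Main.v *)
(* Relations. A diagram acts on colourings of its bottom row by two colours: it is the 0/1
   matrix telling which colourings of the two rows are constant along the strands. Matrix
   product is concatenation with [delta = 2], and these matrices remember both the diagram
   and the power of 2, so identities between diagrams, loops included, can be checked on
   products of transposition and arc operators. Hence [phi] is a well defined algebra map.

   Injectivity. Up to units of the base ring the words form a monoid, in which the [r i]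
   generate an image [tau] of the hyperoctahedral group, by the Coxeter presentation, and the
   conjugates of the [e i] are arc elements [X a b]. Every element is a product
   [Xprod f * Eprod f * tau u * Xprod g], with symmetric involutions [f] and [g] for the arcs
   in the top and bottom rows and [u] for the vertical strands, and the diagram determines
   this normal form. So two words with the same diagram agree up to a unit, and since powers
   of [delta] are not zero divisors [phi] detects the coefficients of one word per diagram.

   Rank. In a symmetric matching of [k] mirror pairs a given dot is matched either with its
   mirror image, leaving [k - 1] pairs, or with one of [2 (k - 1)] other dots, leaving
   [k - 2] pairs. *)

Require Import Defs.
From HB Require Import structures.
From mathcomp Require Import all_boot all_order all_algebra all_fingroup generic_quotient.
From mathcomp Require Import zify ring.
From Stdlib Require Import ClassicalEpsilon.
Set Implicit Arguments. Unset Strict Implicit. Unset Printing Implicit Defensive.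

(** * Gluing diagrams *)

(** The two rows of a symmetric diagram need not carry the same number of self-mirror arcs {a, sg
    a}: two of them in one row can face a pair {a, b}, {sg a, sg b} in the other. Top and bottom
    arcs therefore cannot be matched one to one, and the normal form needs a neutral middle.
    [Eprod f] puts a self-mirror arc on every non-vertical strand, so [f] and [g] only have to
    agree, through [u], on which strands are vertical. It also absorbs every exchange of
    non-vertical strands, so the product depends on [u] only through its values on the vertical
    ones. The arc element [X a b] is a conjugate of [e 0] or [e 1]. For it to depend on the arc
    alone, these generators must commute with the stabilisers of their arcs; such stabilisers become
    words in few letters once the fixed strands are carried to the far end of the chain of simple
    reflections. For diagrams with loops, associativity enters through the matrix product, from
    which [phi] inherits its multiplicativity on words. *)

Lemma diagramP m (f : bfun m) : reflect (involutive f /\ forall x, f x != x) (is_diagram f).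
Proof.
apply: (iffP forallP) => [h|[h1 h2] x]; last by rewrite h1 eqxx h2.
by split=> x; case/andP: (h x) => // /eqP.
Qed.

Definition dotcol m (t bo : {ffun 'I_m -> bool}) (x : dot m) := if x.2 then t x.1 else bo x.1.
Definition compat m (f : bfun m) (t bo : {ffun 'I_m -> bool}) :=
  [forall x, dotcol t bo (f x) == dotcol t bo x].

Lemma compatP m (f : bfun m) t bo :
  reflect (forall x, dotcol t bo (f x) = dotcol t bo x) (compat f t bo).
Proof. by apply: (iffP forallP) => h x; apply/eqP; rewrite h. Qed.

Section Concatenation.
Variables (m : nat) (a b : bfun m).
Hypotheses (da : is_diagram a) (db : is_diagram b).

Let aK : involutive a. Proof. by case/diagramP: da. Qed.
Let bK : involutive b. Proof. by case/diagramP: db. Qed.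
Let aN x : a x != x. Proof. by case/diagramP: da. Qed.
Let bN x : b x != x. Proof. by case/diagramP: db. Qed.

(* The dots of both diagrams; [glue] identifies the bottom of [a] with the top of
   [b] and fixes the outer dots, [arcs2] follows an arc. A strand of the
   composite is an orbit segment of [arcs2 \o glue] between outer dots. *)
Let D := (dot m + dot m)%type.
Let arcs2 (z : D) : D := match z with inl x => inl (a x) | inr x => inr (b x) end.
Let glue (z : D) : D := match z with
  | inl (k, false) => inr (k, true) | inr (k, true) => inl (k, false) | _ => z end.
Let outer (z : D) := glue z == z.
Let out (x : dot m) : D := if x.2 then inl x else inr x.
Let step (z : D) := arcs2 (glue z).

Let arcs2K : involutive arcs2. Proof. by case=> x /=; rewrite ?aK ?bK. Qed.
Let arcs2N z : arcs2 z != z. Proof. by case: z => x; apply/eqP => -[/eqP]; apply/negP; rewrite ?aN ?bN. Qed.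
Let glueK : involutive glue. Proof. by case=> [[k []]|[k []]]. Qed.
Let step_inj : injective step.
Proof. exact: inj_comp (inv_inj arcs2K) (inv_inj glueK). Qed.

Let iter_step_inj i : injective (iter i step).
Proof. by elim: i => [|i IH] z w //= /step_inj /IH. Qed.

Let outer_out x : outer (out x). Proof. by case: x => k []; rewrite /outer /out /= eqxx. Qed.
Let outerP z : outer z -> exists x, z = out x.
Proof. by case: z => [[k []]|[k []]] // _; [exists (k, true)|exists (k, false)]. Qed.
Let out_inj : injective out.
Proof. by move=> [k []] [k' []] // [->]. Qed.

(** [step] is the product of two involutions, so [glue] conjugates it to its inverse: a walk read
    backwards is again a walk. *)
Let step_reverse j z w : iter j step z = w -> iter j step (glue w) = glue z.
Proof.
elim: j z w => [|j IH] z w; first by move=> /= ->.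
rewrite iterS => hw; rewrite iterSr.
have -> : step (glue w) = glue (iter j step z) by rewrite -hw /step glueK arcs2K.
exact: IH.
Qed.

Let first_outer j z := [/\ 0 < j, outer (iter j step z)
  & forall i, 0 < i -> i < j -> ~~ outer (iter i step z)].

(** The dot just reached when [follow] stands at middle position [k]: it lies on the diagram left
    behind, and the next [step] first glues it to the other one. *)
Let state (useA : bool) k : D := if useA then inr (k, true) else inl (k, false).

Let follow_first fuel useA k j : j <= fuel -> first_outer j (state useA k) ->
  out (follow a b fuel useA k) = iter j step (state useA k).
Proof.
elim: fuel useA k j => [|fuel IH] useA k j; first by case: j => // _ [].
case: j => [|j] hj [] // _ ho hmin.
have next useA' k' : step (state useA k) = state useA' k' ->
    out (follow a b fuel useA' k') = iter j.+1 step (state useA k).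
  move=> e1; rewrite iterSr e1; apply: IH => //.
  case: j hj ho hmin => [|j] hj ho hmin.
    by move: ho; rewrite /= e1; case: useA' {e1}.
  split=> //; first by rewrite -e1 -iterSr.
  by move=> i i0 ij; rewrite -e1 -iterSr hmin.
case: useA ho hmin next => ho hmin next /=.
- case ey : (a (k, false)) => [k' [|]] /=.
    have e1 : step (state true k) = out (k', true) by rewrite /step /= ey.
    case: j hj ho hmin {next} => [|j] hj ho hmin; first by rewrite /= e1.
    by have := hmin 1 isT isT; rewrite /= e1 outer_out.
  by apply: next; rewrite /step /= ey.
- case ey : (b (k, true)) => [k' [|]] /=; last first.
    have e1 : step (state false k) = out (k', false) by rewrite /step /= ey.
    case: j hj ho hmin {next} => [|j] hj ho hmin; first by rewrite /= e1.
    by have := hmin 1 isT isT; rewrite /= e1 outer_out.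
  by apply: next; rewrite /step /= ey.
Qed.

(** [step] permutes a finite set, so the walk returns to an outer dot. Before that it visits
    distinct inner dots, of which there are [m.*2]; hence the fuel in [compose] suffices. *)
Let first_outer_exists x : exists2 j, first_outer j (out x) & j <= m.*2.+1.
Proof.
have ex : exists j, (0 < j) && outer (iter j step (out x)).
  exists (fingraph.order step (out x)); rewrite fingraph.order_gt0 /=.
  by rewrite (iter_order step_inj) outer_out.
case: (ex_minnP ex) => j /andP[j0 jo] jmin.
have fo : first_outer j (out x).
  split=> // i i0 ij; apply/negP => io.
  by have := jmin i; rewrite i0 io leqNgt ij => /(_ isT).
exists j => //.
pose s := [seq iter i step (out x) | i <- iota 1 j.-1].
have us : uniq s.
  rewrite map_inj_in_uniq ?iota_uniq // => i i'; rewrite !mem_iota => hi hi' e1.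
  (* A repeated dot would, by injectivity of [step], bring the walk back to [out x] after [i' - i]
     steps, too early. *)
  wlog lt : i i' hi hi' e1 / i < i'.
    by move=> th; case: (ltngtP i i') => // h; [apply: th|apply/esym/th].
  have : iter (i' - i) step (out x) = out x.
    apply: (@iter_step_inj i).
    by rewrite -iterD addnC subnK ?e1 // ltnW.
  case: fo => _ _ /(_ (i' - i)%N) fo e2; move: fo; rewrite e2 outer_out.
  by move=> h; exfalso; move: (h ltac:(lia) ltac:(lia)).
have : size s <= size [seq state t k | t <- [:: true; false], k <- enum 'I_m].
  apply: uniq_leq_size => // z /mapP[i]; rewrite mem_iota => hi ->.
  have no : ~~ outer (iter i step (out x)) by case: fo => _ _; apply; lia.
  apply/allpairsP; move: no; case: (iter i step (out x)) => [[k []]|[k []]] //=;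
    rewrite /outer /= ?eqxx // => _.
    by exists (false, k); rewrite !mem_enum.
  by exists (true, k); rewrite !mem_enum.
rewrite size_map size_iota size_allpairs -cardE card_ord /=; lia.
Qed.

Let compose_first x j : first_outer j (out x) -> out (compose a b x) = iter j step (out x).
Proof.
move=> fo; have hj : j <= m.*2.+1.
  have [j' [j'0 fo' h'] hj'] := first_outer_exists x.
  case: fo => j0 fo h; apply: leq_trans hj'; rewrite leqNgt; apply/negP => lt.
  by move: (h _ j'0 lt); rewrite fo'.
rewrite ffunE; case: j fo hj => [[]|j] // fo hj.
have next useA k : step (out x) = state useA k ->
    out (follow a b m.*2.+2 useA k) = iter j.+1 step (out x).
  move=> e1; case: fo => _ fo h; rewrite iterSr e1; apply: follow_first; first by lia.
  case: j hj fo h => [|j] hj fo h.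
    by move: fo; rewrite /= e1; case: useA {e1}.
  split=> //; first by rewrite -e1 -iterSr.
  by move=> i i0 ij; rewrite -e1 -iterSr h.
have stop y : step (out x) = out y -> out y = iter j.+1 step (out x).
  move=> e1; case: fo => _ _ h; case: j hj h {next} => [|j] hj h; first by rewrite /= e1.
  by have := h 1 isT isT; rewrite /= e1 outer_out.
case: x fo next stop => k [] fo next stop /=.
  case ey : (a (k, true)) => [k' []] /=; first by apply: stop; rewrite /step /out /= ey.
  by apply: (next false k'); rewrite /step /out /= ey.
case ey : (b (k, false)) => [k' []] /=; last by apply: stop; rewrite /step /out /= ey.
by apply: (next true k'); rewrite /step /out /= ey.
Qed.

Let compose_step x : exists2 j, first_outer j (out x) & out (compose a b x) = iter j step (out x).
Proof. by have [j fo _] := first_outer_exists x; exists j => //; apply: compose_first. Qed.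

Lemma compose_diagram : is_diagram (compose a b).
Proof.
have gout x : glue (out x) = out x by apply/eqP; apply: outer_out.
apply/diagramP; split=> x; have [j fo e1] := compose_step x; have [j0 jo jmin] := fo.
  have back : iter j step (out (compose a b x)) = out x.
    by have := step_reverse (esym e1); rewrite !gout.
  apply: out_inj; rewrite -[RHS]back; apply: compose_first; split=> //.
    by rewrite back outer_out.
  move=> i i0 ij; apply/negP => /outerP[w ew].
  have rev := step_reverse ew; rewrite !gout e1 in rev.
  have : out w = iter (j - i) step (out x).
    by apply: (@iter_step_inj i); rewrite -iterD subnKC ?rev // ltnW.
  by move=> ew'; move: (jmin (j - i)%N); rewrite -ew' outer_out => h; move: (h ltac:(lia) ltac:(lia)).
apply/negP => /eqP fx; move: e1; rewrite fx => e1.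
(* A walk that ends where it began is its own reversal. At even length its midpoint is fixed by
   [glue], hence is an outer dot met too early; at odd length the middle arc would join a dot to
   itself. *)
have [i ji] : exists i, j = i.*2 \/ j = i.*2.+1 by exists j./2; lia.
pose w := iter i step (out x).
case: ji => ji.
  have : iter i step w = out x by rewrite /w -iterD addnn -ji -e1.
  move/step_reverse; rewrite gout -/w => e2.
  by move: (jmin i); rewrite /outer -/w -e2 eqxx => h; move: (h ltac:(lia) ltac:(lia)).
have : iter i.+1 step w = out x by rewrite /w -iterD addSn addnn -ji -e1.
move/step_reverse; rewrite gout iterS -/w /step => e2.
by have := arcs2N (glue w); rewrite e2 eqxx.
Qed.

Let colD t mi bo (z : D) := match z with inl x => dotcol t mi x | inr x => dotcol mi bo x end.

Let colD_glue t mi bo z : colD t mi bo (glue z) = colD t mi bo z.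
Proof. by case: z => [[k []]|[k []]]. Qed.

Let colD_out t mi bo x : colD t mi bo (out x) = dotcol t bo x.
Proof. by case: x => k []. Qed.

Let compat_arcs2 t mi bo : compat a t mi && compat b mi bo ->
  forall z, colD t mi bo (arcs2 z) = colD t mi bo z.
Proof. by case/andP => /compatP ha /compatP hb [] x /=. Qed.

Let compat_compose t mi bo : compat a t mi -> compat b mi bo -> compat (compose a b) t bo.
Proof.
move=> ha hb; have hab : compat a t mi && compat b mi bo by rewrite ha.
apply/compatP => x; have [j _ e1] := compose_step x.
rewrite -!(colD_out t mi bo) e1; elim: j {e1} => //= j <-.
by rewrite /step compat_arcs2 // colD_glue.
Qed.

(** Every dot takes the colour of an outer dot on its orbit, and [false] on orbits that form closed
    loops. Reversibility of walks makes this colouring invariant under [glue] as well as under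
    [step], hence along arcs. *)
Let middle_exists t bo : compat (compose a b) t bo ->
  exists mi, compat a t mi && compat b mi bo.
Proof.
move=> /compatP hc.
(* A walk between outer dots is cut at its first return; each piece is a strand of the composite,
   whose ends share a colour. *)
have same j x y : iter j step (out x) = out y -> dotcol t bo x = dotcol t bo y.
  have [N] := ubnP j; elim: N j x => // N IH [|j] x hN; first by move=> /out_inj ->.
  move=> exy; have [i [i0 io imin] e1] := compose_step x.
  have ij : i <= j.+1.
    by rewrite leqNgt; apply/negP => lt; move: (imin j.+1 isT lt); rewrite exy outer_out.
  rewrite -hc; apply: (IH (j.+1 - i)); first by lia.
  by rewrite e1 -iterD subnK.
pose chi z := if [pick x | fconnect step z (out x)] is Some x then dotcol t bo x else false.
have csym := fconnect_sym step_inj.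
have chiE z x : fconnect step z (out x) -> chi z = dotcol t bo x.
  rewrite /chi; case: pickP => [y hy hx|/(_ x)->] //.
  have : fconnect step (out y) (out x) by rewrite -(same_connect csym hy).
  by case/iter_findex => /same.
have chi_step z : chi (step z) = chi z.
  have e1 x : fconnect step (step z) x = fconnect step z x.
    by rewrite (same_connect csym (fconnect1 step z)).
  by rewrite /chi (eq_pick (Q := fun x => fconnect step z (out x))) // => x; rewrite /= e1.
have conn_glue z x : fconnect step z (out x) -> fconnect step (glue z) (out x).
  move/iter_findex/step_reverse; rewrite (eqP (outer_out x)) => <-.
  by rewrite csym fconnect_iter.
have chi_glue z : chi (glue z) = chi z.
  rewrite [in RHS]/chi; case: pickP => [x hx|no]; first exact/chiE/conn_glue.
  by rewrite /chi; case: pickP => // x /conn_glue; rewrite glueK no.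
have chi_arcs z : chi (arcs2 z) = chi z.
  by rewrite -[z in arcs2 z]glueK -[arcs2 _]/(step _) chi_step chi_glue.
pose mi := [ffun k => chi (inl (k, false))].
have chi_out x : chi (out x) = dotcol t bo x by apply: chiE; apply: connect0.
have E z : colD t mi bo z = chi z.
  case: z => [[k []]|[k []]]; rewrite /= /dotcol /= ?ffunE //.
  - by rewrite -[inl (k, true)]/(out (k, true)) chi_out.
  - by rewrite -chi_glue.
  - by rewrite -[inr (k, false)]/(out (k, false)) chi_out.
exists mi; apply/andP; split; apply/compatP => x.
  by rewrite -[LHS]/(colD t mi bo (arcs2 (inl x))) -[RHS]/(colD t mi bo (inl x)) !E.
by rewrite -[LHS]/(colD t mi bo (arcs2 (inr x))) -[RHS]/(colD t mi bo (inr x)) !E.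
Qed.

Let zero : {ffun 'I_m -> bool} := [ffun=> false].
Let middles t bo := [set mi | compat a t mi && compat b mi bo].
Let e := mid_edge a b.

(** Compatibility is linear over the field with two elements, so the solutions for given outer
    colours are a translate of those for zero outer colours. *)
Let middles_shift t bo mi0 : mi0 \in middles t bo -> #|middles t bo| = #|middles zero zero|.
Proof.
pose add (mi mi' : {ffun 'I_m -> bool}) := [ffun k => mi k (+) mi' k].
have addE t1 b1 t2 b2 x : dotcol (add t1 t2) (add b1 b2) x = dotcol t1 b1 x (+) dotcol t2 b2 x.
  by rewrite /dotcol; case: ifP; rewrite ffunE.
have addK mi : cancel (add^~ mi) (add^~ mi).
  by move=> mi'; apply/ffunP => k; rewrite !ffunE addbK.
have addz mi : add mi mi = zero by apply/ffunP => k; rewrite !ffunE addbb.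
have addm t1 b1 t2 b2 mi1 mi2 : mi1 \in middles t1 b1 -> mi2 \in middles t2 b2 ->
    add mi1 mi2 \in middles (add t1 t2) (add b1 b2).
  rewrite !inE => /andP[/compatP h1 /compatP h2] /andP[/compatP h3 /compatP h4].
  by apply/andP; split; apply/compatP => x; rewrite !addE ?h1 ?h2 ?h3 ?h4.
move=> h0; have -> : middles zero zero = (add^~ mi0) @: middles t bo.
  apply/setP => mi; apply/idP/imsetP => [hmi|[mi' h' ->]]; last first.
    by have := addm _ _ _ _ _ _ h' h0; rewrite !addz.
  exists (add mi mi0); last by rewrite addK.
  have z0 t' : add zero t' = t' by apply/ffunP => k; rewrite !ffunE.
  by have := addm _ _ _ _ _ _ hmi h0; rewrite !z0.
by rewrite card_imset //; apply: can_inj (addK mi0).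
Qed.

Let mid_edge_sym : symmetric e.
Proof.
by move=> k k'; rewrite /e /mid_edge; do 4!case: eqP.
Qed.

Let e_connect_sym : connect_sym e. Proof. exact: sym_connect_sym mid_edge_sym. Qed.

(** An outer dot forces the colour [false] on its whole component, so only closed loops keep a free
    colour. *)
Let middles0P (mi : {ffun 'I_m -> bool}) : reflect ((forall k k', connect e k k' -> mi k = mi k') /\
    (forall k, mi k -> in_loop a b k)) (mi \in middles zero zero).
Proof.
apply: (iffP idP); rewrite inE.
- case/andP=> /compatP ha /compatP hb.
  have edge k k' : e k k' -> mi k = mi k'.
    have ca k1 k2 : a (k1, false) = (k2, false) -> mi k2 = mi k1.
      by move=> e1; have := ha (k1, false); rewrite e1.
    have cb k1 k2 : b (k1, true) = (k2, true) -> mi k2 = mi k1.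
      by move=> e1; have := hb (k1, true); rewrite e1.
    by case/or4P=> /eqP => [/ca|/ca|/cb|/cb].
  have con k k' : connect e k k' -> mi k = mi k'.
    case/connectP=> s; elim: s k => [|x s IH] k /=; first by move=> _ ->.
    by case/andP=> /edge -> hs /(IH _ hs).
  split=> // k hk; apply/forallP => k'; apply/implyP => /con e1; move: hk; rewrite e1 => hk'.
  rewrite /touches_outer negb_or negbK; apply/andP; split.
    by have := ha (k', false); rewrite /dotcol /= ffunE hk'; case: ifP.
  by have := hb (k', true); rewrite /dotcol /= ffunE hk'; case: ifP.
- case=> con loop.
  have out0 k : touches_outer a b k -> mi k = false.
    move=> tk; apply/negP => /loop /forallP /(_ k); rewrite connect0 /=.
    by rewrite tk.
  apply/andP; split; apply/compatP => -[k []].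
  + case ek : (a (k, true)) => [k' []]; rewrite /dotcol /= !ffunE //.
    by rewrite out0 // /touches_outer -ek aK.
  + case ek : (a (k, false)) => [k' []]; rewrite /dotcol /= ?ffunE.
      by rewrite out0 // /touches_outer ek.
    by rewrite (con k' k) // connect1 // /e /mid_edge ek eqxx orbT.
  + case ek : (b (k, true)) => [k' []]; rewrite /dotcol /= ?ffunE.
      by rewrite (con k' k) // connect1 // /e /mid_edge ek eqxx !orbT.
    by rewrite out0 // /touches_outer ek orbT.
  + case ek : (b (k, false)) => [k' []]; rewrite /dotcol /= !ffunE //.
    by rewrite out0 // /touches_outer -ek bK orbT.
Qed.

Let in_loop_connect k k' : connect e k k' -> in_loop a b k = in_loop a b k'.
Proof.
move=> hk; apply/forallP/forallP => h x; have := h x.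
  by rewrite -/e (same_connect e_connect_sym hk).
by rewrite -/e (same_connect e_connect_sym hk).
Qed.

(** A compatible colouring amounts to a set of closed loops, each loop being represented by its
    [root]. *)
Let middles0_card : #|middles zero zero| = 2 ^ nloops a b.
Proof.
pose R := [set k | roots e k && in_loop a b k].
have -> : nloops a b = #|R|.
  by rewrite /nloops /n_comp_mem; apply: eq_card => k; rewrite !inE.
pose g (S : {set 'I_m}) : {ffun 'I_m -> bool} := [ffun k => fingraph.root e k \in S].
have -> : middles zero zero = g @: powerset R.
  apply/setP => mi; apply/middles0P/imsetP => [[con loop]|[S]].
    exists [set k in R | mi k]; first by rewrite inE; apply/subsetP => k; rewrite inE => /andP[].
    apply/ffunP => k; rewrite ffunE !inE roots_root // (con _ _ (connect_root e k)).
    case: (boolP (mi _)) => [h|]; last by rewrite andbF.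
    by rewrite loop.
  rewrite inE => /subsetP hS ->; split=> [k k' hk|k]; rewrite !ffunE.
    by rewrite (fingraph.rootP e_connect_sym hk).
  by move/hS; rewrite inE (in_loop_connect (connect_root e k)) => /andP[].
rewrite card_in_imset ?card_powerset // => S S'; rewrite !inE => /subsetP hS /subsetP hS' /ffunP eg.
have mem (U : {set 'I_m}) k : {subset U <= R} -> k \in R -> (k \in U) = g U k.
  by move=> hU; rewrite inE ffunE => /andP[/eqP->].
apply/setP => k; case: (boolP (k \in R)) => hk; first by rewrite (mem _ _ hS) // (mem _ _ hS').
by apply/idP/idP => [/hS|/hS'] h; rewrite h in hk.
Qed.

(** The left side is an entry of the product of two colouring matrices; this is where a loop becomes
    a factor 2. *)
Lemma card_middles t bo : #|[set mi | compat a t mi && compat b mi bo]| =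
  compat (compose a b) t bo * 2 ^ nloops a b.
Proof.
case: (boolP (compat (compose a b) t bo)) => hc.
  have [mi hmi] := middle_exists hc.
  by rewrite mul1n -middles0_card -(@middles_shift t bo mi) // inE.
rewrite mul0n; apply/eqP; rewrite cards_eq0; apply/eqP/setP => mi; rewrite !inE.
by apply/negbTE; apply: contra hc => /andP[]; apply: compat_compose.
Qed.

End Concatenation.

Lemma compat_inj m (f g : bfun m) : is_diagram f -> is_diagram g -> compat f =2 compat g -> f = g.
Proof.
move=> /diagramP[fK fN] /diagramP[gK gN] efg; apply/ffunP => x.
(* The test colouring marks [x] and [f x] only. Compatibility with [g] then forces [g x] into this
   pair. *)
pose c y := (y == x) || (y == f x).
pose t := [ffun k => c (k, true)]; pose bo := [ffun k => c (k, false)].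
have colE y : dotcol t bo y = c y by case: y => k []; rewrite /dotcol /= ffunE.
have : compat f t bo.
  by apply/compatP => y; rewrite !colE /c orbC (inj_eq (inv_inj fK)) (inv_eq fK).
rewrite efg => /compatP /(_ x); rewrite !colE /c eqxx /= => /orP[/eqP gx|/eqP //].
by have := gN x; rewrite gx eqxx.
Qed.

Local Open Scope group_scope.

(** * The hyperoctahedral group *)

Section SymmetricPermutations.
Variables (T : finType) (sg : T -> T).
Hypotheses (sgK : involutive sg) (sgN : forall x, sg x != x).
Implicit Types (a b c x : T) (u v : {perm T}).

Definition symp u := [forall x, u (sg x) == sg (u x)].

Lemma sympP u : reflect (forall x, u (sg x) = sg (u x)) (symp u).
Proof. by apply: (iffP forallP) => h x; apply/eqP; rewrite h. Qed.

Lemma symp1 : symp 1.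
Proof. by apply/sympP => x; rewrite !perm1. Qed.

Lemma sympM u v : symp u -> symp v -> symp (u * v).
Proof. by move=> /sympP hu /sympP hv; apply/sympP => x; rewrite !permM hu hv. Qed.

Lemma sympV u : symp u -> symp u^-1.
Proof.
move=> /sympP hu; apply/sympP => x.
by apply: (@perm_inj _ u); rewrite hu !permKV.
Qed.

Lemma sg_eq a b : (sg a == sg b) = (a == b).
Proof. exact: (inj_eq (inv_inj sgK)). Qed.

Lemma sg_eqC a b : (sg a == b) = (a == sg b).
Proof. by rewrite -sg_eq sgK. Qed.

(** The reflections of the hyperoctahedral group: a sign change when [b] mirrors [a], a pair of
    mirror transpositions otherwise. *)
Definition refl a b : {perm T} :=
  if b == sg a then tperm a b else tperm a b * tperm (sg a) (sg b).

Lemma refl_neq a b : b != sg a -> refl a b = tperm a b * tperm (sg a) (sg b).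
Proof. by rewrite /refl => /negbTE->. Qed.

Lemma reflE a b x : refl a b x =
  if x == a then b else if x == b then a else
  if x == sg a then sg b else if x == sg b then sg a else x.
Proof.
have E : (sg a == a) = false by apply: negbTE.
have E' : (sg b == b) = false by apply: negbTE.
rewrite /refl; case: (eqVneq b (sg a)) => [->|hb].
  by rewrite permE /= sgK; case: eqVneq => // _; case: eqVneq.
rewrite permM; have hb' : sg b == a = false by rewrite sg_eqC; apply/negbTE.
case: (eqVneq x a) => [->|h1]; first by rewrite tpermL permE /= (negbTE hb) eq_sym E'.
case: (eqVneq x b) => [->|h2]; last by rewrite permE /= permE /= (negbTE h1) (negbTE h2).
by rewrite tpermR permE /= [a == sg a]eq_sym E eq_sym hb'.
Qed.

Lemma symp_refl a b : symp (refl a b).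
Proof.
apply/sympP => x; rewrite !reflE !sg_eq !sg_eqC.
have N c : (c == sg c) = false by rewrite eq_sym; apply: negbTE.
case: (eqVneq x a) => [->|h1]; first by rewrite N; case: eqVneq.
case: (eqVneq x b) => [->|h2]; first by rewrite N; case: eqVneq => [->|]; rewrite ?sgK.
case: (eqVneq x (sg a)) => [_|h3]; first by rewrite sgK.
by case: (eqVneq x (sg b)) => [_|h4] //; rewrite sgK.
Qed.

Lemma refl_l a b : refl a b a = b.
Proof. by rewrite reflE eqxx. Qed.

Lemma refl_r a b : refl a b b = a.
Proof. by rewrite reflE eqxx; case: eqVneq. Qed.

Lemma refl_id a b x : x != a -> x != b -> x != sg a -> x != sg b -> refl a b x = x.
Proof. by rewrite reflE; do 4 move=> /negbTE->. Qed.

Lemma reflC a b : refl a b = refl b a.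
Proof.
apply/permP => x; rewrite !reflE.
case: (eqVneq x a) => [->|h1]; first by case: eqVneq.
case: (eqVneq x b) => // h2.
by case: (eqVneq x (sg a)) => [->|//]; case: eqVneq => [->|].
Qed.

Lemma reflK a b : refl a b * refl a b = 1.
Proof.
apply/permP => x; rewrite permM perm1.
have h := symp_refl a b; move/sympP: h => h.
rewrite [refl a b x]reflE.
case: (eqVneq x a) => [->|h1]; first exact: refl_r.
case: (eqVneq x b) => [->|h2]; first exact: refl_l.
case: (eqVneq x (sg a)) => [->|h3]; first by rewrite h refl_r.
case: (eqVneq x (sg b)) => [->|h4]; first by rewrite h refl_l.
exact: refl_id.
Qed.

Lemma reflV a b : (refl a b)^-1 = refl a b.
Proof. by apply: (mulgI (refl a b)); rewrite mulgV reflK. Qed.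

Lemma refl_conj u a b : symp u -> u^-1 * refl a b * u = refl (u a) (u b).
Proof.
move=> /sympP hu; apply/permP => x.
rewrite !permM !reflE -!hu -[in RHS](permKV u x) !(inj_eq perm_inj).
by case: ifP => // _; case: ifP => // _; case: ifP => // _; case: ifP.
Qed.

Lemma refl_conjC u a b : symp u -> refl a b * u = u * refl (u a) (u b).
Proof. by move=> hu; rewrite -refl_conj // !mulgA mulgV mul1g. Qed.

End SymmetricPermutations.

(** * Coset normal forms for words in Coxeter generators of type B *)

Section CoxeterCosets.
Variables (n : nat) (N : monoidType) (r : nat -> N).

Definition coxeterC : Prop :=
  [/\ forall i, i < n -> r i * r i = 1,
      forall i j, i.+1 < j -> j < n -> r i * r j = r j * r i,
      forall i, 0 < i -> i.+1 < n -> r i * r i.+1 * r i = r i.+1 * r i * r i.+1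
    & 1 < n -> r 1%N * r 0%N * r 1%N * r 0%N = r 0%N * r 1%N * r 0%N * r 1%N].

Definition prodw (w : seq nat) : N := \prod_(i <- w) r i.

Lemma prodw_cat v w : prodw (v ++ w) = prodw v * prodw w.
Proof. exact: big_cat. Qed.

Lemma prodw_cons i w : prodw (i :: w) = r i * prodw w.
Proof. exact: big_cons. Qed.

Lemma prodw1 i : prodw [:: i] = r i.
Proof. by rewrite prodw_cons /prodw big_nil mulg1. Qed.

Lemma prodw_rcons i w : prodw (rcons w i) = prodw w * r i.
Proof. by rewrite -cats1 prodw_cat prodw1. Qed.

(** Representatives for the cosets of the subgroup on letters below [k] in the one on letters up to
    [k]: the words k ... j+1 and k ... 1 0 1 ... j, with j at most k. Applied to strand [k], they
    produce strand [j] and its mirror image respectively. *)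
Definition dword k j := rev (iota j.+1 (k - j)).
Definition uword k j := dword k 0 ++ iota 0 j.+1.
Definition cword k (t : bool * nat) := if t.1 then uword k t.2 else dword k t.2.

Lemma dwordS k j : j < k -> dword k j = rcons (dword k j.+1) j.+1.
Proof.
move=> h; rewrite /dword -rev_cons; congr rev.
by rewrite -[(k - j)%N]prednK ?subn_gt0 //= subnS.
Qed.

Lemma dwordk k : dword k k = [::].
Proof. by rewrite /dword subnn. Qed.

Lemma uwordS k j : uword k j.+1 = rcons (uword k j) j.+1.
Proof. by rewrite /uword -[j.+2]addn1 iotaD catA cats1. Qed.

Lemma uword0 k : uword k 0 = rcons (dword k 0) 0.
Proof. by rewrite /uword -cats1. Qed.

Hypothesis cox : coxeterC.
Let rK i : i < n -> r i * r i = 1. Proof. by case: cox => h _ _ _; apply: h. Qed.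
Let rC i j : i.+1 < j -> j < n -> r i * r j = r j * r i.
Proof. by case: cox => _ h _ _; apply: h. Qed.
Let rB i : 0 < i -> i.+1 < n -> r i * r i.+1 * r i = r i.+1 * r i * r i.+1.
Proof. by case: cox => _ _ h _; apply: h. Qed.
Let rB0 : 1 < n -> r 1%N * r 0%N * r 1%N * r 0%N = r 0%N * r 1%N * r 0%N * r 1%N.
Proof. by case: cox. Qed.

Variable k : nat.
Hypothesis kn : k < n.
Let D j := prodw (dword k j).
Let U j := prodw (uword k j).

Let DS j : j < k -> D j = D j.+1 * r j.+1.
Proof. by move=> h; rewrite /D dwordS // prodw_rcons. Qed.
Let Dk : D k = 1. Proof. by rewrite /D dwordk /prodw big_nil. Qed.
Let U0 : U 0%N = D 0%N * r 0%N. Proof. by rewrite /U uword0 prodw_rcons. Qed.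
Let US j : U j.+1 = U j * r j.+1. Proof. by rewrite /U uwordS prodw_rcons. Qed.

(** This and the next three lemmas are exchange rules: a letter far below the turning point [j]
    passes unchanged, one above [j.+1] passes with its index lowered by one through a braid move.
    Only the letters [j] and [j.+1] lengthen or shorten the coset word. *)
Lemma dword_lt i j : i < j -> j <= k -> D j * r i = r i * D j.
Proof.
move=> hi; have [m] := ubnP (k - j); elim: m j hi => // m IH j hi hm hj.
move: hj; rewrite leq_eqVlt => /orP[/eqP->|hj]; first by rewrite Dk mul1g mulg1.
rewrite DS // -mulgA -rC; [|lia|lia].
by rewrite mulgA IH; [rewrite mulgA|lia|lia|lia].
Qed.

Lemma dword_gt i j : j.+1 < i -> i <= k -> D j * r i = r i.-1 * D j.
Proof.
move=> hi hk; have [m] := ubnP (i - j); elim: m j hi => // m IH j hi hm.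
have [e|hj] := eqVneq i j.+2; last first.
  rewrite DS; last by lia.
  by rewrite -mulgA rC; [rewrite mulgA IH ?mulgA //; lia|lia|lia].
subst i; rewrite DS; last by lia. rewrite DS; last by lia.
rewrite -!mulgA [r _ * (r _ * r _)]mulgA -rB; [|lia|lia].
by rewrite !mulgA /= dword_lt //; lia.
Qed.

Lemma uword_gt i j : j.+1 < i -> i <= k -> U j * r i = r i.-1 * U j.
Proof.
elim: j => [|j IH] hi hk.
  by rewrite U0 -mulgA rC ?mulgA ?dword_gt //; lia.
by rewrite US -mulgA rC ?mulgA ?IH //; lia.
Qed.

Lemma uword_lt i j : i < j -> j <= k -> U j * r i = r i * U j.
Proof.
elim: j => // j IH hi hk; rewrite US.
have [hij|hij] := ltnP i j.
  rewrite -mulgA -rC; [|lia|lia].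
  by rewrite mulgA IH ?mulgA //; lia.
have e : i = j by lia.
subst i; case: j {hi hij} IH hk => [|j] IH hk; last first.
  rewrite US -!mulgA [r _ * (r _ * r _)]mulgA rB; [|lia|lia].
  by rewrite !mulgA uword_gt //; lia.
rewrite U0 DS; last by lia.
have := rB0; rewrite -!mulgA => -> //; last by lia.
by rewrite !mulgA dword_lt //; lia.
Qed.

(** Right multiplication by a letter permutes the cosets: either the representative changes, or the
    letter passes to its left as a smaller letter and joins [v]. *)
Lemma coset_normal_form w : all (fun i => i <= k) w ->
  exists v t, [/\ all (fun i => i < k) v, t.2 <= k & prodw w = prodw v * prodw (cword k t)].
Proof.
elim/last_ind: w => [|w i IH].
  by move=> _; exists [::], (false, k); rewrite /cword /= dwordk /prodw big_nil mulg1.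
rewrite all_rcons => /andP[hi /IH [v [[b j] /= [hv hj e]]]] {IH}.
rewrite prodw_rcons e -mulgA.
have step i' : i' < k -> prodw (cword k (b, j)) * r i = r i' * prodw (cword k (b, j)) ->
  exists v0 t, [/\ all (fun i => i < k) v0, t.2 <= k &
    prodw v * (prodw (cword k (b, j)) * r i) = prodw v0 * prodw (cword k t)].
  move=> hi' ->; exists (rcons v i'), (b, j); rewrite all_rcons hi' hv; split=> //.
  by rewrite prodw_rcons -!mulgA.
have stay b' j' : j' <= k -> prodw (cword k (b, j)) * r i = prodw (cword k (b', j')) ->
  exists v0 t, [/\ all (fun i => i < k) v0, t.2 <= k &
    prodw v * (prodw (cword k (b, j)) * r i) = prodw v0 * prodw (cword k t)].
  by move=> hj' ->; exists v, (b', j').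
case: b {e} step stay => step stay; rewrite /cword /= in step stay *.
- case: (ltngtP i j) => hij.
  + by apply: (step i); [lia|exact: uword_lt].
  + have [e|h] := eqVneq i j.+1; first by apply: (stay true i) => //; rewrite e -US.
    by apply: (step i.-1); [lia|apply: uword_gt; lia].
  + subst j; case: i hi hj {step} stay => [|i] hi hj stay.
      by apply: (stay false 0%N) => //; rewrite -/(U 0) U0 -mulgA rK ?mulg1 //; lia.
    by apply: (stay true i); [lia|rewrite -/(U _) US -mulgA rK ?mulg1 //; lia].
- case: (ltngtP i j) => hij.
  + by apply: (step i); [lia|exact: dword_lt].
  + have [e|h] := eqVneq i j.+1; last by apply: (step i.-1); [lia|apply: dword_gt; lia].
    apply: (stay false i) => //=; rewrite -/(D _) DS; last by lia.
    by rewrite e -mulgA rK ?mulg1 //; lia.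
  + subst j; case: i hi hj {step} stay => [|i] hi hj stay.
      by apply: (stay true 0%N) => //; rewrite -/(D _) -U0.
    by apply: (stay false i); [lia|rewrite -DS //; lia].
Qed.

End CoxeterCosets.

(** * The Coxeter presentation of the hyperoctahedral group *)

Section Hyperoctahedral.
Variables (T : finType) (sg : T -> T).
Hypotheses (sgK : involutive sg) (sgN : forall x, sg x != x).
Variables (n : nat) (p : nat -> T).

(** A choice of one strand from each mirror pair, numbered outwards from the axis in the
    application. *)
Definition strand_frame : Prop :=
  [/\ forall i j, i < n -> j < n -> p i = p j -> i = j,
      forall i j, i < n -> j < n -> p i != sg (p j)
    & forall x, exists2 i, i < n & x = p i \/ x = sg (p i)].
Hypothesis frame : strand_frame.

Let p_eq i j : i < n -> j < n -> (p i == p j) = (i == j).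
Proof.
move=> hi hj; case: frame => h _ _.
by apply/eqP/eqP => [/h->|->].
Qed.
Let p_sg i j : i < n -> j < n -> (p i == sg (p j)) = false.
Proof. by case: frame => _ h _ hi hj; apply/negbTE/h. Qed.

Definition srefl i : {perm T} := refl sg (p i.-1) (if i is 0 then sg (p 0%N) else p i).

Let symp_s i : symp sg (srefl i). Proof. exact: symp_refl. Qed.

Let symp_prod w : symp sg (prodw srefl w).
Proof.
elim: w => [|i w IH]; first by rewrite /prodw big_nil symp1.
by rewrite prodw_cons sympM.
Qed.

Lemma srefl_id i j : i < n -> j < n -> j != i -> j.+1 != i -> srefl i (p j) = p j.
Proof.
move=> hi hj h1 h2; rewrite /srefl.
by case: i hi h1 h2 => [|i] hi h1 h2 /=; apply: refl_id;
   rewrite ?sgK ?p_eq ?p_sg //; lia.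
Qed.

Lemma srefl0 : srefl 0 (p 0%N) = sg (p 0%N). Proof. exact: refl_l. Qed.
Lemma sreflS i : srefl i.+1 (p i) = p i.+1. Proof. exact: refl_l. Qed.
Lemma srefl_pred i : srefl i.+1 (p i.+1) = p i. Proof. exact: refl_r. Qed.
Lemma srefl_sg i x : srefl i (sg x) = sg (srefl i x).
Proof. by move/sympP: (symp_s i) => ->. Qed.

Lemma srefl_coxeter : coxeterC n srefl.
Proof.
have K i : srefl i * srefl i = 1 by apply: reflK.
have conj u a b : symp sg u -> u * u = 1 -> u * refl sg a b * u = refl sg (u a) (u b).
  by move=> hu huu; rewrite -[RHS]refl_conj // -[u^-1]mul1g -huu mulgK.
split=> // [i j hij hj|i hi hin|hn].
- have symi := symp_s i; case: j hij hj => // j hij hj.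
  rewrite [srefl j.+1]/srefl /= -[RHS]/(_ * srefl i) refl_conjC // !srefl_id //; lia.
- case: i hi hin => // i _ hi.
  have E1 : srefl i.+1 * srefl i.+2 * srefl i.+1 = refl sg (p i) (p i.+2).
    rewrite [srefl i.+2]/srefl /= conj // srefl_pred srefl_id //; lia.
  have E2 : srefl i.+2 * srefl i.+1 * srefl i.+2 = refl sg (p i) (p i.+2).
    rewrite [srefl i.+1]/srefl /= conj // sreflS srefl_id //; lia.
  by rewrite E1 E2.
- have E : srefl 1 * srefl 0 * srefl 1 = refl sg (p 1%N) (sg (p 1%N)).
    by rewrite [srefl 0]/srefl /= conj // srefl_sg sreflS.
  rewrite E -[RHS]mulgA -[RHS]mulgA [srefl 1 * _]mulgA E.
  by rewrite refl_conjC // srefl_sg srefl_id //; lia.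
Qed.

Let dword_image k j : j <= k -> k < n -> prodw srefl (dword k j) (p k) = p j.
Proof.
move=> hj hk; have [m] := ubnP (k - j); elim: m j hj => // m IH j.
rewrite leq_eqVlt => /orP[/eqP-> _|hj hm]; first by rewrite dwordk /prodw big_nil perm1.
rewrite dwordS // prodw_rcons permM IH //; last by lia.
exact: srefl_pred.
Qed.

Let uword_image k j : j <= k -> k < n -> prodw srefl (uword k j) (p k) = sg (p j).
Proof.
move=> hj hk; elim: j hj => [|j IH] hj.
  by rewrite uword0 prodw_rcons permM dword_image // srefl0.
by rewrite uwordS prodw_rcons permM IH ?srefl_sg ?sreflS //; lia.
Qed.

Let cword_image k t : t.2 <= k -> k < n ->
  prodw srefl (cword k t) (p k) = if t.1 then sg (p t.2) else p t.2.
Proof. by case: t => [[] j] hj hk; rewrite /cword /= ?uword_image ?dword_image. Qed.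

Let prod_fix k w : k < n -> all (fun i => i < k) w -> prodw srefl w (p k) = p k.
Proof.
move=> hk; elim: w => [|i w IH /= /andP[hi hw]]; first by rewrite /prodw big_nil perm1.
by rewrite prodw_cons permM srefl_id ?IH //; lia.
Qed.

Let cword_all k t : t.2 <= k -> all (fun i => i < k.+1) (cword k t).
Proof.
case: t => b j /= hj.
have D j' : all (fun i => i < k.+1) (dword k j').
  by rewrite all_rev; apply/allP => i; rewrite mem_iota; lia.
rewrite /cword; case: b; last exact: D.
rewrite [X in all _ X]/(uword k j) /uword all_cat D.
by apply/allP => i; rewrite mem_iota /=; lia.
Qed.

(** The case [k = n] says that the simple reflections generate. The cases [n.-1] and [n.-2] later
    turn the stabilisers of one and of two strands into words. *)
Lemma srefl_word_exists k u : k <= n -> symp sg u ->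
  (forall i, k <= i -> i < n -> u (p i) = p i) ->
  exists2 w, all (fun i => i < k) w & prodw srefl w = u.
Proof.
elim: k u => [|k IH] u hk hu fix_u.
  exists [::] => //; rewrite /prodw big_nil; apply/permP => x.
  case: frame => _ _ /(_ x) [i hi []->]; rewrite perm1 ?(sympP _ _ hu) fix_u //.
(* The image of strand [k] names the coset of [u]; its index is at most [k] because the strands
   beyond [k] are fixed. *)
have [t ht e] : exists2 t : bool * nat, t.2 <= k & u (p k) = if t.1 then sg (p t.2) else p t.2.
  case: frame => pI _ /(_ (u (p k))) [i hi hpi].
  exists (u (p k) == sg (p i), i) => /=; last first.
    by case: hpi => ->; rewrite ?eqxx // p_sg.
  rewrite leqNgt; apply/negP => hki; have hui := fix_u _ hki hi.
  case: hpi; first by rewrite -hui => /perm_inj /pI; lia.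
  rewrite -hui -(sympP _ _ hu) => /perm_inj /eqP; by rewrite p_sg //; lia.
have hc := @cword_image k t ht hk.
have [] := IH (u * (prodw srefl (cword k t))^-1); first by lia.
- by rewrite sympM ?sympV.
- move=> i hki hi; rewrite permM.
  have [->|hik] := eqVneq i k; first by rewrite e -hc permK.
  rewrite fix_u //; last by lia.
  apply: (@perm_inj _ (prodw srefl (cword k t))); rewrite permKV.
  elim: (cword k t) (cword_all ht) => [_|j w IHw /= /andP[hj hw]].
    by rewrite /prodw big_nil perm1.
  by rewrite prodw_cons permM srefl_id -?IHw //; lia.
move=> w hw ew; exists (w ++ cword k t).
  by rewrite all_cat cword_all // andbT; apply: sub_all hw => i; lia.
by rewrite prodw_cat ew mulgKV.
Qed.

Variables (M : monoidType) (r : nat -> M).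
Hypothesis cox : coxeterC n r.

(* Running the coset argument in [M * {perm T}] produces one normal form that is
   valid in both factors at once, so the permutation pins down the monoid element. *)
Theorem coxeter_presentation u v : all (fun i => i < n) u -> all (fun i => i < n) v ->
  prodw srefl u = prodw srefl v -> prodw r u = prodw r v.
Proof.
pose rs i : (M * {perm T})%type := (r i, srefl i).
have prs w : prodw rs w = (prodw r w, prodw srefl w).
  elim: w => [|i w IH]; first by rewrite /prodw !big_nil.
  by rewrite !prodw_cons IH.
have coxs : coxeterC n rs.
  case: cox srefl_coxeter => [a1 a2 a3 a4] [b1 b2 b3 b4].
  split=> [i hi|i j hij hj|i hi hin|hn].
  - by congr pair; [apply: a1|apply: b1].
  - by congr pair; [apply: a2|apply: b2].
  - by congr pair; [apply: a3|apply: b3].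
  - by congr pair; [apply: a4|apply: b4].
(* The bound on the letters is separated from [n], so that each induction step can strip one coset
   word. *)
have : n <= n by []. move: {1 3 4}n => k.
elim: k u v => [|k IH] u v hk; first by case: u => [|? ?] //; case: v.
move=> hu hv huv.
have [u1 [t1 [hu1 ht1 e1]]] := coset_normal_form coxs hk hu.
have [v1 [t2 [hv1 ht2 e2]]] := coset_normal_form coxs hk hv.
move: e1 e2; rewrite !prs => - [e1 e1'] [e2 e2'].
(* Letters below [k] fix strand [k], so its image under the permutation is decided by the coset word
   alone. *)
have et : t1 = t2.
  have := congr1 (fun w : {perm T} => w (p k)) huv.
  rewrite e1' e2' !permM (prod_fix hk hu1) (prod_fix hk hv1) !cword_image //.
  case: t1 t2 ht1 ht2 {e1 e1' e2 e2'} => [b1 j1] [b2 j2] /= h1 h2.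
  case: b1; case: b2 => /eqP; rewrite ?(inj_eq (inv_inj sgK)) ?p_eq ?p_sg; try lia.
  - by move/eqP->.
  - by rewrite eq_sym p_sg //; lia.
  - by move/eqP->.
rewrite e1 e2 et (IH u1 v1) //; first by lia.
by apply: (@mulIg _ (prodw srefl (cword k t1))); rewrite -e1' et -e2'.
Qed.

Lemma srefl_generate w : symp sg w ->
  exists u, all (fun i => i < n) u && (prodw srefl u == w).
Proof.
move=> hw; have [|u hu eu] := @srefl_word_exists n w (leqnn n) hw; first by lia.
by exists u; rewrite hu eu eqxx.
Qed.

(** A chosen word for a symmetric permutation, with [[::]] as a default elsewhere; hence [tau] is
    multiplicative on symmetric permutations only. *)
Definition tau_word (w : {perm T}) : seq nat :=
  if symp sg w =P true is ReflectT hw then xchoose (srefl_generate hw) else [::].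
Definition tau w : M := prodw r (tau_word w).

Lemma tau_wordP w : symp sg w ->
  all (fun i => i < n) (tau_word w) /\ prodw srefl (tau_word w) = w.
Proof.
rewrite /tau_word; case: eqP => // h _.
by have /andP[-> /eqP] := xchooseP (srefl_generate h).
Qed.

Lemma tau_prod u : all (fun i => i < n) u -> tau (prodw srefl u) = prodw r u.
Proof.
move=> hu; have [h1 h2] := tau_wordP (symp_prod u).
exact: coxeter_presentation.
Qed.

Lemma tau_srefl i : i < n -> tau (srefl i) = r i.
Proof. by move=> hi; rewrite -[srefl i](prodw1 srefl) tau_prod /= ?hi // prodw1. Qed.

Lemma tau1 : tau 1 = 1.
Proof. by have := @tau_prod [::] isT; rewrite /prodw !big_nil. Qed.

Lemma tauM u v : symp sg u -> symp sg v -> tau (u * v) = tau u * tau v.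
Proof.
move=> hu hv; have [u1 u2] := tau_wordP hu; have [v1 v2] := tau_wordP hv.
by rewrite -{1}u2 -{1}v2 -prodw_cat tau_prod ?prodw_cat // all_cat u1.
Qed.

Lemma tauV u : symp sg u -> tau u * tau u^-1 = 1.
Proof. by move=> hu; rewrite -tauM ?sympV // mulgV tau1. Qed.

Lemma tauVl u : symp sg u -> tau u^-1 * tau u = 1.
Proof. by move=> hu; rewrite -tauM ?sympV // mulVg tau1. Qed.

End Hyperoctahedral.

(** * Normal forms in the monoid *)

Section CommutingIdempotents.
Variables (N : monoidType) (I : eqType) (F : I -> N).
Implicit Types (l : seq I) (x y : N).

Lemma commute_prodl x l : (forall i, i \in l -> x * F i = F i * x) ->
  x * \prod_(i <- l) F i = (\prod_(i <- l) F i) * x.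
Proof.
elim: l => [|i l IH] h; first by rewrite big_nil mul1g mulg1.
rewrite big_cons mulgA h ?mem_head // -!mulgA IH // => j hj.
by rewrite h // inE hj orbT.
Qed.

Lemma prod_absorb_l x l : (forall i, i \in l -> F i * x = x) -> (\prod_(i <- l) F i) * x = x.
Proof.
elim: l => [|i l IH] h; first by rewrite big_nil mul1g.
by rewrite big_cons -mulgA IH ?h ?mem_head // => j hj; rewrite h // inE hj orbT.
Qed.

Lemma prod_absorb_r x l : (forall i, i \in l -> x * F i = x) -> x * (\prod_(i <- l) F i) = x.
Proof.
elim: l => [|i l IH] h; first by rewrite big_nil mulg1.
by rewrite big_cons mulgA h ?mem_head // IH // => j hj; rewrite h // inE hj orbT.
Qed.

Lemma factor_absorb_l i l : (forall j, j \in l -> F i * F j = F j * F i) ->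
  F i * F i = F i -> i \in l -> F i * (\prod_(j <- l) F j) = \prod_(j <- l) F j.
Proof.
elim: l => // j l IH h ii; rewrite inE big_cons.
have [e _|ij /= il] := eqVneq i j; first by rewrite -e mulgA ii.
rewrite mulgA h ?mem_head // -mulgA IH // => k hk.
by rewrite h // inE hk orbT.
Qed.

(* A product of commuting idempotents only depends on the set of its factors. *)
Lemma prod_idem_eq l l' :
  (forall i j, i \in l ++ l' -> j \in l ++ l' -> F i * F j = F j * F i) ->
  (forall i, i \in l ++ l' -> F i * F i = F i) ->
  (forall i, i \in l -> exists2 j, j \in l' & F i = F j) ->
  (forall i, i \in l' -> exists2 j, j \in l & F i = F j) ->
  \prod_(i <- l) F i = \prod_(i <- l') F i.
Proof.
move=> hC hI h1 h2.
have inl i : i \in l -> i \in l ++ l' by rewrite mem_cat => ->.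
have inr i : i \in l' -> i \in l ++ l' by rewrite mem_cat => ->; rewrite orbT.
have e1 : (\prod_(i <- l) F i) * (\prod_(i <- l') F i) = \prod_(i <- l') F i.
  apply: prod_absorb_l => i /h1 [j hj ->].
  apply: factor_absorb_l => // [k hk|]; last by rewrite hI // inr.
  by rewrite hC // inr.
rewrite -{}e1; apply/esym/prod_absorb_r => i /h2 [j hj ->].
rewrite -commute_prodl => [|k hk]; last by rewrite hC // inl.
apply: factor_absorb_l => // [k hk|]; last by rewrite hI // inl.
by rewrite hC // inl.
Qed.

End CommutingIdempotents.

(** * The type C Brauer monoid: arc elements and normal forms *)

Section BrauerMonoid.
Variables (T : finType) (sg : T -> T).
Hypotheses (sgK : involutive sg) (sgN : forall x, sg x != x).
Variables (n : nat) (p : nat -> T).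
Hypotheses (frame : strand_frame sg n p) (n_gt1 : 1 < n).
Variables (M : monoidType) (r e : nat -> M).

(* The defining relations of Br(C_n) at [delta = 1]. *)
Record brauerC : Prop := BrauerC {
  brauer_cox : coxeterC n r;
  brauer_re i : i < n -> r i * e i = e i;
  brauer_er i : i < n -> e i * r i = e i;
  brauer_ee i : i < n -> e i * e i = e i;
  brauer_erC i j : i < n -> j < n -> (i.+1 < j) || (j.+1 < i) -> e i * r j = r j * e i;
  brauer_eeC i j : i < n -> j < n -> i.+1 < j -> e i * e j = e j * e i;
  brauer_rre i : 0 < i -> i.+1 < n -> r i * r i.+1 * e i = e i.+1 * e i;
  brauer_rer i : 0 < i -> i.+1 < n -> r i * e i.+1 * r i = r i.+1 * e i * r i.+1;
  brauer_C2 : r 1%N * r 0%N * e 1%N = r 0%N * e 1%N;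
  brauer_C3 : r 1%N * e 0%N * r 1%N * e 0%N = e 0%N * e 1%N * e 0%N;
  brauer_C4 : r 1%N * r 0%N * r 1%N * e 0%N = e 0%N * r 1%N * r 0%N * r 1%N;
  brauer_C5 : e 1%N * r 0%N * e 1%N = e 1%N;
  brauer_C6 : e 1%N * e 0%N * e 1%N = e 1%N;
  brauer_C7 : e 1%N * r 0%N * r 1%N = e 1%N * r 0%N;
  brauer_C8 : e 1%N * e 0%N * r 1%N = e 1%N * e 0%N }.
Hypothesis br : brauerC.

Let cox : coxeterC n r. Proof. exact: brauer_cox. Qed.
Let n_gt0 : 0 < n. Proof. exact: ltnW. Qed.
Let rK i : i < n -> r i * r i = 1. Proof. by case: cox => h _ _ _; apply: h. Qed.
Let p_eq i j : i < n -> j < n -> (p i == p j) = (i == j).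
Proof.
move=> hi hj; case: frame => h _ _.
by apply/eqP/eqP => [/h->|->].
Qed.
Let p_sg i j : i < n -> j < n -> (p i == sg (p j)) = false.
Proof. by case: frame => _ h _ hi hj; apply/negbTE/h. Qed.

(** The mirror image of [brauer_C3]. The relations are not visibly stable under reversing words, so
    it is derived: by [brauer_C8] the element [e 0 * e 1 * e 0] absorbs [r 1] on the right, and
    [brauer_C3] together with cancellation of [r 1] carries this over to [e 0 * r 1 * e 0]. *)
Let e0r1e0r1 : e 0%N * r 1%N * e 0%N * r 1%N = e 0%N * e 1%N * e 0%N.
Proof.
have h : e 0%N * e 1%N * e 0%N * r 1%N = e 0%N * e 1%N * e 0%N.
  by rewrite -!mulgA [e 1%N * (_ * _)]mulgA (brauer_C8 br) !mulgA.
have h' : e 0%N * r 1%N * e 0%N * r 1%N = e 0%N * r 1%N * e 0%N.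
  have := h; rewrite -(brauer_C3 br) => h1.
  apply: (can_inj (g := fun x => r 1%N * x) (f := fun x => r 1%N * x)).
    by move=> x; rewrite mulgA rK ?mul1g.
  by rewrite !mulgA.
have E : e 0%N * (e 0%N * e 1%N * e 0%N) = e 0%N * e 1%N * e 0%N.
  by rewrite !mulgA (brauer_ee br).
by rewrite -E -(brauer_C3 br) !mulgA h' -[in RHS]mulgA (brauer_ee br).
Qed.

Let e0r1e0 : e 0%N * r 1%N * e 0%N = e 0%N * e 1%N * e 0%N.
Proof.
have := congr1 (fun x => x * r 1%N) e0r1e0r1.
rewrite -[in RHS]mulgA /= -!mulgA rK // mulg1 => ->.
by rewrite [e 1%N * (_ * _)]mulgA (brauer_C8 br).
Qed.

Notation W := (symp sg).
Notation tau := (tau sgK sgN frame r).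
Notation refl := (refl sg).
Notation s := (srefl sg p).

Let tauM u v : W u -> W v -> tau (u * v) = tau u * tau v.
Proof. exact: tauM. Qed.
Let tauV u : W u -> tau u * tau u^-1 = 1. Proof. exact: tauV. Qed.
Let tauVl u : W u -> tau u^-1 * tau u = 1. Proof. exact: tauVl. Qed.
Let tau_s i : i < n -> tau (s i) = r i. Proof. exact: tau_srefl. Qed.
Let sympR a b : W (refl a b). Proof. exact: symp_refl. Qed.
Let sympS i : W (s i). Proof. exact: symp_refl. Qed.
Let s_id i j : i < n -> j < n -> j != i -> j.+1 != i -> s i (p j) = p j.
Proof. exact: srefl_id. Qed.
Let s_0 : s 0%N (p 0%N) = sg (p 0%N). Proof. exact: srefl0. Qed.
Let s_S i : s i.+1 (p i) = p i.+1. Proof. exact: sreflS. Qed.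
Let s_pred i : s i.+1 (p i.+1) = p i. Proof. exact: srefl_pred. Qed.
Let s_sg i x : s i (sg x) = sg (s i x). Proof. exact: srefl_sg. Qed.
Let s_K i : s i * s i = 1. Proof. exact: reflK. Qed.
#[local] Hint Resolve sympR sympS : core.

(* Letters [i < n.-1] of a word fixing the last strand, pushed through the cycle
   [D = r_(n-1) ... r_1] that carries the last strand to the first. *)
Definition shifted_letter i : M := if i is 0 then r 1%N * r 0%N * r 1%N else r i.+1.

Let D := prodw r (dword n.-1 0).

Let shift1 i : i < n.-1 -> r i * D = D * shifted_letter i.
Proof.
move=> hi; have hD1 : D = prodw r (dword n.-1 1) * r 1%N.
  by rewrite /D dwordS ?prodw_rcons //; lia.
case: i hi => [|i] hi; rewrite /shifted_letter.
  rewrite hD1 !mulgA -[in RHS](mulgA _ (r 1%N) (r 1%N)) rK // mulg1.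
  by rewrite -(@dword_lt n _ r cox) //; lia.
by rewrite /D (@dword_gt n _ r cox) //; lia.
Qed.

Let e0_shifted i : i < n.-1 -> shifted_letter i * e 0%N = e 0%N * shifted_letter i.
Proof.
case: i => [|i] hi; rewrite /shifted_letter; first by rewrite (brauer_C4 br) !mulgA.
by rewrite (brauer_erC br) //; lia.
Qed.

Let cyc := prodw s (dword n.-1 0).

Let sympW w : W (prodw s w).
Proof.
elim: w => [|i w IH]; first by rewrite /prodw big_nil symp1.
by rewrite prodw_cons sympM.
Qed.

Let tau_cyc : tau cyc = D.
Proof.
apply: tau_prod => //; rewrite all_rev.
by apply/allP => i; rewrite mem_iota; lia.
Qed.

Let cyc_p i : i < n -> cyc (p i) = if i == n.-1 then p 0%N else p i.+1.
Proof.
move=> hi; have gen k j : j <= k -> k < n -> prodw s (dword k j) (p i) =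
    if (i < j) || (k < i) then p i else if i == k then p j else p i.+1.
  move=> hj hk; have [m] := ubnP (k - j); elim: m j hj => // m IH j.
  rewrite leq_eqVlt => /orP[/eqP-> _|hj hm].
    by rewrite dwordk /prodw big_nil perm1; case: (ltngtP i k) => //= ->.
  rewrite dwordS // prodw_rcons permM IH //; last by lia.
  have -> : (i < j.+1) || (k < i) = [|| i < j, k < i | i == j] by lia.
  case: (eqVneq i j) => [e1|h1]; first by rewrite !orbT e1 ltnn /= s_S //; do 2![case: ifP => ?; try lia].
  rewrite orbF orbC; case: (ltngtP i j) => hij /=; try lia.
    by rewrite orbT s_id //; lia.
  rewrite orbF; case: ifP => hki; first by rewrite s_id //; lia.
  case: (eqVneq i k) => [_|hik]; first by rewrite s_pred.
  by rewrite s_id //; lia.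
rewrite /cyc gen //; last by lia.
by case: ifP => h //; lia.
Qed.

Let comm_prod x y (w : seq nat) : all (fun i => i < n.-1) w ->
  (forall i, i < n.-1 -> y i * x = x * y i) -> prodw y w * x = x * prodw y w :> M.
Proof.
move=> + h; elim: w => [|i w IH] /=; first by rewrite /prodw big_nil mul1g mulg1.
by case/andP=> hi hw; rewrite !prodw_cons -mulgA IH // mulgA h // -!mulgA.
Qed.

Let shift_prod w : all (fun i => i < n.-1) w -> prodw r w * D = D * prodw shifted_letter w.
Proof.
elim: w => [|i w IH] /=; first by rewrite /prodw !big_nil mul1g mulg1.
by case/andP=> hi hw; rewrite !prodw_cons -mulgA IH // mulgA shift1 // -!mulgA.
Qed.

(** Conjugation by [cyc] moves the fixed strand to the last position, where [u] becomes a word in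
    letters below [n.-1]. Pulling that word back through [D] gives shifted letters, and each of them
    commutes with [e 0]: letter 0 by [brauer_C4], the others by distance. *)
Let comm_fix0 u : W u -> u (p 0%N) = p 0%N -> tau u * e 0%N = e 0%N * tau u.
Proof.
move=> hu fu; have hc : W cyc by exact: sympW.
have [|||w hw ew] := srefl_word_exists sgK sgN frame (k := n.-1) (u := cyc * u * cyc^-1).
- by lia.
- by rewrite !sympM ?sympV ?sympW.
- move=> i hi hin; have -> : i = n.-1 by lia.
  have E : cyc (p n.-1) = p 0%N by rewrite cyc_p ?eqxx //; lia.
  by rewrite !permM E fu -E permK.
have eu : u = cyc^-1 * (prodw s w * cyc) by rewrite ew !mulgA mulgKV mulVg mul1g.
have hn w' : all (fun i => i < n.-1) w' -> all (fun i => i < n) w'.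
  by move=> h; apply: sub_all h => i; lia.
have -> : tau u = prodw shifted_letter w.
  rewrite eu tauM ?sympV ?sympM // tauM // tau_cyc tau_prod ?hn //.
  by rewrite shift_prod // mulgA -tau_cyc tauVl // mul1g.
exact: comm_prod hw e0_shifted.
Qed.

(** The hypothesis describes the stabiliser of the arc of [e 0]. A sign change of the first strand
    is split off as [s 0], which [e 0] absorbs on both sides. *)
Lemma commute_e0 u : W u -> u (p 0%N) = p 0%N \/ u (p 0%N) = sg (p 0%N) ->
  tau u * e 0%N = e 0%N * tau u.
Proof.
move=> hu [|fu]; first exact: comm_fix0.
have hu' : W (u * s 0%N) by rewrite sympM.
have -> : u = u * s 0%N * s 0%N.
  by rewrite -mulgA s_K mulg1.
have fv : (u * s 0%N) (p 0%N) = p 0%N by rewrite permM fu s_sg // s_0 sgK.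
rewrite tauM // tau_s // -mulgA (brauer_re br) // mulgA -comm_fix0 // -mulgA.
by rewrite (brauer_er br).
Qed.

Let shift2 i : i < n.-2 -> shifted_letter i * D =
  D * (if i is 0 then r 2%N * shifted_letter 0 * r 2%N else r i.+2).
Proof.
case: i => [|i] hi /=; last by rewrite shift1 //; lia.
have h1 : r 1%N * D = D * r 2%N by rewrite shift1 //; lia.
have h0 : r 0%N * D = D * shifted_letter 0 by rewrite shift1 //; lia.
by rewrite -2!mulgA h1 [r 0%N * _]mulgA h0 !mulgA h1.
Qed.

(** This word is the simultaneous sign change of the first two strands, which preserves the double
    arc of [e 1]. *)
Let r0r1r0r1_e1 : r 0%N * r 1%N * r 0%N * r 1%N * e 1%N = e 1%N * (r 0%N * r 1%N * r 0%N * r 1%N).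
Proof.
rewrite -[_ * _ * e 1%N]mulgA (brauer_re br) // -[r 0%N * _ * _]mulgA -mulgA (brauer_C2 br).
rewrite !mulgA rK // mul1g.
have h : e 1%N * r 0%N * r 1%N * r 0%N = e 1%N by rewrite (brauer_C7 br) -mulgA rK // mulg1.
by rewrite h (brauer_er br).
Qed.

(** Shifted twice, letter 0 becomes [r 2 * r 1 * r 0 * r 1 * r 2]. Writing [e 1] as a conjugate of
    [e 2] through [brauer_rer] reduces the claim to the commutation of [r 0] with [e 2]. *)
Let shifted2_e1 i : i < n.-2 ->
  (if i is 0 then r 2%N * shifted_letter 0 * r 2%N else r i.+2) * e 1%N =
  e 1%N * (if i is 0 then r 2%N * shifted_letter 0 * r 2%N else r i.+2).
Proof.
case: i => [|i] hi; last by rewrite (brauer_erC br) //; lia.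
have hn : 2 < n by lia.
have e1E : e 1%N = r 2%N * r 1%N * e 2%N * r 1%N * r 2%N.
  have := brauer_rer br (i := 1%N) isT hn => h.
  rewrite -[r 2%N * _ * _]mulgA -[r 2%N * _ * _]mulgA h !mulgA rK // mul1g.
  by rewrite -mulgA rK // mulg1.
have h2 : r 0%N * e 2%N = e 2%N * r 0%N by rewrite (brauer_erC br) //; lia.
have L : r 2%N * shifted_letter 0 * r 2%N * e 1%N = r 2%N * r 1%N * r 0%N * e 2%N * r 1%N * r 2%N.
  rewrite e1E /= !mulgA -[_ * r 2%N * r 2%N]mulgA rK // mulg1.
  by rewrite -[_ * r 1%N * r 1%N]mulgA rK // mulg1.
have R : e 1%N * (r 2%N * shifted_letter 0 * r 2%N) = r 2%N * r 1%N * e 2%N * r 0%N * r 1%N * r 2%N.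
  rewrite e1E /= !mulgA -[_ * r 2%N * r 2%N]mulgA rK // mulg1.
  by rewrite -[_ * r 1%N * r 1%N]mulgA rK // mulg1.
by rewrite L R -[_ * r 0%N * e 2%N]mulgA h2 !mulgA.
Qed.

(** The argument of [comm_fix0] with two turns of the cycle, which bring the first two strands to
    the last two positions. *)
Let comm_fix1 u : W u -> u (p 0%N) = p 0%N -> u (p 1%N) = p 1%N -> tau u * e 1%N = e 1%N * tau u.
Proof.
move=> hu f0 f1; have hc : W cyc by exact: sympW.
have E1 : cyc (p n.-1) = p 0%N by rewrite cyc_p ?eqxx //; lia.
have E2 : cyc (cyc (p n.-2)) = p 0%N.
  rewrite cyc_p ?ifN; [|lia|lia].
  by rewrite (_ : n.-2.+1 = n.-1) //; lia.
have E3 : cyc (cyc (p n.-1)) = p 1%N.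
  by rewrite E1 cyc_p // ifN //; lia.
have [|||w hw ew] := srefl_word_exists sgK sgN frame (k := n.-2)
  (u := cyc * cyc * u * (cyc * cyc)^-1).
- by lia.
- by rewrite !sympM ?sympV ?sympM ?sympW.
- move=> i hi hin; have : i = n.-1 \/ i = n.-2 by lia.
  have F x y : cyc (cyc x) = y -> u y = y -> (cyc * cyc * u * (cyc * cyc)^-1) x = x.
    by rewrite -permM => <- fy; rewrite permM [(_ * u) x]permM fy permK.
  by case=> ->; [apply: F E3 f1|apply: F E2 f0].
have eu : u = (cyc * cyc)^-1 * (prodw s w * (cyc * cyc)).
  by rewrite ew !mulgA invMg !mulgA !mulgKV mulVg mul1g.
have hn w' : all (fun i => i < n.-2) w' -> all (fun i => i < n) w'.
  by move=> h; apply: sub_all h => i; lia.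
pose y i := if i is 0 then r 2%N * shifted_letter 0 * r 2%N else r i.+2.
have hD : prodw r w * (D * D) = D * D * prodw y w.
  rewrite mulgA shift_prod; last by apply: sub_all hw => i; lia.
  rewrite -!mulgA; congr (D * _).
  elim: w hw {ew eu hn} => [|i w IH] /=; first by rewrite /prodw !big_nil mul1g mulg1.
  case/andP=> hi hw; rewrite !prodw_cons -mulgA IH //.
  by rewrite mulgA shift2 // -mulgA.
have hcc : W (cyc * cyc) by exact: sympM.
have -> : tau u = prodw y w.
  rewrite eu tauM ?sympV ?sympM // tauM // [X in _ * (_ * X)]tauM // tau_cyc tau_prod ?hn //.
  by rewrite hD mulgA -{1 2}tau_cyc -tauM // tauVl // mul1g.
elim: w hw {hD ew eu} => [|i w IH] /=; first by rewrite /prodw big_nil mul1g mulg1.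
by case/andP=> hi hw; rewrite !prodw_cons -mulgA IH // mulgA shifted2_e1 // -mulgA.
Qed.

(** The four cases form the stabiliser of the double arc of [e 1]. It is generated by the
    permutations fixing both strands, the exchange [s 1] and the double sign change [t]. *)
Lemma commute_e1 u : W u ->
  [\/ u (p 0%N) = p 0%N /\ u (p 1%N) = p 1%N, u (p 0%N) = p 1%N /\ u (p 1%N) = p 0%N,
      u (p 0%N) = sg (p 0%N) /\ u (p 1%N) = sg (p 1%N)
    | u (p 0%N) = sg (p 1%N) /\ u (p 1%N) = sg (p 0%N)] ->
  tau u * e 1%N = e 1%N * tau u.
Proof.
move=> hu.
have red v : W v -> tau v * e 1%N = e 1%N * tau v ->
    tau (u * v) * e 1%N = e 1%N * tau (u * v) -> tau u * e 1%N = e 1%N * tau u.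
  move=> hv cv; rewrite tauM // => h.
  rewrite -[tau u]mulg1 -(tauV hv) !mulgA.
  have cv' : tau v^-1 * e 1%N = e 1%N * tau v^-1.
    rewrite -[e 1%N in LHS]mulg1 -(tauV hv) !mulgA -(mulgA _ (e 1%N)) -cv.
    by rewrite !mulgA tauVl // mul1g.
  by rewrite -(mulgA _ (tau v^-1)) cv' mulgA h -!mulgA.
have c1 : tau (s 1%N) * e 1%N = e 1%N * tau (s 1%N).
  by rewrite tau_s // (brauer_re br) // (brauer_er br).
pose t := s 0%N * s 1%N * s 0%N * s 1%N.
have t1 : tau t * e 1%N = e 1%N * tau t.
  rewrite /t !tauM ?sympM // !tau_s //; exact: r0r1r0r1_e1.
have s01 : s 0%N (p 1%N) = p 1%N by rewrite s_id.
have tp0 : t (p 0%N) = sg (p 0%N).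
  by rewrite /t !permM s_0 s_sg s_S s_sg s01 s_sg s_pred.
have tp1 : t (p 1%N) = sg (p 1%N).
  by rewrite /t !permM s01 s_pred s_0 s_sg s_S.
have tW : W t by rewrite /t !sympM.
clearbody t.
case=> -[u0 u1].
- exact: comm_fix1.
- apply: (red (s 1%N)) => //; apply: comm_fix1; rewrite ?sympM // permM ?u0 ?u1 ?s_S ?s_pred //.
- apply: (red t) => //; apply: comm_fix1; rewrite ?sympM // permM ?u0 ?u1.
    by rewrite (sympP _ _ tW) tp0 sgK.
  by rewrite (sympP _ _ tW) tp1 sgK.
- apply: (red (t * s 1%N)); rewrite ?sympM //.
    by rewrite tauM // -mulgA c1 mulgA t1 -!mulgA.
  apply: comm_fix1; rewrite ?sympM // !permM ?u0 ?u1 (sympP _ _ tW) ?tp0 ?tp1 sgK ?s_S ?s_pred //.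
Qed.

Let refl_l a b : refl a b a = b. Proof. exact: refl_l. Qed.
Let refl_r a b : refl a b b = a. Proof. exact: refl_r. Qed.
Let reflK a b : refl a b * refl a b = 1. Proof. exact: reflK. Qed.
Let reflV a b : (refl a b)^-1 = refl a b. Proof. exact: reflV. Qed.

(** * Arc elements and the identities between them *)

Definition apart a b := (b != a) && (b != sg a).

Lemma apartC a b : apart a b = apart b a.
Proof. by rewrite /apart eq_sym -(sg_eqC sgK) [sg b == a]eq_sym. Qed.

Lemma apart_sg a b : apart a (sg b) = apart a b.
Proof. by rewrite /apart (sg_eqC sgK) (sg_eq sgK) andbC. Qed.

Lemma apart_sgl a b : apart (sg a) b = apart a b.
Proof. by rewrite apartC apart_sg apartC. Qed.

Lemma apart_perm u a b : W u -> apart (u a) (u b) = apart a b.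
Proof. by move=> hu; rewrite /apart -(sympP _ _ hu) !(inj_eq perm_inj). Qed.

Lemma apart_neq a b : apart a b -> b != a. Proof. by case/andP. Qed.
Lemma apart_nsg a b : apart a b -> b != sg a. Proof. by case/andP. Qed.

Lemma refl_apart a b c : apart a c -> apart b c -> refl a b c = c.
Proof. by move=> /andP[h1 h2] /andP[h3 h4]; apply: refl_id. Qed.

Let apart_p i j : i < n -> j < n -> i != j -> apart (p i) (p j).
Proof. by move=> hi hj hij; rewrite /apart p_eq // p_sg // eq_sym hij. Qed.

(** The group is transitive on families of strands from distinct mirror pairs. With [conjtX] this
    moves every identity between arc elements to the first strands, where it is a defining relation;
    the bound on [size l] supplies the strands that this relation speaks of. *)
Lemma frame_transitive (l : seq T) : pairwise apart l ->
  size l <= n /\ exists2 u, W u & forall i, i < size l -> u (p i) = nth (p 0%N) l i.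
Proof.
elim/last_ind: l => [|l a IH]; first by split=> //; exists 1; rewrite ?symp1.
rewrite pairwise_rcons => /andP[ha /IH [hl [u hu eu]]]; rewrite size_rcons.
have [pI _ /(_ (u^-1 a)) [j hj aj]] := frame.
have fresh i : i < size l -> apart (p i) (u^-1 a).
  move=> hi; rewrite -(apart_perm _ _ hu) permKV eu //.
  by apply: (allP ha); rewrite mem_nth.
have hlj : size l <= j.
  rewrite leqNgt; apply/negP => /fresh; rewrite /apart.
  by case: aj => ->; rewrite eqxx ?andbF.
split; first by lia.
exists (refl (p (size l)) (u^-1 a) * u); first by rewrite sympM.
move=> i; rewrite ltnS leq_eqVlt permM nth_rcons => /orP[/eqP->|hi].
  by rewrite ltnn eqxx refl_l permKV.
rewrite hi refl_apart ?eu //; last by rewrite apartC fresh.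
by apply: apart_p; lia.
Qed.

Definition base_perm a b : {perm T} :=
  let u := refl (p 0%N) a in u * refl (u (p 1%N)) b.

(* [X a b] is the monoid element of the double arc {a,b}, {sg a,sg b}: a single
   self-mirror arc when [b = sg a]. *)
Definition X a b : M :=
  if b == sg a then tau (refl (p 0%N) a)^-1 * e 0%N * tau (refl (p 0%N) a)
  else tau (base_perm a b)^-1 * e 1%N * tau (base_perm a b).

Let base_permP a b : apart a b ->
  [/\ W (base_perm a b), base_perm a b (p 0%N) = a & base_perm a b (p 1%N) = b].
Proof.
move=> hab; rewrite /base_perm; set u := refl (p 0%N) a.
have hu : W u by exact: sympR.
have h0 : u (p 0%N) = a by apply: refl_l.
split; first by rewrite sympM.
  rewrite permM h0 refl_apart //; last by rewrite apartC.
  by rewrite -h0 apart_perm // apart_p.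
by rewrite permM refl_l.
Qed.

(** Two conjugates of [x] agree when the conjugating elements differ by something commuting with
    [x]; with the stabiliser lemmas this makes [X] independent of its choices. *)
Let conj_eq x u v : W u -> W v -> tau (v * u^-1) * x = x * tau (v * u^-1) ->
  tau v^-1 * x * tau v = tau u^-1 * x * tau u.
Proof.
move=> hu hv cx; have hz : W (v * u^-1) by rewrite sympM ?sympV.
have -> : tau v = tau (v * u^-1) * tau u by rewrite -tauM // mulgKV.
have -> : tau v^-1 = tau u^-1 * tau (v * u^-1)^-1.
  by rewrite -tauM ?sympV // invMg invgK mulKg.
rewrite -!mulgA; congr (_ * _).
by rewrite [x * (_ * _)]mulgA -cx !mulgA tauVl // mul1g.
Qed.

Lemma X_single u a : W u -> u (p 0%N) = a \/ u (p 0%N) = sg a ->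
  X a (sg a) = tau u^-1 * e 0%N * tau u.
Proof.
move=> hu ua; rewrite /X eqxx; apply: conj_eq => //.
apply: commute_e0; first by rewrite sympM ?sympV.
rewrite permM refl_l //; case: ua => [<-|h]; first by left; rewrite permK.
by right; apply: (@perm_inj _ u); rewrite permKV (sympP _ _ hu) h sgK.
Qed.

Lemma X_double u a b : apart a b -> W u ->
  [\/ u (p 0%N) = a /\ u (p 1%N) = b, u (p 0%N) = b /\ u (p 1%N) = a,
      u (p 0%N) = sg a /\ u (p 1%N) = sg b
    | u (p 0%N) = sg b /\ u (p 1%N) = sg a] ->
  X a b = tau u^-1 * e 1%N * tau u.
Proof.
move=> hab hu ua; rewrite /X ifN ?apart_nsg //.
have [hv v0 v1] := base_permP hab; apply: conj_eq => //.
apply: commute_e1; first by rewrite sympM ?sympV.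
have E x y : u x = y -> u^-1 y = x by move=> <-; rewrite permK.
have E' x y : u x = sg y -> u^-1 y = sg x.
  by move=> h; apply: (@perm_inj _ u); rewrite permKV (sympP _ _ hu) h sgK.
rewrite 2!(permM (base_perm a b)) v0 v1; case: ua => -[h k].
- by apply: Or41; rewrite (E _ _ h) (E _ _ k).
- by apply: Or42; rewrite (E _ _ h) (E _ _ k).
- by apply: Or43; rewrite (E' _ _ h) (E' _ _ k).
- by apply: Or44; rewrite (E' _ _ h) (E' _ _ k).
Qed.

Lemma XC a b : a != b -> X a b = X b a.
Proof.
have [->|hs] := eqVneq b (sg a); move=> hab.
  have -> : X (sg a) a = X (sg a) (sg (sg a)) by rewrite sgK.
  rewrite (@X_single (refl (p 0%N) a) (sg a)) //; last by right; rewrite sgK refl_l.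
  by apply: X_single => //; left; apply: refl_l.
have h : apart a b by rewrite /apart eq_sym hab.
have [hv v0 v1] := base_permP h.
rewrite (X_double h hv) ?(@X_double (base_perm a b) b a) //; first by rewrite apartC.
  by apply: Or42.
by apply: Or41.
Qed.

Lemma X_sg a b : a != b -> X (sg a) (sg b) = X a b.
Proof.
have [->|hs] := eqVneq b (sg a); move=> hab.
  rewrite (@X_single (refl (p 0%N) a) (sg a)) //; last by right; rewrite sgK refl_l.
  by rewrite (@X_single (refl (p 0%N) a) a) //; left; apply: refl_l.
have h : apart a b by rewrite /apart eq_sym hab.
have [hv v0 v1] := base_permP h.
rewrite (X_double h hv); last by apply: Or41.
rewrite (@X_double (base_perm a b)) //; first by rewrite apart_sg apart_sgl.
by apply: Or43; rewrite !sgK.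
Qed.

Definition conjt u x : M := tau u^-1 * x * tau u.

Lemma conjtM u x y : W u -> conjt u (x * y) = conjt u x * conjt u y.
Proof.
move=> hu; rewrite /conjt -!mulgA; congr (_ * (_ * _)).
by rewrite [tau u * _]mulgA tauV // mul1g.
Qed.

Lemma conjt_tau u v : W u -> W v -> conjt u (tau v) = tau (v ^ u).
Proof. by move=> hu hv; rewrite /conjt -!tauM ?sympM ?sympV // conjgE mulgA. Qed.

Lemma conjt_refl u a b : W u -> conjt u (tau (refl a b)) = tau (refl (u a) (u b)).
Proof. by move=> hu; rewrite conjt_tau // conjgE mulgA refl_conj. Qed.

Lemma conjtX u a b : W u -> a != b -> conjt u (X a b) = X (u a) (u b).
Proof.
move=> hu hab.
have comp v x : W v -> conjt u (tau v^-1 * x * tau v) = tau (v * u)^-1 * x * tau (v * u).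
  by move=> hv; rewrite /conjt invMg !tauM ?sympV // !mulgA.
have [->|hs] := eqVneq b (sg a).
  rewrite (@X_single (refl (p 0%N) a)) //; last by left; apply: refl_l.
  rewrite comp // (sympP _ _ hu) (@X_single (refl (p 0%N) a * u)) ?sympM //.
  by left; rewrite permM refl_l.
have h : apart a b by rewrite /apart eq_sym hab.
have [hv v0 v1] := base_permP h.
rewrite (X_double h hv); last by apply: Or41.
rewrite comp // (@X_double (base_perm a b * u)) ?sympM ?apart_perm //.
by apply: Or41; rewrite 2!(permM (base_perm a b)) v0 v1.
Qed.

Lemma X_tau u a b : W u -> a != b -> X a b * tau u = tau u * X (u a) (u b).
Proof. by move=> hu hab; rewrite -conjtX // /conjt !mulgA tauV // mul1g. Qed.

Lemma tau_X u a b : W u -> a != b -> tau u * X a b = X (u^-1 a) (u^-1 b) * tau u.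
Proof. by move=> hu hab; rewrite X_tau ?(inj_eq perm_inj) // !permKV. Qed.

Lemma X_e0 : X (p 0%N) (sg (p 0%N)) = e 0%N.
Proof. by rewrite (@X_single 1) ?symp1 ?perm1; [rewrite invg1 tau1 // mul1g mulg1| |left]. Qed.

Lemma X_eS i : i.+1 < n -> X (p i) (p i.+1) = e i.+1.
Proof.
elim: i => [|i IH] hi.
  rewrite (@X_double 1) ?symp1 ?apart_p // ?invg1 ?tau1 // ?mul1g ?mulg1 //.
  by apply: Or41; rewrite !perm1.
have hu : W (s i.+2 * s i.+1) by rewrite sympM.
have -> : X (p i.+1) (p i.+2) = conjt (s i.+2 * s i.+1) (X (p i) (p i.+1)).
  rewrite conjtX ?p_eq //; try lia.
  by rewrite !permM s_id ?s_S ?s_id //; lia.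
rewrite IH; last by lia.
rewrite /conjt invMg !reflV // !tauM // !tau_s; [|lia|lia].
have h := brauer_rer br (i := i.+1) isT hi.
have -> : r i.+1 * r i.+2 * e i.+1 * (r i.+2 * r i.+1) =
    r i.+1 * (r i.+2 * e i.+1 * r i.+2) * r i.+1 by rewrite !mulgA.
by rewrite -h !mulgA rK ?mul1g -?mulgA ?rK ?mulg1 //; lia.
Qed.

Notation E a := (X a (sg a)).

Let neq_sg a : a != sg a. Proof. by rewrite eq_sym. Qed.
#[local] Hint Resolve neq_sg : core.

Lemma E_sg a : E (sg a) = E a. Proof. exact: X_sg. Qed.

Let move1 a : exists2 u, W u & u (p 0%N) = a.
Proof. by exists (refl (p 0%N) a). Qed.

Let move2 a b : apart a b -> exists2 u, W u & u (p 0%N) = a /\ u (p 1%N) = b.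
Proof. by move/base_permP => [h1 h2 h3]; exists (base_perm a b). Qed.

Let move3 a b c : apart a b -> apart b c -> apart a c ->
  2 < n /\ exists2 u, W u & [/\ u (p 0%N) = a, u (p 1%N) = b & u (p 2%N) = c].
Proof.
move=> ab bc ac; have [|hn [u hu eu]] := @frame_transitive [:: a; b; c].
  by rewrite /= ab bc ac.
split=> //; exists u => //.
by split; [apply: (eu 0%N)|apply: (eu 1%N)|apply: (eu 2%N)].
Qed.

Let move4 a b c d : pairwise apart [:: a; b; c; d] ->
  3 < n /\ exists2 u, W u & [/\ u (p 0%N) = a, u (p 1%N) = b, u (p 2%N) = c & u (p 3%N) = d].
Proof.
move=> /frame_transitive[hn [u hu eu]].
split=> //; exists u => //.
by split; [apply: (eu 0%N)|apply: (eu 1%N)|apply: (eu 2%N)|apply: (eu 3%N)].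
Qed.

Let neqVapart a b : a != b -> b = sg a \/ apart a b.
Proof. by rewrite /apart eq_sym => ->; case: eqVneq => [->|]; [left|right]. Qed.

Lemma X_idem a b : a != b -> X a b * X a b = X a b.
Proof.
case/neqVapart => [->|ab].
  have [u hu <-] := move1 a; rewrite -(sympP _ _ hu) -conjtX // -conjtM // X_e0.
  by rewrite (brauer_ee br).
have [u hu [<- <-]] := move2 ab; rewrite -conjtX ?p_eq // -conjtM // X_eS //.
by rewrite (brauer_ee br).
Qed.

Lemma refl_X a b : a != b -> tau (refl a b) * X a b = X a b.
Proof.
case/neqVapart => [->|ab].
  have [u hu <-] := move1 a; rewrite -(sympP _ _ hu) -conjtX // -conjt_refl // -conjtM // X_e0.
  by rewrite -[refl _ _]/(s 0%N) tau_s // (brauer_re br).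
have [u hu [<- <-]] := move2 ab; rewrite -conjtX ?p_eq // -conjt_refl // -conjtM // X_eS //.
by rewrite -[refl _ _]/(s 1%N) tau_s // (brauer_re br).
Qed.

Lemma X_refl a b : a != b -> X a b * tau (refl a b) = X a b.
Proof.
move=> ab; rewrite X_tau // refl_l refl_r -XC //; exact: refl_X.
Qed.

Let X10 : X (p 1%N) (p 0%N) = e 1%N.
Proof. by rewrite XC ?p_eq // X_eS. Qed.

Let Ep1 : E (p 1%N) = r 1%N * e 0%N * r 1%N.
Proof.
have -> : E (p 1%N) = conjt (s 1%N) (E (p 0%N)) by rewrite conjtX // s_sg s_S.
by rewrite /conjt reflV tau_s // X_e0.
Qed.

(** Sliding along a shared strand. If [c] mirrors [a], this is [brauer_C5] after a sign change;
    otherwise it is [brauer_rre] on three strands. *)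
Lemma X_X_refl a b c : apart a b -> apart b c -> a != c ->
  X a b * X b c = tau (refl a c) * X b c.
Proof.
move=> ab bc /neqVapart[ec|ac].
  rewrite ec; have [u hu [<- <-]] := move2 ab; rewrite -(sympP _ _ hu).
  have hp : p 1%N != sg (p 0%N) by rewrite p_sg.
  rewrite -!conjtX ?p_eq // -conjt_refl // -!conjtM //; congr (conjt u _).
  have -> : X (p 1%N) (sg (p 0%N)) = r 0%N * e 1%N * r 0%N.
    have -> : X (p 1%N) (sg (p 0%N)) = conjt (s 0%N) (X (p 1%N) (p 0%N)).
      by rewrite conjtX ?p_eq // s_0 s_id.
    by rewrite /conjt reflV tau_s // X10.
  rewrite X_eS // -[refl _ _]/(s 0%N) tau_s // !mulgA (brauer_C5 br).
  by rewrite rK ?mul1g.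
have [hn [u hu [<- <- <-]]] : 2 < n /\ exists2 u, W u & [/\ u (p 0%N) = c, u (p 1%N) = b & u (p 2%N) = a].
  by apply: move3; rewrite apartC.
rewrite -!conjtX ?p_eq //; try lia.
rewrite -conjt_refl // -!conjtM //; congr (conjt u _).
rewrite X10 XC ?p_eq // X_eS // -(brauer_rre br) //.
have -> : refl (p 2%N) (p 0%N) = s 1%N * s 2%N * s 1%N.
  have := @refl_conj _ sg sgK sgN (s 1%N) (p 1%N) (p 2%N) (sympS 1).
  rewrite reflV s_pred s_id // => h.
  by rewrite reflC // -h.
have ts : tau (s 1%N * s 2%N * s 1%N) = r 1%N * r 2%N * r 1%N.
  by rewrite (tauM (u := s 1%N * s 2%N)) ?sympM // (tauM (u := s 1%N)) // !tau_s.
by rewrite ts -!mulgA (brauer_re br).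
Qed.

Lemma E_X_E a b : apart a b -> E a * X a b * E a = E a * E b.
Proof.
move=> /move2 [u hu [<- <-]]; rewrite -!(sympP _ _ hu) -!conjtX ?p_eq // -!conjtM //.
by congr (conjt u _); rewrite X_eS // Ep1 X_e0 -e0r1e0r1 !mulgA.
Qed.

Lemma X_E a b : apart a b -> X a b * E b = X a b * E b * E a.
Proof.
rewrite apartC => /move2 [u hu [<- <-]].
rewrite -!(sympP _ _ hu) -!conjtX ?p_eq // -!conjtM //; congr (conjt u _).
rewrite X10 Ep1 X_e0 !mulgA (brauer_C8 br).
by rewrite -[e 1%N * _ * _]mulgA (brauer_ee br) // (brauer_C8 br).
Qed.

(** In standard position the two orders are the left sides of [brauer_C3] and of its mirror image
    [e0r1e0r1]. *)
Lemma E_comm a b : E a * E b = E b * E a.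
Proof.
have [->|ab] := eqVneq b a; first by [].
have [->|ab'] := eqVneq b (sg a); first by rewrite E_sg.
have /move2 [u hu [<- <-]] : apart a b by rewrite /apart ab.
rewrite -!(sympP _ _ hu) -!conjtX ?p_eq // -!conjtM //; congr (conjt u _).
by rewrite Ep1 X_e0 !mulgA e0r1e0r1 -(brauer_C3 br).
Qed.

(** [brauer_C6] used twice. It opens a double arc in the middle and inserts two self-mirror arcs:
    this creates new factors of [Eprod] when vertical strands are closed. *)
Lemma X_E_E_X a b : apart a b -> X a b * E a * E b * X a b = X a b.
Proof.
move=> /move2 [u hu [<- <-]]; rewrite -!(sympP _ _ hu) -!conjtX ?p_eq // -!conjtM //.
congr (conjt u _); rewrite X_eS // Ep1 X_e0 !mulgA.
have -> : e 1%N * e 0%N * r 1%N * e 0%N * r 1%N * e 1%N = e 1%N * (e 0%N * r 1%N * e 0%N * r 1%N) * e 1%N.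
  by rewrite !mulgA.
by rewrite e0r1e0r1 !mulgA (brauer_C6 br) (brauer_C6 br).
Qed.

(** Self-mirror arcs hide an exchange of their strands; this gives the freedom in [u] exploited by
    [NF_eq]. *)
Lemma E_E_refl a b : apart a b -> E a * E b * tau (refl a b) = E a * E b.
Proof.
move=> /move2 [u hu [<- <-]]; rewrite -!(sympP _ _ hu) -!conjtX ?p_eq // -conjt_refl // -!conjtM //.
congr (conjt u _); rewrite Ep1 X_e0 -[refl _ _]/(s 1%N) tau_s //.
by rewrite -!mulgA rK // mulg1 !mulgA e0r1e0r1 e0r1e0.
Qed.

Lemma E_X_comm a b c : apart a b -> apart a c -> apart b c -> E a * X b c = X b c * E a.
Proof.
move=> ab ac bc; have [hn [u hu [<- <- <-]]] := move3 ab bc ac.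
rewrite -!(sympP _ _ hu) -!conjtX ?p_eq // -?conjtM //; congr (conjt u _).
by rewrite X_e0 X_eS // (brauer_eeC br).
Qed.

Lemma X_X_comm a b c d : pairwise apart [:: a; b; c; d] -> X a b * X c d = X c d * X a b.
Proof.
move=> /move4[hn [u hu [<- <- <- <-]]].
rewrite -!conjtX ?p_eq //; try lia.
rewrite -?conjtM //; congr (conjt u _).
by rewrite !X_eS // (brauer_eeC br) //; lia.
Qed.

(** * Arc patterns of one row as symmetric involutions *)

Implicit Types (f g u v w : {perm T}) (a b c d x : T).

Definition sym_invol (f : {perm T}) := symp sg f && [forall x, f (f x) == x].

Lemma sym_involP f : reflect (W f /\ involutive f) (sym_invol f).
Proof.
by apply: (iffP andP) => -[h1 h2]; split=> //; [move=> x; apply/eqP/(forallP h2)|apply/forallP => x; rewrite h2].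
Qed.

Lemma sym_invol1 : sym_invol 1.
Proof. by apply/sym_involP; split; [exact: symp1|move=> x; rewrite !perm1]. Qed.

Definition sgp : {perm T} := perm (inv_inj sgK).

Lemma sym_invol_sgp : sym_invol sgp.
Proof. by apply/sym_involP; split; [apply/sympP|] => x; rewrite !permE ?sgK. Qed.

Lemma sym_invol_refl a b : sym_invol (refl a b).
Proof. by apply/sym_involP; split=> // x; rewrite -permM reflK perm1. Qed.

(** Surgery on arc patterns: inside the stable set [O] the arcs of [f] are replaced by those of [h].
    Taking [sgp] for [h] installs self-mirror arcs. *)
Lemma sym_invol_patch f h (O : pred T) : sym_invol f -> sym_invol h ->
  (forall x, O (sg x) = O x) -> (forall x, O (f x) = O x) -> (forall x, O (h x) = O x) ->
  exists2 f', sym_invol f' & forall x, f' x = if O x then h x else f x.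
Proof.
move=> /sym_involP[/sympP fW fK] /sym_involP[/sympP hW hK] Os Of Oh.
pose g x := if O x then h x else f x.
have gK : involutive g.
  by move=> x; rewrite /g; case: (boolP (O x)) => hx; rewrite ?Oh ?Of ?hx ?(negbTE hx).
exists (perm (inv_inj gK)); last by move=> x; rewrite permE.
apply/sym_involP; split; last by move=> x; rewrite !permE gK.
by apply/sympP => x; rewrite !permE /g Os; case: ifP; rewrite ?fW ?hW.
Qed.

(** Each double arc is listed four times, once from each of its ends, which commuting idempotents
    tolerate. Self-mirror arcs are left to [Eprod]. *)
Definition arcs (f : {perm T}) : seq (T * T) := [seq (a, f a) | a <- enum T & apart a (f a)].
Definition Xs (q : T * T) := X q.1 q.2.
Definition Xprod f := \prod_(q <- arcs f) Xs q.
(** Every moved strand receives a self-mirror arc, also those on double arcs of [f]. *)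
Definition Eprod (f : {perm T}) := \prod_(a <- [seq a <- enum T | f a != a]) E a.

Lemma mem_arcs f q : (q \in arcs f) = apart q.1 (f q.1) && (q.2 == f q.1).
Proof.
apply/mapP/andP => [[a]|[h1 /eqP h2]]; first by rewrite mem_filter => /andP[h _] -> /=.
by exists q.1; [rewrite mem_filter h1 mem_enum|rewrite -h2; case: q {h1 h2}].
Qed.

Let arc_cases f a b : sym_invol f -> apart a (f a) -> apart b (f b) ->
  Xs (a, f a) = Xs (b, f b) \/ pairwise apart [:: a; f a; b; f b].
Proof.
move=> /sym_involP[/sympP fW fK] ha hb; rewrite /Xs /=.
have hfa := apart_neq ha.
have [->|h1] := eqVneq b a; first by left.
have [->|h2] := eqVneq b (sg a); first by left; rewrite fW X_sg // eq_sym.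
have [->|h3] := eqVneq b (f a); first by left; rewrite fK XC // eq_sym.
have [->|h4] := eqVneq b (sg (f a)).
  by left; rewrite fW fK X_sg // XC // eq_sym.
right; rewrite /= ha hb.
have -> : apart a b by rewrite /apart h1.
have -> : apart (f a) b by rewrite /apart h3.
have -> : apart a (f b).
  have e1 : (f b == a) = (b == f a) by rewrite -(inj_eq (@perm_inj _ f)) fK.
  have e2 : (f b == sg a) = (b == sg (f a)) by rewrite -(inj_eq (@perm_inj _ f)) fK fW.
  by rewrite /apart e1 e2 h3.
by rewrite /apart (inj_eq perm_inj) h1 -fW (inj_eq perm_inj) h2.
Qed.

Let arcs_comm f q q' : sym_invol f -> q \in arcs f -> q' \in arcs f -> Xs q * Xs q' = Xs q' * Xs q.
Proof.
case: q q' => a a' [b b'] hf; rewrite !mem_arcs /= => /andP[ha /eqP->] /andP[hb /eqP->].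
by case: (arc_cases hf ha hb) => [->|/X_X_comm].
Qed.

Let arcs_idem f q : q \in arcs f -> Xs q * Xs q = Xs q.
Proof. by rewrite mem_arcs => /andP[h /eqP eq1]; rewrite /Xs eq1 X_idem // eq_sym apart_neq. Qed.

Let arc_mem f a : apart a (f a) -> (a, f a) \in arcs f.
Proof. by move=> h; rewrite mem_arcs h eqxx. Qed.

Lemma X_Xprod f a : sym_invol f -> apart a (f a) -> X a (f a) * Xprod f = Xprod f.
Proof.
move=> hf /arc_mem ha; apply: (factor_absorb_l (F := Xs) (i := (a, f a))) => //.
  by move=> q; apply: arcs_comm.
exact: arcs_idem ha.
Qed.

Lemma Xprod_X f a : sym_invol f -> apart a (f a) -> Xprod f * X a (f a) = Xprod f.
Proof.
move=> hf ha; rewrite -[RHS](X_Xprod hf ha) -[X a _]/(Xs (a, f a)) -commute_prodl //.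
by move=> q; apply: arcs_comm => //; apply: arc_mem.
Qed.

Lemma Xprod_tau f u : sym_invol f -> W u -> Xprod f * tau u = tau u * Xprod (f ^ u).
Proof.
move=> hf hu.
have eu x : (f ^ u) (u x) = u (f x) by rewrite permJ.
have hfu : sym_invol (f ^ u).
  case/sym_involP: hf => fW fK; apply/sym_involP; split.
    by rewrite conjgE !sympM ?sympV.
  by move=> x; rewrite -[x](permKV u) !eu fK.
have -> : Xprod (f ^ u) = \prod_(q <- [seq (u q.1, u q.2) | q <- arcs f]) Xs q.
  have in1 q : q \in arcs f -> (u q.1, u q.2) \in arcs (f ^ u).
    by rewrite !mem_arcs /= eu apart_perm // => /andP[-> /eqP->] /=.
  have sub q : q \in arcs (f ^ u) ++ [seq (u q.1, u q.2) | q <- arcs f] -> q \in arcs (f ^ u).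
    by rewrite mem_cat => /orP[//|/mapP[q' h ->]]; apply: in1.
  apply: prod_idem_eq => [q q' /sub h /sub h'|q /sub|q hq|q /mapP[q' /in1 h ->]].
  - exact: arcs_comm h h'.
  - exact: arcs_idem.
  - exists q => //; apply/mapP; exists (u^-1 q.1, u^-1 q.2); rewrite /= ?permKV; last by case: q {hq}.
    move: hq; rewrite !mem_arcs /= -{1 2 3}[q.1](permKV u) !eu apart_perm // => /andP[-> /eqP->].
    by rewrite permK eqxx.
  - by exists (u q'.1, u q'.2).
rewrite /Xprod [in RHS]big_map.
suff gen l : {subset l <= arcs f} ->
  (\prod_(q <- l) Xs q) * tau u = tau u * \prod_(q <- l) Xs (u q.1, u q.2).
  by exact: (gen (arcs f) (fun q h => h)).
elim: l => [|q l IH] hl; first by rewrite !big_nil mul1g mulg1.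
rewrite !big_cons -mulgA IH; last by move=> q' h; apply: hl; rewrite inE h orbT.
have := hl q (mem_head _ _); rewrite mem_arcs => /andP[h /eqP eq1].
by rewrite mulgA /Xs /= X_tau ?mulgA // eq1 eq_sym apart_neq.
Qed.

Lemma E_Xprod f a : sym_invol f -> ~~ apart a (f a) -> E a * Xprod f = Xprod f * E a.
Proof.
move=> /sym_involP[/sympP fW fK] ha.
apply: commute_prodl => -[b c]; rewrite mem_arcs /= => /andP[hb /eqP->].
have hab : apart a b.
  rewrite /apart; apply/andP; split; apply: contra ha => /eqP eq1; move: hb; rewrite eq1 //.
  by rewrite fW apart_sg apart_sgl.
rewrite /Xs /=; apply: E_X_comm => //.
rewrite /apart; apply/andP; split; apply: contra ha => /eqP eq1.
  by rewrite -eq1 fK apartC.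
have -> : a = sg (f b) by rewrite eq1 sgK.
by rewrite fW fK apart_sg apart_sgl apartC.
Qed.

Lemma X_Xprod_comm f a b : sym_invol f -> apart a b -> ~~ apart a (f a) -> ~~ apart b (f b) ->
  X a b * Xprod f = Xprod f * X a b.
Proof.
move=> /sym_involP[/sympP fW fK] hab ha hb.
have away x c : ~~ apart x (f x) -> apart c (f c) -> apart x c && apart x (f c).
  move=> hx hc; apply/andP; split.
    rewrite /apart; apply/andP; split; apply: contra hx => /eqP eq1; move: hc; rewrite eq1 //.
    by rewrite fW apart_sg apart_sgl.
  rewrite /apart; apply/andP; split; apply: contra hx => /eqP eq1.
    by rewrite -eq1 fK apartC.
  have -> : x = sg (f c) by rewrite eq1 sgK.
  by rewrite fW fK apart_sg apart_sgl apartC.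
apply: commute_prodl => -[c d]; rewrite mem_arcs /= => /andP[hc /eqP->].
rewrite /Xs /=; apply: X_X_comm => /=; case/andP: (away _ _ ha hc) => -> ->.
by case/andP: (away _ _ hb hc) => -> ->; rewrite hab hc.
Qed.

Lemma E_Eprod f a : f a != a -> E a * Eprod f = Eprod f.
Proof.
move=> h; apply: (factor_absorb_l (F := fun a => E a)) => [j _||].
- exact: E_comm.
- exact: X_idem.
- by rewrite mem_filter h mem_enum.
Qed.

Lemma Eprod_E f a : f a != a -> Eprod f * E a = Eprod f.
Proof. by move=> h; rewrite -commute_prodl ?E_Eprod // => b _; apply: E_comm. Qed.

Lemma Eprod_tau f u : W u -> Eprod f * tau u = tau u * Eprod (f ^ u).
Proof.
move=> hu; have eu x : (f ^ u) (u x) = u (f x) by rewrite permJ.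
have -> : Eprod (f ^ u) = \prod_(a <- map u [seq a <- enum T | f a != a]) E a.
  apply: (prod_idem_eq (F := fun a => E a)) => [i j _ _|i _|i|i].
  - exact: E_comm.
  - exact: X_idem.
  - rewrite mem_filter -{1 2}[i](permKV u) eu (inj_eq perm_inj) => /andP[h _].
    exists i => //; apply/mapP; exists (u^-1 i); last by rewrite permKV.
    by rewrite mem_filter h mem_enum.
  - case/mapP => a; rewrite mem_filter => /andP[h _] ->.
    by exists (u a) => //; rewrite mem_filter eu (inj_eq perm_inj) h mem_enum.
rewrite /Eprod big_map; elim: [seq _ <- _ | _] => [|a l IH]; first by rewrite !big_nil mul1g mulg1.
by rewrite !big_cons -mulgA IH mulgA X_tau // (sympP _ _ hu) mulgA.
Qed.

Lemma Eprod_refl f a b : a != b -> f a != a -> f b != b ->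
  Eprod f * tau (refl a b) = Eprod f.
Proof.
move=> /neqVapart[->|hab] ha hb.
  by rewrite -(Eprod_E ha) -[in LHS]mulgA X_refl.
have h : Eprod f = Eprod f * (E a * E b) by rewrite mulgA !Eprod_E.
by rewrite [in LHS]h -[in LHS]mulgA E_E_refl // -h.
Qed.

Definition orb2 a b : pred T := fun x => [|| x == a, x == b, x == sg a | x == sg b].

Let orb2_sg a b x : orb2 a b (sg x) = orb2 a b x.
Proof.
rewrite /orb2 !(sg_eq sgK) !(sg_eqC sgK) orbCA.
by case: (x == a); case: (x == b); case: (x == sg a); case: (x == sg b).
Qed.

Let orb2_perm u a b x : W u -> orb2 (u a) (u b) (u x) = orb2 a b x.
Proof. by move=> hu; rewrite /orb2 -!(sympP _ _ hu) !(inj_eq perm_inj). Qed.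

Let orb2P (P : T -> Prop) a b : P a -> P b -> (forall x, P x -> P (sg x)) ->
  forall x, orb2 a b x -> P x.
Proof. by move=> ha hb hs x /or4P[] /eqP->; auto. Qed.

Let orb2_stable f a b : sym_invol f -> orb2 a b (f a) -> orb2 a b (f b) ->
  forall x, orb2 a b (f x) = orb2 a b x.
Proof.
move=> /sym_involP[/sympP fW fK] ha hb.
have st x : orb2 a b x -> orb2 a b (f x).
  by apply: (orb2P (P := fun x => orb2 a b (f x))) => // y; rewrite fW orb2_sg.
by move=> x; apply/idP/idP => [/st|/st //]; rewrite fK.
Qed.

Let napartP a b : ~~ apart a b -> b = a \/ b = sg a.
Proof. by rewrite negb_and !negbK => /orP[] /eqP->; [left|right]. Qed.

Let invol_W f : sym_invol f -> W f. Proof. by case/sym_involP. Qed.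
Let invol_K f : sym_invol f -> involutive f. Proof. by case/sym_involP. Qed.
Let invol_sg f x : sym_invol f -> f (sg x) = sg (f x).
Proof. by case/sym_involP => /sympP. Qed.

Lemma Xprod_eq f f' : sym_invol f -> (forall a, apart a (f a) -> f' a = f a) ->
  (forall a, apart a (f' a) -> f a = f' a) -> Xprod f' = Xprod f.
Proof.
move=> hf h1 h2.
have sub q : q \in arcs f' ++ arcs f -> q \in arcs f.
  rewrite mem_cat => /orP[|//]; rewrite !mem_arcs => /andP[hq /eqP->].
  by rewrite h2 // hq eqxx.
apply: prod_idem_eq => [q q' /sub h /sub|q /sub|q hq|q hq].
- exact: arcs_comm.
- exact: arcs_idem.
- by exists q => //; apply: sub; rewrite mem_cat hq.
- exists q => //; move: hq; rewrite !mem_arcs => /andP[hq /eqP->].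
  by rewrite h1 // hq eqxx.
Qed.

Lemma Xprod_add f f' a b : sym_invol f -> sym_invol f' -> apart a b -> f' a = b ->
  ~~ apart a (f a) -> ~~ apart b (f b) ->
  (forall x, ~~ orb2 a b x -> f' x = f x) -> Xprod f' = X a b * Xprod f.
Proof.
move=> hf hf' hab fa na nb out.
have nO : forall x, orb2 a b x -> ~~ apart x (f x).
  by apply: orb2P => // x hx; rewrite invol_sg // apart_sg apart_sgl.
have -> : X a b * Xprod f = \prod_(q <- (a, b) :: arcs f) Xs q by rewrite big_cons.
have in0 : (a, b) \in arcs f' by rewrite mem_arcs /= fa hab eqxx.
have in1 q : q \in arcs f -> q \in arcs f'.
  rewrite !mem_arcs => /andP[hq /eqP->]; rewrite out ?hq ?eqxx //.
  by apply: contraL hq => /nO.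
have sub q : q \in arcs f' ++ (a, b) :: arcs f -> q \in arcs f'.
  by rewrite mem_cat inE => /or3P[//|/eqP->//|/in1].
apply: prod_idem_eq => [q q' /sub h /sub|q /sub|[x y] hq|q hq].
- exact: arcs_comm.
- exact: arcs_idem.
- move: hq; rewrite mem_arcs /= => /andP[hx /eqP->].
  case: (boolP (orb2 a b x)) => Ox; last first.
    by exists (x, f' x) => //; rewrite inE mem_arcs /= -out // hx eqxx orbT.
  exists (a, b); rewrite ?mem_head // /Xs /=.
  have fb : f' b = a by rewrite -fa invol_K.
  have ab : a != b by rewrite eq_sym apart_neq.
  have ba : b != a by rewrite eq_sym.
  by case/or4P: Ox => /eqP->; rewrite ?invol_sg // ?fa ?fb ?X_sg // [X b a]XC.
- by exists q => //; apply: sub; rewrite mem_cat hq orbT.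
Qed.

Lemma Eprod_eq f f' : (forall x, (f' x == x) = (f x == x)) -> Eprod f' = Eprod f.
Proof. by move=> h; rewrite /Eprod; under eq_filter => x do rewrite h. Qed.

Lemma Eprod_add f f' a : (forall x, (f' x == x) = (f x == x) && ~~ orb2 a a x) ->
  Eprod f' = E a * Eprod f.
Proof.
move=> h; have -> : E a * Eprod f = \prod_(x <- a :: [seq x <- enum T | f x != x]) E x.
  by rewrite big_cons.
apply: (prod_idem_eq (F := fun a => E a)) => [i j _ _|i _|x|x].
- exact: E_comm.
- exact: X_idem.
- rewrite mem_filter h negb_and negbK => /andP[/orP[hx _|Ox _]].
    by exists x => //; rewrite inE mem_filter hx mem_enum orbT.
  exists a; rewrite ?mem_head //.
  by case/or4P: Ox => /eqP-> //; rewrite E_sg.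
- rewrite inE mem_filter => /orP[/eqP->|/andP[hx _]].
    by exists a => //; rewrite mem_filter h /orb2 eqxx andbF mem_enum.
  by exists x => //; rewrite mem_filter h (negbTE hx) mem_enum.
Qed.

(** * Normal forms and their stability under the generators *)

Definition NF f u g := Xprod f * Eprod f * tau u * Xprod g.
(** The fixed points of [f] and of [g] are the ends of the vertical strands in the two rows, and [u]
    carries the former onto the latter. *)
Definition NFvalid f u g :=
  [/\ sym_invol f, W u, sym_invol g & forall x, (g (u x) == u x) = (f x == x)].
Definition is_NF (m : M) := exists f u g, NFvalid f u g /\ m = NF f u g.

Lemma is_NF1 : is_NF 1.
Proof.
exists 1, 1, 1; split.
  by split; rewrite ?sym_invol1 ?symp1 // => x; rewrite !perm1.
have X1 : Xprod 1 = 1.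
  rewrite /Xprod; apply: big1_seq => q; rewrite mem_arcs perm1 /apart eqxx //.
have E1 : Eprod 1 = 1.
  by rewrite /Eprod big1_seq // => a; rewrite mem_filter perm1 eqxx.
by rewrite /NF X1 E1 tau1 // !mulg1.
Qed.

Lemma tau_NF w m : W w -> is_NF m -> is_NF (tau w * m).
Proof.
move=> hw [f [u [g [[hf hu hg v] ->]]]].
have hfw : sym_invol (f ^ w^-1).
  apply/sym_involP; split; first by rewrite conjgE !sympM ?sympV // invol_W.
  by move=> z; rewrite -[z](permKV w^-1) !permJ invol_K.
exists (f ^ w^-1), (w * u), g; split.
  split=> //; first exact: sympM.
  move=> z; have -> : (f ^ w^-1) z = w^-1 (f (w z)) by rewrite -{1}[z](permK w) permJ.
  by rewrite permM v -[in RHS](inj_eq (@perm_inj _ w)) permKV.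
have hX := Xprod_tau hfw hw; have hE := Eprod_tau (f ^ w^-1) hw.
rewrite -conjgM mulVg conjg1 in hX hE.
by rewrite /NF tauM // !mulgA -hX -(mulgA _ (tau w)) -hE !mulgA.
Qed.

Lemma E_NF a m : is_NF m -> is_NF (E a * m).
Proof.
case=> f [u [g [[hf hu hg v] ->]]].
case: (boolP (apart a (f a))) => [ha|/[dup] na /napartP[fa|fa]].
(* The strand [a] lies on a double arc of [f], which [E a] cuts into self-mirror arcs at [a] and at
   [f a]. *)
- have hstab : forall x, orb2 a (f a) (f x) = orb2 a (f a) x.
    by apply: orb2_stable; rewrite ?invol_K // /orb2 eqxx ?orbT.
  have [f' hf' ef'] := sym_invol_patch hf sym_invol_sgp (orb2_sg a (f a)) hstab
    (fun x => etrans (congr1 _ (permE _ x)) (orb2_sg a (f a) x)).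
  have mv y : (f' y == y) = (f y == y).
    rewrite ef'; case: ifP => //; move: y; apply: orb2P.
    + by rewrite permE (negbTE (sgN a)) (negbTE (apart_neq ha)).
    + by rewrite permE (negbTE (sgN _)) invol_K // eq_sym (negbTE (apart_neq ha)).
    + by move=> y; rewrite !permE invol_sg // !(sg_eq sgK) => <-.
  exists f', u, g; split; first by split=> // y; rewrite v mv.
  have eX : Xprod f = X a (f a) * Xprod f'.
    apply: Xprod_add => //; try by rewrite ef' /orb2 eqxx ?orbT permE /apart eqxx andbF.
    by move=> y /negbTE ny; rewrite ef' ny.
  rewrite /NF (Eprod_eq mv) !mulgA; congr (_ * _ * _).
  have naf : ~~ apart a (f' a) by rewrite ef' /orb2 eqxx permE /apart eqxx andbF.
  have nafb : ~~ apart (f a) (f' (f a)) by rewrite ef' /orb2 eqxx orbT permE /apart eqxx andbF.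
  have ma : f a != a by rewrite apart_neq.
  have mb : f (f a) != f a by rewrite invol_K // eq_sym.
  rewrite eX !mulgA -[in LHS](E_Eprod ma) -[in LHS](E_Eprod mb) !mulgA.
  rewrite -[_ * Xprod f' * E a]mulgA -E_Xprod // mulgA.
  rewrite -[_ * Xprod f' * E (f a)]mulgA -E_Xprod // mulgA.
  rewrite E_X_E // -[_ * E (f a) * E (f a)]mulgA X_idem //.
  rewrite -(mulgA _ (E (f a))) E_Xprod // mulgA E_Xprod // -!mulgA.
  by rewrite [E (f a) * _]E_Eprod // E_Eprod.
(* The strands [a] and [sg a] are vertical: [E a] joins them in the top row and their ends [u a],
   [sg (u a)] in the bottom row. *)
- have ga : g (u a) = u a by apply/eqP; rewrite v fa.
  have sgp_orb b x : orb2 b b (sgp x) = orb2 b b x by rewrite permE orb2_sg.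
  have stab h b : sym_invol h -> h b = b -> forall x, orb2 b b (h x) = orb2 b b x.
    by move=> hh hb; apply: orb2_stable; rewrite // hb /orb2 eqxx.
  have [f' hf' ef'] := sym_invol_patch hf sym_invol_sgp (orb2_sg a a) (stab _ _ hf fa) (sgp_orb a).
  have [g' hg' eg'] := sym_invol_patch hg sym_invol_sgp (orb2_sg (u a) (u a))
    (stab _ _ hg ga) (sgp_orb (u a)).
  exists f', u, g'; split.
    split=> // y; rewrite eg' ef' orb2_perm //; case: ifP => // _.
    by rewrite !permE !(negbTE (sgN _)).
  have eq_arcs (h h' : {perm T}) (b : T) : sym_invol h -> h b = b ->
      (forall x, h' x = if orb2 b b x then sgp x else h x) -> Xprod h' = Xprod h.
    move=> hh hb eh; apply: Xprod_eq => // y.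
      rewrite eh; case: ifP => // Oy; suff -> : h y = y by rewrite /apart eqxx.
      by move: y Oy; apply: orb2P => // y hy; rewrite invol_sg // hy.
    by rewrite eh; case: ifP => //; rewrite permE /apart eqxx andbF.
  rewrite /NF (eq_arcs _ _ _ hf fa ef') (eq_arcs _ _ _ hg ga eg').
  rewrite (@Eprod_add f f' a) ?mulgA ?E_Xprod // => y.
  by rewrite ef'; case: ifP => Oy; rewrite /= ?andbT // permE (negbTE (sgN _)) andbF.
(* A self-mirror arc at [a] is already present and absorbs [E a]. *)
- exists f, u, g; split=> //.
  by rewrite /NF !mulgA E_Xprod // -(mulgA _ (E a)) E_Eprod // fa sgN.
Qed.

Let X_NF_absorb f u g a b : apart a b -> NFvalid f u g -> f a = b ->
  X a b * NF f u g = NF f u g.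
Proof. by move=> hab [hf _ _ _] fa; rewrite /NF !mulgA -{1}fa X_Xprod // fa. Qed.

(** The double arc at [b] slides: [X a b] acts on it as a reflection, by [X_X_refl]. *)
Let X_NF_refl f u g a b : apart a b -> NFvalid f u g -> apart b (f b) -> f b != a ->
  is_NF (X a b * NF f u g).
Proof.
move=> hab h hb hne; have [hf _ _ _] := h.
have -> : X a b * NF f u g = tau (refl a (f b)) * NF f u g.
  rewrite /NF -(X_Xprod hf hb) !mulgA X_X_refl //; last by rewrite eq_sym.
by apply: tau_NF => //; exists f, u, g.
Qed.

(** If [b] also carries a self-mirror arc, the two are replaced by the double arc from [a] to [b].
    If [b] is vertical, its strand turns back through the arc at [a], leaving a self-mirror arc at
    [u b] in the bottom row. *)
Let X_NF_single f u g a b : apart a b -> NFvalid f u g -> f a = sg a -> ~~ apart b (f b) ->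
  is_NF (X a b * NF f u g).
Proof.
move=> hab h fa nb; have [hf hu hg v] := h.
have na : ~~ apart a (f a) by rewrite fa /apart eqxx andbF.
have fb : f b = b \/ f b = sg b := napartP nb.
have reflO x : orb2 a b (refl a b x) = orb2 a b x.
  apply: orb2_stable; rewrite ?sym_invol_refl // ?refl_l ?refl_r /orb2 eqxx ?orbT //.
have stf : forall x, orb2 a b (f x) = orb2 a b x.
  apply: orb2_stable; rewrite // ?fa /orb2 ?eqxx ?orbT //.
  by case: fb => ->; rewrite eqxx ?orbT.
have [f' hf' ef'] := sym_invol_patch hf (sym_invol_refl a b) (orb2_sg a b) stf reflO.
have f'a : f' a = b by rewrite ef' /orb2 eqxx refl_l.
have mv x : (f' x == x) = if orb2 a b x then false else f x == x.
  rewrite ef'; case: ifP => // Ox; move: x Ox; apply: orb2P.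
  - by rewrite refl_l (negbTE (apart_neq hab)).
  - by rewrite refl_r eq_sym (negbTE (apart_neq hab)).
  - by move=> x <-; rewrite (sympP _ _ (sympR a b)) (sg_eq sgK).
have eX : Xprod f' = X a b * Xprod f.
  by apply: Xprod_add => // x /negbTE nO; rewrite ef' nO.
have gua : g (u a) != u a by rewrite v fa.
case: fb => fb; last first.
  have mv' x : (f' x == x) = (f x == x).
    rewrite mv; case: ifP => // Ox; apply/esym; move: x Ox; apply: orb2P.
    - by rewrite fa (negbTE (sgN a)).
    - by rewrite fb (negbTE (sgN b)).
    - by move=> x <-; rewrite invol_sg // (sg_eq sgK).
  exists f', u, g; split; first by split=> // x; rewrite v mv'.
  by rewrite /NF eX (Eprod_eq mv') !mulgA.
have gb : g (u b) = u b by apply/eqP; rewrite v fb.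
have [g' hg' eg'] : exists2 g', sym_invol g' & forall x, g' x = if orb2 (u b) (u b) x then sgp x else g x.
  apply: sym_invol_patch; rewrite // ?sym_invol_sgp //.
    by apply: orb2_stable; rewrite // gb /orb2 eqxx.
  by move=> x; rewrite permE orb2_sg.
exists f', u, g'; split.
  split=> // x; rewrite eg' orb2_perm // mv.
  case: (boolP (orb2 b b x)) => Ob.
    have -> : orb2 a b x by move: Ob; rewrite /orb2 => /or4P[] ->; rewrite ?orbT.
    by rewrite permE (negbTE (sgN _)).
  case: ifP => // Ox; rewrite v; apply/negbTE.
  move: Ox Ob; rewrite /orb2 => /or4P[] /eqP->; rewrite ?eqxx ?orbT // => _.
    by rewrite fa.
  by rewrite invol_sg // fa (sg_eq sgK).
have eXg : Xprod g' = Xprod g.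
  apply: Xprod_eq => // y.
    rewrite eg'; case: ifP => // Oy; suff -> : g y = y by rewrite /apart eqxx.
    by move: y Oy; apply: orb2P => // y hy; rewrite invol_sg // hy.
  by rewrite eg'; case: ifP => //; rewrite permE /apart eqxx andbF.
have eE : Eprod f' = E b * Eprod f.
  apply: Eprod_add => x; rewrite mv; case: (boolP (orb2 b b x)) => Ob.
    rewrite andbF; suff -> : orb2 a b x by [].
    by move: Ob; rewrite /orb2 => /or4P[] ->; rewrite ?orbT.
  rewrite andbT; case: ifP => // Ox; apply/esym/negbTE.
  move: Ox Ob; rewrite /orb2 => /or4P[] /eqP->; rewrite ?eqxx ?orbT // => _.
    by rewrite fa.
  by rewrite invol_sg // fa (sg_eq sgK).
rewrite /NF eX eE eXg !mulgA; congr (_ * _ * _).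
have ma : f a != a by rewrite fa.
have hXE : X a b * E a = X a b * E a * E b.
  have ba : b != a by rewrite apart_neq.
  by have := @X_E b a; rewrite [X b a]XC // apartC; apply.
rewrite -[in LHS](E_Eprod ma) -[in RHS](E_Eprod ma) !mulgA.
rewrite -(mulgA _ (Xprod f) (E a)) -E_Xprod // mulgA hXE.
rewrite -(mulgA _ (Xprod f) (E b)) -(E_Xprod (a := b)) // !mulgA.
rewrite -(mulgA _ (Xprod f) (E a)) -E_Xprod // !mulgA.
by rewrite -(mulgA _ (E b) (E a)) -E_comm !mulgA.
Qed.

(** Two vertical strands are closed in both rows. By [X_E_E_X], one copy of [X a b] stays on top,
    one travels through [tau u] to the bottom as [X (u a) (u b)], and the self-mirror arcs between
    them enlarge [Eprod]. *)
Let X_NF_through f u g a b : apart a b -> NFvalid f u g -> f a = a -> f b = b ->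
  is_NF (X a b * NF f u g).
Proof.
move=> hab h fa fb; have [hf hu hg v] := h.
have habu : apart (u a) (u b) by rewrite apart_perm.
have patch k c d : apart c d -> sym_invol k -> k c = c -> k d = d ->
    exists k', [/\ sym_invol k', (forall x, (k' x == x) = (k x == x) && ~~ orb2 c d x),
                   Xprod k' = X c d * Xprod k & k' c = d].
  move=> hcd hk kc kd.
  have reflO x : orb2 c d (refl c d x) = orb2 c d x.
    by apply: orb2_stable; rewrite ?sym_invol_refl // ?refl_l ?refl_r /orb2 eqxx ?orbT.
  have stk : forall x, orb2 c d (k x) = orb2 c d x.
    by apply: orb2_stable; rewrite // ?kc ?kd /orb2 ?eqxx ?orbT.
  have [k' hk' ek'] := sym_invol_patch hk (sym_invol_refl c d) (orb2_sg c d) stk reflO.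
  have k'c : k' c = d by rewrite ek' /orb2 eqxx refl_l.
  exists k'; split=> //.
    move=> x; rewrite ek'; case: ifP => Ox; rewrite /= ?andbT // andbF; move: x Ox; apply: orb2P.
    - by rewrite refl_l (negbTE (apart_neq hcd)).
    - by rewrite refl_r eq_sym (negbTE (apart_neq hcd)).
    - by move=> x <-; rewrite (sympP _ _ (sympR c d)) (sg_eq sgK).
  apply: Xprod_add => //; rewrite ?kc ?kd /apart ?eqxx //.
  by move=> x /negbTE nO; rewrite ek' nO.
have ga : g (u a) = u a by apply/eqP; rewrite v fa.
have gb : g (u b) = u b by apply/eqP; rewrite v fb.
have [f' [hf' mf eXf _]] := patch f a b hab hf fa fb.
have [g' [hg' mg eXg _]] := patch g _ _ habu hg ga gb.
exists f', u, g'; split; first by split=> // x; rewrite mg mf v orb2_perm.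
have [fa' [hfa' mfa]] : exists fa', sym_invol fa' /\ forall x, (fa' x == x) = (f x == x) && ~~ orb2 b b x.
  have [k hk ek] : exists2 k, sym_invol k & forall x, k x = if orb2 b b x then sgp x else f x.
    apply: sym_invol_patch; rewrite // ?sym_invol_sgp //.
      by apply: orb2_stable; rewrite // fb /orb2 eqxx.
    by move=> x; rewrite permE orb2_sg.
  exists k; split=> // x; rewrite ek; case: ifP => Ox; rewrite /= ?andbT // permE.
  by rewrite (negbTE (sgN x)) andbF.
have eE : Eprod f' = E a * (E b * Eprod f).
  rewrite -(@Eprod_add f fa') // (@Eprod_add fa' f' a) // => x.
  rewrite mf mfa -andbA; congr (_ && _); rewrite /orb2.
  by case: (x == a); case: (x == b); case: (x == sg a); case: (x == sg b).
have na : ~~ apart a (f a) by rewrite fa /apart eqxx.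
have nb : ~~ apart b (f b) by rewrite fb /apart eqxx.
have abX : a != b by rewrite eq_sym apart_neq.
have cXE : X a b * Eprod f = Eprod f * X a b.
  apply: commute_prodl => c; rewrite mem_filter => /andP[hc _].
  have away d : f d = d -> apart c d.
    move=> fd; rewrite /apart; apply/andP; split; apply: contra hc => /eqP eq1.
      by rewrite -eq1 fd.
    by rewrite -[c]sgK -eq1 invol_sg // fd.
  by rewrite -E_X_comm // away.
have tX : tau u * X (u a) (u b) = X a b * tau u by rewrite X_tau.
rewrite /NF eXf eXg eE !mulgA.
rewrite -(mulgA _ (tau u) (X _ _)) tX !mulgA.
rewrite -(mulgA _ (Eprod f) (X a b)) -cXE !mulgA; congr (_ * _ * _ * _).
rewrite X_Xprod_comm // -!(mulgA (Xprod f)); congr (_ * _).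
by rewrite ?mulgA X_E_E_X.
Qed.

Lemma X_NF a b m : a != b -> is_NF m -> is_NF (X a b * m).
Proof.
case/neqVapart => [->|hab]; first exact: E_NF.
case=> f [u [g [h ->]]]; have [hf hu hg v] := h.
have hba : apart b a by rewrite apartC.
have abX : a != b by rewrite eq_sym apart_neq.
have [fab|nab] := eqVneq (f a) b; first by rewrite X_NF_absorb //; exists f, u, g.
have fba : f b != a by apply: contra nab => /eqP <-; rewrite invol_K.
case: (boolP (apart b (f b))) => hb; first exact: X_NF_refl.
case: (boolP (apart a (f a))) => ha; first by rewrite XC //; apply: X_NF_refl.
case: (napartP ha) => fa; last exact: X_NF_single.
case: (napartP hb) => fb; first exact: X_NF_through.
by rewrite XC //; apply: X_NF_single.
Qed.

(** Two choices of [u] differ by exchanges of non-vertical strands, each absorbed by [Eprod f]; the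
    induction is on the number of disagreements. *)
Lemma NF_eq f g u v : NFvalid f u g -> NFvalid f v g ->
  (forall a, f a = a -> u a = v a) -> NF f u g = NF f v g.
Proof.
move=> [hf hu hg Vu] hv.
have [k] := ubnP #|[pred a | u a != v a]|; elim: k v hv => // k IH v hv hk uv.
have [_ hvW _ Vv] := hv.
case: (pickP [pred a | u a != v a]) => [a /= ha|same]; last first.
  by congr NF; apply/permP => x; move/negbFE: (same x) => /eqP.
(* Composing [v] with the reflection in [a] and [b] repairs the value at [a] and spoils none that
   was right. *)
pose b := v^-1 (u a).
have vb : v b = u a by rewrite permKV.
have ab : a != b by apply: contra ha => /eqP eq1; rewrite -vb -eq1.
have fa : f a != a by apply: contra ha => /eqP /uv ->.
have fb : f b != b by rewrite -Vv vb Vu.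
have -> : NF f v g = NF f (refl a b * v) g.
  by rewrite /NF tauM // -!mulgA [Eprod f * (tau (refl a b) * _)]mulgA Eprod_refl.
have fix_id x : f x = x -> refl a b x = x.
  move=> fx; rewrite refl_id //.
  - by apply: contra fa => /eqP <-; rewrite fx.
  - by apply: contra fb => /eqP <-; rewrite fx.
  - by apply: contra fa => /eqP eq1; rewrite -[a]sgK -eq1 invol_sg // fx.
  - by apply: contra fb => /eqP eq1; rewrite -[b]sgK -eq1 invol_sg // fx.
have stf x : (f (refl a b x) == refl a b x) = (f x == x).
  have [fx|fx] := eqVneq (f x) x; first by rewrite fix_id // fx eqxx.
  apply: contraNF fx => /eqP fx; have := fix_id _ fx.
  by move/perm_inj => eq1; rewrite eq1 in fx; rewrite fx.
apply: IH.
- split=> //; first exact: sympM.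
  by move=> x; rewrite permM Vv stf.
- rewrite ltnS in hk; apply: leq_trans hk; apply: proper_card; apply/properP; split.
    apply/subsetP => x; rewrite !inE permM; apply: contra => /eqP uvx.
    rewrite refl_id ?uvx //.
    + by apply: contra ha => /eqP <-; rewrite uvx.
    + apply: contra ab => /eqP eq1; rewrite -(inj_eq (@perm_inj _ u)).
      by rewrite -eq1 uvx eq1 vb.
    + apply: contra ha => /eqP eq1; rewrite -(sg_eq sgK) -(sympP _ _ hu) -(sympP _ _ hvW).
      by rewrite -eq1 uvx.
    + apply: contra ab => /eqP eq1; rewrite -(inj_eq (@perm_inj _ u)) -vb.
      by rewrite -(sg_eq sgK) -(sympP _ _ hu) -(sympP _ _ hvW) -eq1 uvx.
  by exists a; rewrite !inE ?ha // permM refl_l vb eqxx.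
- by move=> x fx; rewrite permM fix_id // uv.
Qed.

Lemma X_NF_top f u g a : NFvalid f u g -> f a != a -> X a (f a) * NF f u g = NF f u g.
Proof.
move=> [hf _ _ _] ma; rewrite /NF !mulgA.
case: (boolP (apart a (f a))) => ha; first by rewrite X_Xprod.
case: (napartP ha) => fa; first by rewrite fa eqxx in ma.
by rewrite fa E_Xprod // -(mulgA _ (E a)) E_Eprod.
Qed.

Lemma NF_X_bot f u g b : NFvalid f u g -> g b != b -> NF f u g * X b (g b) = NF f u g.
Proof.
move=> [hf hu hg v] mb; rewrite /NF -!mulgA.
case: (boolP (apart b (g b))) => hb; first by rewrite Xprod_X.
case: (napartP hb) => gb; first by rewrite gb eqxx in mb.
have ma : f (u^-1 b) != u^-1 b by rewrite -v permKV.
have e1 : tau u * E b = E (u^-1 b) * tau u by rewrite tau_X // (sympP _ _ (sympV hu)).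
by rewrite gb -E_Xprod // [tau u * _]mulgA e1 -mulgA [Eprod f * (E _ * _)]mulgA Eprod_E.
Qed.

Lemma r_NF i m : i < n -> is_NF m -> is_NF (r i * m).
Proof. by move=> hi; rewrite -tau_s //; apply: tau_NF. Qed.

Lemma e_NF i m : i < n -> is_NF m -> is_NF (e i * m).
Proof.
case: i => [|i] hi hm; first by rewrite -X_e0; apply: E_NF.
by rewrite -X_eS //; apply: X_NF => //; rewrite p_eq //; lia.
Qed.

(** * Reading the diagram off a normal form *)

Variable dg : M -> T * bool -> T * bool.

(* [dg m (a, true)] is the partner of the top dot [a] in the diagram of [m]. *)
Record diagram_rep : Prop := DiagramRep {
  dg_invol m : involutive (dg m);
  dg1 a : dg 1 (a, true) = (a, false);
  dg_thru m m' a b c : dg m (a, true) = (b, false) -> dg m' (b, true) = (c, false) ->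
    dg (m * m') (a, true) = (c, false);
  dg_top m m' a b : dg m (a, true) = (b, true) -> dg (m * m') (a, true) = (b, true);
  dg_bot m m' a b : dg m' (a, false) = (b, false) -> dg (m * m') (a, false) = (b, false);
  dg_turn_top m m' a b c d : dg m (a, true) = (b, false) -> dg m' (b, true) = (c, true) ->
    dg m (d, true) = (c, false) -> dg (m * m') (a, true) = (d, true);
  dg_turn_bot m m' a b c d : dg m' (b, true) = (a, false) -> dg m (b, false) = (c, false) ->
    dg m' (c, true) = (d, false) -> dg (m * m') (a, false) = (d, false);
  dg_r i a : i < n -> dg (r i) (a, true) = (s i a, false);
  dg_e0 t : dg (e 0%N) (p 0%N, t) = (sg (p 0%N), t);
  dg_e0_thru a : apart (p 0%N) a -> dg (e 0%N) (a, true) = (a, false);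
  dg_e1 t : dg (e 1%N) (p 0%N, t) = (p 1%N, t);
  dg_e1_sg t : dg (e 1%N) (sg (p 0%N), t) = (sg (p 1%N), t);
  dg_e1_thru a : apart (p 0%N) a -> apart (p 1%N) a -> dg (e 1%N) (a, true) = (a, false) }.
Hypothesis rep : diagram_rep.

Let dg_sym m (x y : T * bool) : dg m x = y -> dg m y = x.
Proof. by move=> <-; rewrite (dg_invol rep). Qed.

Lemma dg_tau u a : W u -> dg (tau u) (a, true) = (u a, false).
Proof.
move=> hu; have [h1 h2] := tau_wordP sgK sgN frame hu; rewrite -{2}h2.
rewrite -[tau u]/(prodw r (tau_word sgK sgN frame u)) {h2}.
elim: (tau_word sgK sgN frame u) a h1 => [|i l IH] a /=.
  by rewrite /prodw !big_nil perm1 (dg1 rep).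
by case/andP=> hi hl; rewrite !prodw_cons permM (dg_thru rep (dg_r rep _ hi) (IH _ hl)).
Qed.

Let dg_conj u m (x y : T) t : W u -> dg m (x, t) = (y, t) ->
  dg (conjt u m) (u x, t) = (u y, t).
Proof.
move=> hu hxy; have V z : dg (tau u^-1) (u z, true) = (z, false).
  by rewrite dg_tau ?sympV // permK.
have U z : dg (tau u) (z, true) = (u z, false) by rewrite dg_tau.
rewrite /conjt; case: t hxy => hxy.
  by apply: (dg_top rep); exact: (dg_turn_top rep (V x) hxy (V y)).
by rewrite -mulgA; apply: (dg_bot rep); exact: (dg_turn_bot rep (U x) hxy (U y)).
Qed.

Let dg_conj_thru u m x : W u -> dg m (x, true) = (x, false) ->
  dg (conjt u m) (u x, true) = (u x, false).
Proof.
move=> hu hx; rewrite /conjt; apply: (dg_thru rep (b := x)); last by rewrite dg_tau.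
by apply: (dg_thru rep (b := x)) hx; rewrite dg_tau ?sympV // permK.
Qed.

Lemma dg_X a b t : a != b -> dg (X a b) (a, t) = (b, t).
Proof.
case/neqVapart => [->|hab].
  have [u hu <-] := move1 a; rewrite -(sympP _ _ hu) -conjtX // X_e0.
  by apply: dg_conj => //; apply: (dg_e0 rep).
have [u hu [<- <-]] := move2 hab; rewrite -conjtX ?p_eq // X_eS //.
by apply: dg_conj => //; apply: (dg_e1 rep).
Qed.

Lemma dg_X_thru a b c : a != b -> apart a c -> apart b c -> dg (X a b) (c, true) = (c, false).
Proof.
case/neqVapart => [->|hab] hac hbc.
  have [u hu eu] := move1 a; move: hac; rewrite -eu -[c](permKV u) apart_perm // => hc.
  rewrite -(sympP _ _ hu) -conjtX // X_e0.
  by apply: dg_conj_thru => //; apply: (dg_e0_thru rep).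
have [u hu [ea eb]] := move2 hab; move: hac hbc.
rewrite -ea -eb -[c](permKV u) !apart_perm // => hac hbc.
rewrite -conjtX ?p_eq // X_eS //.
by apply: dg_conj_thru => //; apply: (dg_e1_thru rep).
Qed.

Let dg_prod_thru (I : eqType) (F : I -> M) (l : seq I) c :
  (forall i, i \in l -> dg (F i) (c, true) = (c, false)) ->
  dg (\prod_(i <- l) F i) (c, true) = (c, false).
Proof.
elim: l => [|i l IH] h; first by rewrite big_nil (dg1 rep).
rewrite big_cons; apply: (dg_thru rep (h i (mem_head _ _))); apply: IH => j hj.
by apply: h; rewrite inE hj orbT.
Qed.

Let apart_fixed f a c : sym_invol f -> f c = c -> f a != a -> apart a c.
Proof.
move=> hf fc fa; rewrite /apart; apply/andP; split; apply: contra fa => /eqP eq1.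
  by rewrite -eq1 fc.
by rewrite -[a]sgK -eq1 invol_sg // fc.
Qed.

Lemma Xprod_thru f c : sym_invol f -> f c = c -> dg (Xprod f) (c, true) = (c, false).
Proof.
move=> hf fc; apply: dg_prod_thru => -[a b]; rewrite mem_arcs /= => /andP[ha /eqP->].
have fa : f a != a by rewrite apart_neq.
rewrite /Xs /= dg_X_thru //; first by rewrite eq_sym.
  exact: apart_fixed fc fa.
by apply: apart_fixed fc _; rewrite // invol_K // eq_sym.
Qed.

Lemma Eprod_thru f c : sym_invol f -> f c = c -> dg (Eprod f) (c, true) = (c, false).
Proof.
move=> hf fc; apply: dg_prod_thru => a; rewrite mem_filter => /andP[fa _].
have h := apart_fixed hf fc fa.
by rewrite dg_X_thru // apart_sgl.
Qed.

Lemma dg_NF_thru f u g a : NFvalid f u g -> f a = a -> dg (NF f u g) (a, true) = (u a, false).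
Proof.
move=> [hf hu hg v] fa; have gu : g (u a) = u a by apply/eqP; rewrite v fa.
rewrite /NF; apply: (dg_thru rep) (Xprod_thru hg gu); apply: (dg_thru rep) (dg_tau _ hu).
by apply: (dg_thru rep) (Eprod_thru hf fa); apply: Xprod_thru.
Qed.

(** A normal form absorbs each of its own top arcs on the left, and an arc at the top of the left
    factor survives in a product. *)
Lemma dg_NF_top f u g a : NFvalid f u g -> f a != a -> dg (NF f u g) (a, true) = (f a, true).
Proof.
move=> h fa; rewrite -(X_NF_top h fa); apply: (dg_top rep).
by rewrite dg_X // eq_sym.
Qed.

Lemma dg_NF_bot f u g b : NFvalid f u g -> g b != b -> dg (NF f u g) (b, false) = (g b, false).
Proof.
move=> h gb; rewrite -(NF_X_bot h gb); apply: (dg_bot rep).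
by rewrite dg_X // eq_sym.
Qed.

Let dg_NF_bot_thru f u g a : NFvalid f u g -> f a = a -> dg (NF f u g) (u a, false) = (a, true).
Proof. by move=> h fa; apply: dg_sym; apply: dg_NF_thru. Qed.

Lemma dg_symmetric m a t : is_NF m -> dg m (sg a, t) = (sg (dg m (a, t)).1, (dg m (a, t)).2).
Proof.
move=> [f [u [g [h ->]]]]; have [hf hu hg v] := h; case: t.
  have [fa|fa] := eqVneq (f a) a; last first.
    have fsa : f (sg a) != sg a by rewrite invol_sg // (sg_eq sgK).
    by rewrite !(dg_NF_top h) // invol_sg.
  have fsa : f (sg a) = sg a by rewrite invol_sg // fa.
  by rewrite !(dg_NF_thru h) //= (sympP _ _ hu).
have [ga|ga] := eqVneq (g a) a; last first.
  have gsa : g (sg a) != sg a by rewrite invol_sg // (sg_eq sgK).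
  by rewrite !(dg_NF_bot h) // invol_sg.
have fb : f (u^-1 a) = u^-1 a by apply/eqP; rewrite -v permKV ga.
have fsb : f (sg (u^-1 a)) = sg (u^-1 a) by rewrite invol_sg // fb.
have := dg_NF_bot_thru h fb; rewrite permKV => ->.
by have := dg_NF_bot_thru h fsb; rewrite (sympP _ _ hu) permKV => ->.
Qed.

(** The horizontal strands give [f] and [g], the vertical ones give [u] on the fixed points of [f],
    and [NF_eq] covers the remaining freedom. *)
Theorem dg_inj m m' : is_NF m -> is_NF m' -> dg m =1 dg m' -> m = m'.
Proof.
move=> [f [u [g [h ->]]]] [f' [u' [g' [h' ->]]]] e1.
have [hf hu hg v] := h; have [hf' hu' hg' v'] := h'.
have ef : f = f'.
  apply/permP => a; have [fa|fa] := eqVneq (f a) a; have [fa'|fa'] := eqVneq (f' a) a.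
  - by rewrite fa fa'.
  - by have := e1 (a, true); rewrite (dg_NF_thru h fa) (dg_NF_top h' fa').
  - by have := e1 (a, true); rewrite (dg_NF_top h fa) (dg_NF_thru h' fa').
  - by have := e1 (a, true); rewrite (dg_NF_top h fa) (dg_NF_top h' fa') => -[].
have thru b f0 u0 g0 : NFvalid f0 u0 g0 -> g0 b = b -> dg (NF f0 u0 g0) (b, false) = (u0^-1 b, true).
  move=> h0 gb; apply: dg_sym; rewrite (dg_NF_thru h0) ?permKV //.
  by case: h0 => _ _ _ v0; apply/eqP; rewrite -v0 permKV gb.
have eg : g = g'.
  apply/permP => b; have [gb|gb] := eqVneq (g b) b; have [gb'|gb'] := eqVneq (g' b) b.
  - by rewrite gb gb'.
  - by have := e1 (b, false); rewrite (thru _ _ _ _ h gb) (dg_NF_bot h' gb').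
  - by have := e1 (b, false); rewrite (dg_NF_bot h gb) (thru _ _ _ _ h' gb').
  - by have := e1 (b, false); rewrite (dg_NF_bot h gb) (dg_NF_bot h' gb') => -[].
subst f' g'; apply: NF_eq => // a fa.
by have := e1 (a, true); rewrite (dg_NF_thru h fa) (dg_NF_thru h' fa) => -[].
Qed.

(** A diagram prescribes [u] on its vertical strands only. A full symmetric permutation is built
    from the identity by reflections, each correcting one value and keeping the correct ones. *)
Lemma symp_extension (S : pred T) (phi : T -> T) :
  (forall x, S (sg x) = S x) -> (forall x, S x -> phi (sg x) = sg (phi x)) ->
  {in S &, injective phi} -> exists2 u, W u & forall x, S x -> u x = phi x.
Proof.
move=> Ssg phisg phiI.
suff gen k u : W u -> #|[pred x | S x && (u x != phi x)]| < k ->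
    exists2 u, W u & forall x, S x -> u x = phi x.
  by apply: (gen #|[pred x | S x && ((1 : {perm T}) x != phi x)]|.+1 1); rewrite ?symp1.
elim: k u => // k IH u hu hk.
case: (pickP [pred x | S x && (u x != phi x)]) => [a /= /andP[Sa ua]|same]; last first.
  by exists u => // x Sx; move: (same x); rewrite /= Sx => /negbFE/eqP.
have ok x : S x -> u x = phi x -> refl (u a) (phi a) (u x) = phi x.
  move=> Sx ux; rewrite refl_id //.
  - by rewrite (inj_eq perm_inj); apply: contra ua => /eqP <-; rewrite ux.
  - by rewrite ux; apply: contra ua => /eqP /phiI eq1; rewrite -eq1 ?ux.
  - rewrite -(sympP _ _ hu) (inj_eq perm_inj); apply: contra ua => /eqP eq1.
    by rewrite -(sg_eq sgK) -(sympP _ _ hu) -phisg // -eq1 ux.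
  - rewrite ux -phisg //; apply: contra ua => /eqP /phiI eq1.
    rewrite -(sg_eq sgK) -(sympP _ _ hu) -phisg // -eq1 ?ux //.
    by rewrite unfold_in Ssg.
apply: (IH (u * refl (u a) (phi a))); first exact: sympM.
rewrite ltnS in hk; apply: leq_trans hk; apply: proper_card; apply/properP; split.
  apply/subsetP => x; rewrite !inE => /andP[Sx hx]; rewrite Sx /=.
  by apply: contra hx => /eqP ux; rewrite permM ok.
by exists a; rewrite !inE Sa ?ua // permM refl_l eqxx.
Qed.

Definition symmetric_matching (d : T * bool -> T * bool) : Prop :=
  [/\ involutive d, forall x : T * bool, d x != x & forall a t, d (sg a, t) = (sg (d (a, t)).1, (d (a, t)).2)].

Theorem dg_surj (d : T * bool -> T * bool) : symmetric_matching d ->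
  exists2 m, is_NF m & dg m =1 d.
Proof.
move=> [dK dN dS].
(* The arcs inside row [t]; a dot whose strand is vertical becomes a fixed point. *)
pose side t a := if (d (a, t)).2 == t then (d (a, t)).1 else a.
have sideK t : involutive (side t).
  move=> a; rewrite /side; case: (eqVneq (d (a, t)).2 t) => [e1|e1]; last by rewrite (negbTE e1).
  have -> : ((d (a, t)).1, t) = d (a, t) by rewrite -{2}e1; case: (d _).
  by rewrite dK eqxx.
pose f t : {perm T} := perm (inv_inj (sideK t)).
have hf t : sym_invol (f t).
  apply/sym_involP; split; last by move=> x; rewrite !permE sideK.
  by apply/sympP => x; rewrite !permE /side dS /=; case: ifP.
have arc t a : f t a != a -> d (a, t) = (f t a, t).
  rewrite permE /side; case: (eqVneq (d (a, t)).2 t) => [e1 _|]; last by rewrite eqxx.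
  by rewrite -{3}e1; case: (d _).
have fix1 t a : f t a = a -> d (a, t) = ((d (a, t)).1, ~~ t).
  rewrite permE /side; case: (eqVneq (d (a, t)).2 t) => e1 e2.
    by have := dN (a, t); case: (d (a, t)) e1 e2 => x y /= -> ->; rewrite eqxx.
  by case: (d (a, t)) e1 => x y /=; case: y; case: t.
have fix2 t a b : d (a, t) = (b, ~~ t) -> f t a = a.
  by move=> e1; rewrite permE /side e1 /=; case: t {e1}.
pose S := [pred a | f true a == a].
have [||x y /eqP fx /eqP fy exy|u hu eu] := @symp_extension S (fun a => (d (a, true)).1).
- by move=> x; rewrite /S /= invol_sg // (sg_eq sgK).
- by move=> x _; rewrite dS.
- by have := fix1 _ _ fx; rewrite exy -(fix1 _ _ fy) => /(inv_inj dK) [].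
have v : NFvalid (f true) u (f false).
  split=> // x; apply/eqP/eqP => e1.
    have e2 := fix1 _ _ e1; set z := (d (u x, false)).1 in e2.
    have e3 : d (z, true) = (u x, false) by rewrite -[LHS]/(d (z, ~~ false)) -e2 dK.
    have fz : f true z = z := fix2 true _ _ e3.
    have : u z = u x by rewrite eu ?e3 //=; apply/eqP.
    by move/perm_inj <-.
  have e2 := fix1 _ _ e1; rewrite -eu in e2; last exact/eqP.
  by apply: (fix2 false _ x); rewrite -[(u x, false)]/(u x, ~~ true) -e2 dK.
exists (NF (f true) u (f false)); first by exists (f true), u, (f false).
have top a : dg (NF (f true) u (f false)) (a, true) = d (a, true).
  have [fa|fa] := eqVneq (f true a) a; last by rewrite (dg_NF_top v fa) arc.
  by rewrite (dg_NF_thru v fa) (fix1 _ _ fa) eu //; apply/eqP.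
case=> b [] //; have [gb|gb] := eqVneq (f false b) b; last by rewrite (dg_NF_bot v gb) arc.
apply: dg_sym; rewrite (fix1 _ _ gb) top -[(_, true)]/(_, ~~ false) -(fix1 _ _ gb).
exact: dK.
Qed.

End BrauerMonoid.

(** * Counting symmetric matchings *)

Section CountingInvolutions.
Variables (T : finType) (sg : T -> T).
Hypotheses (sgK : involutive sg) (sgN : forall x, sg x != x).
Implicit Types (f g : {perm T}) (A : {set T}) (a b x : T).

Definition sym_invols A : {set {perm T}} :=
  [set f | sym_invol sg f && [forall x, (f x != x) == (x \in A)]].

Let sym_involsP A f :
  reflect (sym_invol sg f /\ forall x, (f x != x) = (x \in A)) (f \in sym_invols A).
Proof.
rewrite inE; apply: (iffP andP) => -[h1 h2]; split=> //.
  by move=> x; move/forallP: h2 => /(_ x) /eqP.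
by apply/forallP => x; rewrite h2.
Qed.

Let orb a b : {set T} := [set x | orb2 sg a b x].

Let orbE a b x : (x \in orb a b) = [|| x == a, x == b, x == sg a | x == sg b].
Proof. by rewrite inE. Qed.

Let orb_refl a b x : (refl sg a b x \in orb a b) = (x \in orb a b).
Proof.
have st y : y \in orb a b -> refl sg a b y \in orb a b.
  have hs z : refl sg a b (sg z) = sg (refl sg a b z) := sympP _ _ (symp_refl sgK sgN a b) z.
  rewrite !orbE => /or4P[] /eqP->; rewrite ?hs ?refl_l ?refl_r // !eqxx ?orbT //.
have K y : refl sg a b (refl sg a b y) = y by rewrite -permM reflK // perm1.
by apply/idP/idP => [/st|/st//]; rewrite K.
Qed.

Let refl_out a b x : x \notin orb a b -> refl sg a b x = x.
Proof. by rewrite orbE !negb_or => /and4P[h1 h2 h3 h4]; apply: refl_id. Qed.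

Let refl_in a b x : a != b -> x \in orb a b -> refl sg a b x != x.
Proof.
move=> ab; have hs z : refl sg a b (sg z) = sg (refl sg a b z) := sympP _ _ (symp_refl sgK sgN a b) z.
rewrite orbE => /or4P[] /eqP->; rewrite ?hs ?refl_l ?refl_r ?(sg_eq sgK) // eq_sym //.
Qed.

(** Multiplication by the reflection toggles between no arc on the orbit of [a], [b] and the arcs of
    the reflection itself. *)
Let sym_invol_mulP f a b : sym_invol sg f ->
  {in orb a b, forall x, f x = x} \/ {in orb a b, f =1 refl sg a b} ->
  sym_invol sg (f * refl sg a b)%g /\
  forall x, (f * refl sg a b)%g x = if x \in orb a b then refl sg a b (f x) else f x.
Proof.
move=> /sym_involP[fW fK] hf.
have K y : refl sg a b (refl sg a b y) = y by rewrite -permM reflK // perm1.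
have stf x : (f x \in orb a b) = (x \in orb a b).
  have st y : y \in orb a b -> f y \in orb a b.
    by move=> hy; case: hf => /(_ y hy) ->; rewrite ?orb_refl.
  by apply/idP/idP => [/st|/st//]; rewrite fK.
have E x : (f * refl sg a b)%g x = if x \in orb a b then refl sg a b (f x) else f x.
  by rewrite permM; case: ifPn => // hx; apply: refl_out; rewrite stf.
split=> //; apply/sym_involP; split; first by rewrite sympM ?symp_refl.
move=> x; rewrite (E x) E; case: (boolP (x \in orb a b)) => hx; last by rewrite stf (negbTE hx) fK.
rewrite orb_refl stf hx.
have rx : refl sg a b x \in orb a b by rewrite orb_refl.
by case: hf => hf; rewrite (hf _ hx) (hf _ _) ?K.
Qed.

(** Removing the arc at [a] together with its mirror image is a bijection, realised as right
    multiplication by the reflection. *)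
Let card_with_arc A a b : (forall x, x \in A -> sg x \in A) -> a \in A -> b \in A -> a != b ->
  #|[set f in sym_invols A | f a == b]| = #|sym_invols (A :\: orb a b)|.
Proof.
move=> hA aA bA ab; have orbA x : x \in orb a b -> x \in A.
  by rewrite orbE => /or4P[] /eqP-> //; apply: hA.
rewrite -(card_imset _ (@mulIg _ (refl sg a b))); apply: eq_card => g.
apply/imsetP/sym_involsP => [[f]|[gI gA]].
  rewrite inE => /andP[/sym_involsP[fI fA] /eqP fa] ->.
  have /sym_involP[/sympP fW fK] := fI.
  have hs z : refl sg a b (sg z) = sg (refl sg a b z) := sympP _ _ (symp_refl sgK sgN a b) z.
  have fr x : x \in orb a b -> f x = refl sg a b x.
    by rewrite orbE => /or4P[] /eqP->; rewrite ?fW ?hs ?refl_l ?refl_r // -fa ?fK.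
  have [h1 h2] := sym_invol_mulP fI (or_intror fr).
  split=> // x; rewrite h2 in_setD; case: ifP => hx; last by rewrite fA.
  by rewrite fr // -permM reflK // perm1 eqxx.
have gx x : x \in orb a b -> g x = x.
  by move=> hx; apply/eqP; rewrite -[_ == _]negbK gA in_setD hx.
have [h1 h2] := sym_invol_mulP gI (or_introl gx).
exists (g * refl sg a b)%g; last by rewrite -mulgA reflK // mulg1.
rewrite inE; apply/andP; split; last first.
  by rewrite h2 orbE eqxx gx ?orbE ?eqxx // refl_l.
apply/sym_involsP; split=> // x; rewrite h2; case: ifP => hx.
  by rewrite gx // (orbA _ hx) refl_in.
by rewrite gA in_setD hx.
Qed.

Lemma card_sym_invols k A : (forall x, x \in A -> sg x \in A) -> #|A| = k.*2 ->
  #|sym_invols A| = aseq k.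
Proof.
have [N] := ubnP k; elim: N k A => // N IH k A hN hA cA.
have [A0|[a aA]] := set_0Vmem A.
  have k0 : k = 0 by move: cA; rewrite A0 cards0; lia.
  rewrite k0 /= -(cards1 (1 : {perm T})%g); apply: eq_card => f; rewrite in_set1.
  apply/sym_involsP/eqP => [[_ h]|->].
    by apply/permP => x; rewrite perm1; apply/eqP; rewrite -[_ == _]negbK h A0 inE.
  split; first by apply/sym_involP; split; [exact: symp1|move=> x; rewrite !perm1].
  by move=> x; rewrite perm1 eqxx A0 inE.
have saA : sg a \in A by apply: hA.
have orb_closed b x : x \in A :\: orb a b -> sg x \in A :\: orb a b.
  rewrite !in_setD => /andP[h /hA->]; rewrite andbT; move: h.
  by rewrite !orbE !(sg_eq sgK) !(sg_eqC sgK) !negb_or => /and4P[-> -> -> ->].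
have card_orb b : b \in A -> b != a -> #|A :\: orb a b| = #|A| - (if b == sg a then 2 else 4).
  move=> bA ba; rewrite cardsD (setIidPr _); last first.
    by apply/subsetP => x; rewrite orbE => /or4P[] /eqP-> //; apply: hA.
  congr (_ - _); case: eqVneq => [->|bsa].
    have -> : orb a (sg a) = [set a; sg a].
      apply/setP => x; rewrite orbE !inE sgK.
      by case: (x == a); case: (x == sg a).
    by rewrite cards2 eq_sym sgN.
  have -> : orb a b = [set a; sg a] :|: [set b; sg b].
    apply/setP => x; rewrite orbE !inE.
    by case: (x == a); case: (x == sg a); case: (x == b); case: (x == sg b).
  rewrite cardsU !cards2 ![_ == sg _]eq_sym !sgN.
  rewrite (_ : _ :&: _ = set0) ?cards0 //; apply/setP => x; rewrite !inE.
  apply/negbTE/negP => /andP[/orP[]/eqP-> /orP[]/eqP e1].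
  - by rewrite e1 eqxx in ba.
  - by rewrite e1 sgK eqxx in bsa.
  - by rewrite e1 eqxx in bsa.
  - by move: e1 => /(inv_inj sgK) e1; rewrite e1 eqxx in ba.
have total : #|sym_invols A| = \sum_(b in A :\ a) #|sym_invols (A :\: orb a b)|.
  rewrite -sum1_card (partition_big (fun f : {perm T} => f a) (fun b => b \in A :\ a)) /=.
    apply: eq_bigr => b; rewrite in_setD1 => /andP[ba bA].
    rewrite -(card_with_arc hA aA bA) 1?eq_sym // -sum1_card.
    by apply: eq_bigl => f; rewrite inE.
  move=> f /sym_involsP[/sym_involP[_ fK] h].
  by rewrite in_setD1 h aA -h fK eq_sym h.
have kpos : (0 < k)%N by have := cardsD1 a A; rewrite aA cA; lia.
have scard : #|A :\: orb a (sg a)| = k.-1.*2.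
  by rewrite card_orb // eqxx cA; lia.
rewrite total (bigD1 (sg a)) /=; last by rewrite in_setD1 sgN saA.
rewrite (IH k.-1) //; [|lia|exact: orb_closed].
have cbig : #|[pred b | (b \in A :\ a) && (b != sg a)]| = k.-1.*2.
  rewrite -scard; apply: eq_card => b; rewrite [RHS]in_setD ![in LHS]inE [in RHS]orbE sgK.
  by case: (b == a); case: (b == sg a); rewrite ?andbT ?andbF ?orbT.
(* With a single mirror pair left the partner of [a] is forced; from two pairs on, the count is the
   recursion of [aseq]. *)
case: k hN cA kpos scard cbig {total} => // -[|k] hN cA _ scard cbig /=.
  rewrite big_pred0 // => b; apply/negbTE/negP => hb.
  by have := card0_eq cbig b; rewrite !inE in hb *; rewrite hb.
rewrite (eq_bigr (fun=> aseq k)); last first.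
  move=> b /andP[]; rewrite in_setD1 => /andP[ba bA] bsa.
  apply: IH; [lia|exact: orb_closed|].
  by rewrite card_orb // (negbTE bsa) cA; lia.
rewrite sum_nat_const; congr (_ + _ * _).
by move: cbig => /=; rewrite mul2n.
Qed.

End CountingInvolutions.

(** The reflection splits the 4n dots into 2n mirror pairs, and a diagram is an involution moving
    every dot. *)
Lemma card_symmetric_diagrams n :
  #|[set d : diagram n.*2 | is_symmetric (val d)]| = aseq n.*2.
Proof.
have rK : involutive (@refl_dot n.*2) by case=> k t; rewrite /refl_dot /= rev_ordK.
have rN (x : dot n.*2) : refl_dot x != x.
  by apply/eqP => /(congr1 (fun y => val y.1)) /=; have := ltn_ord x.1; lia.
rewrite -(@card_sym_invols _ _ rK rN _ [set: dot n.*2]) //; last first.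
  by rewrite cardsT card_prod card_ord card_bool muln2.
pose g (f : {perm dot n.*2}) : bfun n.*2 := [ffun x => f x].
have gI : injective g by move=> f f' /ffunP e1; apply/permP => x; have := e1 x; rewrite !ffunE.
rewrite -(card_imset _ val_inj) -(card_imset _ gI); apply: eq_card => f.
apply/imsetP/imsetP => [[[f' df]]|[h]].
  rewrite inE /= => /forallP fS ->; have /diagramP[fK fN] := df.
  exists (perm (inv_inj fK)); last by apply/ffunP => x; rewrite ffunE permE.
  rewrite inE; apply/andP; split; last by apply/forallP => x; rewrite permE fN inE.
  apply/sym_involP; split; last by move=> x; rewrite !permE fK.
  by apply/sympP => x; rewrite !permE; apply/eqP.
rewrite inE => /andP[/sym_involP[/sympP hW hK] /forallP hN] ->.
have dh : is_diagram (g h).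
  by apply/diagramP; split=> x; rewrite !ffunE ?hK // (eqP (hN x)) inE.
exists (exist _ (g h) dh) => //; rewrite inE /=.
by apply/forallP => x; rewrite !ffunE hW.
Qed.

Import Order.TTheory GRing.Theory Num.Theory.
Local Open Scope ring_scope.

(** * The relations among Brauer operators *)

Section BrauerOperators.
Variables (T : finType) (Rg : pzRingType) (P : {perm T} -> Rg) (A : T -> T -> Rg).

(* The Brauer algebra at parameter 2: [P] for permutations, [A] for arcs. *)
Record brauer_ops : Prop := BrauerOps {
  opsP1 : P 1%g = 1;
  opsPM u v : P (u * v)%g = P u * P v;
  opsPA u a b : P u * A (u a) (u b) = A a b * P u;
  opsAC a b : A a b = A b a;
  opsAA a b : a != b -> A a b * A a b = A a b *+ 2;
  opsPAl a b : P (tperm a b) * A a b = A a b;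
  opsAAP a b c : uniq [:: a; b; c] -> A a b * A b c = P (tperm a c) * A b c;
  opsAcomm a b c d : uniq [:: a; b; c; d] -> A a b * A c d = A c d * A a b }.
Hypothesis ops : brauer_ops.

Let PM u v : P u * P v = P (u * v)%g. Proof. by rewrite (opsPM ops). Qed.
Let PA u a b : P u * A (u a) (u b) = A a b * P u. Proof. exact: opsPA. Qed.
Let AC a b : A a b = A b a. Proof. exact: opsAC. Qed.

Let PtK a b : P (tperm a b) * P (tperm a b) = 1.
Proof. by rewrite PM -(opsP1 ops) tperm2. Qed.

Let PAr a b : A a b * P (tperm a b) = A a b.
Proof. by rewrite -PA tpermL tpermR AC (opsPAl ops). Qed.

Let PtA a b c d e f : tperm a b c = e -> tperm a b d = f -> P (tperm a b) * A e f = A c d * P (tperm a b).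
Proof. by move=> <- <-; rewrite PA. Qed.

Let AAr a b c : uniq [:: a; b; c] -> A a b * A b c = A a b * P (tperm a c).
Proof.
move=> h; rewrite (opsAAP ops) // [A a b]AC.
move: h; rewrite /= !inE negb_or => /and3P[/andP[ab ac] bc _].
by apply: PtA; rewrite ?tpermL // tpermD // eq_sym.
Qed.

(** Exchanging two parallel arcs end for end changes nothing. One transposition turns the arc [a b]
    into two overlapping arcs; sliding on [c d] turns these into the other transposition, which then
    cancels. *)
Let swap_arcs a b c d : uniq [:: a; b; c; d] ->
  P (tperm a c) * P (tperm b d) * (A a b * A c d) = A a b * A c d.
Proof.
rewrite /= !inE !negb_or => /and4P[/and3P[ab ac ad] /andP[bc bd] cd _].
have hPP : P (tperm a c) * P (tperm b d) = P (tperm b d) * P (tperm a c).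
  by rewrite !PM; congr P; rewrite conjgC tpermJ !tpermD // 1?eq_sym.
rewrite hPP -mulrA [P (tperm a c) * _]mulrA.
have -> : P (tperm a c) * A a b = A c b * A b a.
  rewrite (opsAAP ops) ?[A b a]AC 1?tpermC //.
  by rewrite /= !inE !negb_or eq_sym bc eq_sym ac eq_sym ab.
have u4 : uniq [:: a; b; c; d] by rewrite /= !inE !negb_or ab ac ad bc bd cd.
have -> : A c b * A b a * A c d = P (tperm b d) * A c d * A a b.
  rewrite -(opsAAP ops) /= ?inE ?negb_or ?bc ?bd ?cd //.
  by rewrite -mulrA [A b a]AC (opsAcomm ops) // mulrA [A c b]AC.
by rewrite !mulrA PtK mul1r -(opsAcomm ops u4).
Qed.

Let swap_arcs_r a b c d : uniq [:: a; b; c; d] ->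
  A a b * A c d * (P (tperm a c) * P (tperm b d)) = A a b * A c d.
Proof.
move=> h; rewrite -[RHS]swap_arcs // PM; set u := (_ * _)%g.
move: (h); rewrite /= !inE !negb_or => /and4P[/and3P[ab ac ad] /andP[bc bd] cd _].
have [ba ca da cb db] : [/\ b != a, c != a, d != a, c != b & d != b].
  by split; rewrite eq_sym.
have dc : d != c by rewrite eq_sym.
have ua : u a = c by rewrite permM tpermL tpermD.
have ub : u b = d by rewrite permM [tperm a c b]tpermD // tpermL.
have uc : u c = a by rewrite permM tpermR tpermD.
have ud : u d = b by rewrite permM [tperm a c d]tpermD // tpermR.
rewrite -mulrA -PA uc ud mulrA -PA ua ub -mulrA.
by rewrite -(opsAcomm ops h).
Qed.

Variable sg : T -> T.
Hypotheses (sgK : involutive sg) (sgN : forall x, sg x != x).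
Variables (n : nat) (p : nat -> T).
Hypotheses (frame : strand_frame sg n p).

Let p_eq i j : (i < n)%N -> (j < n)%N -> (p i == p j) = (i == j).
Proof.
move=> hi hj; case: frame => h _ _.
by apply/eqP/eqP => [/h->|->].
Qed.
Let p_sg i j : (i < n)%N -> (j < n)%N -> (p i == sg (p j)) = false.
Proof. by case: frame => _ h _ hi hj; apply/negbTE/h. Qed.
Let sg_p i j : (i < n)%N -> (j < n)%N -> (sg (p i) == p j) = false.
Proof. by move=> hi hj; rewrite eq_sym p_sg. Qed.
Let sg_eq a b : (sg a == sg b) = (a == b). Proof. exact: sg_eq. Qed.
Let p_sgn i : (p i == sg (p i)) = false. Proof. by rewrite eq_sym; apply/negbTE. Qed.
Let sgp_n i : (sg (p i) == p i) = false. Proof. by apply/negbTE. Qed.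

Notation s := (srefl sg p).
Notation refl := (refl sg).

Let EE a b := A a b * A (sg a) (sg b).
Definition opr i := P (s i).
Definition ope i := if i is j.+1 then EE (p j) (p j.+1) else A (p 0%N) (sg (p 0%N)).

Let symp_s i : symp sg (s i). Proof. exact: symp_refl. Qed.
Let s_sg i x : s i (sg x) = sg (s i x). Proof. by apply: srefl_sg. Qed.
Let s_K i : (s i * s i)%g = 1%g. Proof. exact: reflK. Qed.
Let s_id i j : (i < n)%N -> (j < n)%N -> j != i -> j.+1 != i -> s i (p j) = p j.
Proof. exact: srefl_id. Qed.
Let s_S i : s i.+1 (p i) = p i.+1. Proof. exact: refl_l. Qed.
Let s_pred i : s i.+1 (p i.+1) = p i. Proof. exact: refl_r. Qed.

Let PEE u a b : symp sg u -> P u * EE (u a) (u b) = EE a b * P u.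
Proof. by move=> /sympP hu; rewrite /EE mulrA PA -mulrA -!hu PA mulrA. Qed.

Let PEEK u a b : symp sg u -> (u * u = 1)%g -> P u * EE a b * P u = EE (u a) (u b).
Proof.
move=> hu uu; have uK x : u (u x) = x by rewrite -permM uu perm1.
by rewrite -{1}(uK a) -{1}(uK b) PEE // -mulrA PM uu (opsP1 ops) mulr1.
Qed.

Let s0E : s 0 = tperm (p 0%N) (sg (p 0%N)). Proof. by rewrite /srefl /refl eqxx. Qed.

Let sSE i : (i.+1 < n)%N -> s i.+1 = (tperm (p i) (p i.+1) * tperm (sg (p i)) (sg (p i.+1)))%g.
Proof. by move=> hi; rewrite /srefl /refl p_sg //; lia. Qed.

Let uniq4 i j : (i < n)%N -> (j < n)%N -> i != j ->
  uniq [:: p i; p j; sg (p i); sg (p j)].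
Proof. by move=> hi hj hij; rewrite /= !inE p_eq // p_sgn !p_sg // sg_eq p_eq // (negbTE hij). Qed.

Let EEcomm i j : (i < n)%N -> (j < n)%N -> i != j -> A (p i) (p j) * A (sg (p i)) (sg (p j)) =
  A (sg (p i)) (sg (p j)) * A (p i) (p j).
Proof. by move=> hi hj hij; rewrite (opsAcomm ops) // uniq4. Qed.

Lemma op_rr i : opr i * opr i = 1.
Proof. by rewrite /opr PM s_K (opsP1 ops). Qed.

Lemma op_coxeter : coxeterC n s -> 
  [/\ forall i j, (i.+1 < j)%N -> (j < n)%N -> opr i * opr j = opr j * opr i,
      forall i, (0 < i)%N -> (i.+1 < n)%N -> opr i * opr i.+1 * opr i = opr i.+1 * opr i * opr i.+1
    & (1 < n)%N -> opr 1 * opr 0 * opr 1 * opr 0 = opr 0 * opr 1 * opr 0 * opr 1].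
Proof.
case=> _ h1 h2 h3; split=> [i j hij hj|i hi hin|hn]; rewrite /opr !PM.
- by rewrite h1.
- by rewrite h2.
- by rewrite h3.
Qed.

Lemma op_re i : (i < n)%N -> opr i * ope i = ope i.
Proof.
case: i => [|i] hi; first by rewrite /opr s0E (opsPAl ops).
rewrite /opr sSE // -PM /ope /EE -mulrA [P (tperm (sg _) _) * (_ * _)]mulrA.
have hi' : (i < n)%N by lia.
rewrite (@PtA _ _ (p i) (p i.+1)) ?tpermD ?sg_p //; try lia.
by rewrite -mulrA (opsPAl ops) mulrA (opsPAl ops).
Qed.

Lemma op_er i : (i < n)%N -> ope i * opr i = ope i.
Proof.
case: i => [|i] hi; first by rewrite /opr s0E PAr.
have := op_re hi; rewrite /opr /ope -PEE // s_S s_pred => h.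
by rewrite /EE AC [A (sg _) _]AC.
Qed.

Lemma op_ee i : (0 < i)%N -> (i < n)%N -> ope i * ope i = ope i *+ (2 ^ 2).
Proof.
case: i => // i _ hi; have hi' : (i < n)%N by lia.
have pp : p i != p i.+1 by rewrite p_eq //; lia.
have c : A (p i) (p i.+1) * A (sg (p i)) (sg (p i.+1)) = A (sg (p i)) (sg (p i.+1)) * A (p i) (p i.+1).
  by rewrite EEcomm //; lia.
rewrite /ope /EE -mulrA [A (sg _) _ * (_ * _)]mulrA -c.
rewrite -[_ * _ * A (sg _) _]mulrA (opsAA ops) ?sg_eq // mulrA mulrnAr (opsAA ops) //.
by rewrite mulrnAl -mulrnA.
Qed.

Lemma op_ee0 : ope 0 * ope 0 = ope 0 *+ 2.
Proof. by rewrite (opsAA ops) // eq_sym sgN. Qed.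

Lemma op_er_comm i j : (i < n)%N -> (j < n)%N -> (i.+1 < j)%N || (j.+1 < i)%N ->
  ope i * opr j = opr j * ope i.
Proof.
move=> hi hj hij; rewrite /opr; case: i hi hij => [|i] hi hij.
  by rewrite /ope -PA s_sg s_id //; lia.
by rewrite /ope -PEE // !s_id //; lia.
Qed.

Lemma op_ee_comm i j : (i < n)%N -> (j < n)%N -> (i.+1 < j)%N -> ope i * ope j = ope j * ope i.
Proof.
move=> hi hj hij; case: j hj hij => // j hj hij; have hj' : (j < n)%N by lia.
have comm4 a b c d : uniq [:: a; b; c; d] -> GRing.comm (A a b) (A c d) by exact: opsAcomm.
case: i hi hij => [|i] hi hij.
  apply: GRing.commrM; apply: comm4; rewrite /= !inE ?p_eq ?p_sg ?sg_p ?p_sgn ?sgp_n ?sg_eq ?p_eq //; lia.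
have hi' : (i < n)%N by lia.
apply: GRing.commr_sym; apply: GRing.commrM; apply: GRing.commr_sym; apply: GRing.commrM;
  by apply: comm4; rewrite /= !inE ?p_eq ?p_sg ?sg_p ?p_sgn ?sgp_n ?sg_eq ?p_eq //; lia.
Qed.

Let op_eS i : ope i.+1 = EE (p i) (p i.+1). Proof. by []. Qed.
Let EE_C a b : EE a b = EE b a. Proof. by rewrite /EE AC [A (sg a) _]AC. Qed.
Let EE_EE a b c : (forall x y, x \in [:: a; b; c] -> y \in [:: a; b; c] -> x != sg y) ->
  uniq [:: a; b; c] -> EE a b * EE b c = P (refl a c) * EE b c.
Proof.
move=> hs hu; have hsu : uniq [:: sg a; sg b; sg c].
  by rewrite -[[:: _; _; _]]/(map sg [:: a; b; c]) map_inj_uniq //; apply: inv_inj.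
move: (hu); rewrite /= !inE negb_or => /and3P[/andP[ab ac] bc _].
have hs' x y : x \in [:: a; b; c] -> y \in [:: a; b; c] -> sg x != y.
  by move=> hx hy; rewrite eq_sym hs.
have [ia ib ic] : [/\ a \in [:: a; b; c], b \in [:: a; b; c] & c \in [:: a; b; c]].
  by rewrite !inE !eqxx !orbT.
rewrite /EE -mulrA [A (sg a) _ * (_ * _)]mulrA.
rewrite (opsAcomm ops (a := sg a)); last first.
  by rewrite /= !inE !negb_or sg_eq ab bc !hs'.
rewrite -!mulrA (opsAAP ops) // mulrA (opsAAP ops) //.
rewrite refl_neq ?hs //.
rewrite -PM -!mulrA; congr (_ * _); rewrite !mulrA; congr (_ * _).
by rewrite (@PtA _ _ b c) // tpermD // hs'.
Qed.

Lemma op_rre i j : (0 < i)%N -> (0 < j)%N -> (i < n)%N -> (j < n)%N -> (i.+1 == j) || (j.+1 == i) ->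
  opr j * opr i * ope j = ope i * ope j.
Proof.
(* Stated for abstract strands so that it serves both orders of the adjacent indices, the second
   with the three strands reversed. *)
have main a b c k l : (forall x y, x \in [:: a; b; c] -> y \in [:: a; b; c] -> x != sg y) ->
    uniq [:: a; b; c] -> opr k = P (refl a b) -> opr l = P (refl b c) ->
    ope k = EE a b -> ope l = EE b c -> (l < n)%N ->
    opr l * opr k * ope l = ope k * ope l.
  move=> hs hu rk rl ek el hl.
  have -> : ope k * ope l = P (refl a c) * ope l by rewrite ek el EE_EE.
  rewrite -[in LHS](op_re hl) mulrA rk rl !PM; congr (P _ * _).
  move: (hu); rewrite /= !inE negb_or => /and3P[/andP[ab ac] bc _].
  have := refl_conj sgK sgN a b (symp_refl sgK sgN b c); rewrite reflV // => ->.
  rewrite refl_l // refl_id //; by rewrite hs // !inE eqxx ?orbT.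
move=> i0 j0 hi hj hij.
have hs k : (k.+2 < n)%N -> (forall x y, x \in [:: p k; p k.+1; p k.+2] ->
    y \in [:: p k; p k.+1; p k.+2] -> x != sg y).
  by move=> hk x y; rewrite !inE => /or3P[]/eqP-> /or3P[]/eqP->; rewrite p_sg //; lia.
have hu k : (k.+2 < n)%N -> uniq [:: p k; p k.+1; p k.+2].
  by move=> hk; rewrite /= !inE !p_eq //; lia.
case/orP: hij => /eqP e1; subst.
  case: i i0 hi hj {j0} => // i _ hi hj.
  exact: (main (p i) (p i.+1) (p i.+2)) (hs _ hj) (hu _ hj) _ _ _ _ hj.
case: j j0 hi hj {i0} => // j _ hi hj.
apply: (main (p j.+2) (p j.+1) (p j)) => //; rewrite ?op_eS ?[EE (p j.+2) _]EE_C ?[EE (p j.+1) _]EE_C //.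
- by move=> x y hx hy; apply: (hs _ hi); rewrite -mem_rev.
- by rewrite -[[:: _; _; _]]/(rev [:: p j; p j.+1; p j.+2]) rev_uniq hu.
- by rewrite /opr /srefl /= reflC.
- by rewrite /opr /srefl /= reflC.
Qed.

Lemma op_rer i : (0 < i)%N -> (i.+1 < n)%N ->
  opr i * ope i.+1 * opr i = opr i.+1 * ope i * opr i.+1.
Proof.
case: i => // i _ hi; rewrite /opr !op_eS !PEEK // s_S s_pred !s_id //; lia.
Qed.

Section SmallIndices.
Hypothesis n_gt1 : (1 < n)%N.
Let a := p 0%N.
Let b := p 1%N.
Let sa := sg a.
Let sb := sg b.
Let n_gt0 : (0 < n)%N. Proof. exact: ltnW. Qed.
Let ab : (a == b) = false. Proof. by rewrite p_eq. Qed.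
Let asa : (a == sa) = false. Proof. exact: p_sgn. Qed.
Let asb : (a == sb) = false. Proof. by rewrite p_sg. Qed.
Let bsa : (b == sa) = false. Proof. by rewrite p_sg. Qed.
Let bsb : (b == sb) = false. Proof. exact: p_sgn. Qed.
Let sasb : (sa == sb) = false. Proof. by rewrite sg_eq p_eq. Qed.
Let ba : (b == a) = false. Proof. by rewrite eq_sym. Qed.
Let saa : (sa == a) = false. Proof. by rewrite eq_sym. Qed.
Let sba : (sb == a) = false. Proof. by rewrite eq_sym. Qed.
Let sab : (sa == b) = false. Proof. by rewrite eq_sym. Qed.
Let sbb : (sb == b) = false. Proof. by rewrite eq_sym. Qed.
Let sbsa : (sb == sa) = false. Proof. by rewrite eq_sym. Qed.
Let neqs := (ba, saa, sba, sab, sbb, sbsa, ab, asa, asb, bsa, bsb, sasb).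
Ltac ds := by rewrite /= ?inE ?neqs.
Ltac tp := rewrite ?tpermL ?tpermR ?tpermD ?neqs //.

Let r0 : opr 0 = P (tperm a sa). Proof. by rewrite /opr s0E. Qed.
Let r1 : opr 1 = P (tperm a b) * P (tperm sa sb). Proof. by rewrite /opr sSE // PM. Qed.
Let r1' : opr 1 = P (tperm sa sb) * P (tperm a b).
Proof. by rewrite r1 !PM conjgC tpermJ !tpermD ?neqs. Qed.
Let e0 : ope 0 = A a sa. Proof. by []. Qed.
Let e1 : ope 1 = A a b * A sa sb. Proof. by []. Qed.
Let e1C : A a b * A sa sb = A sa sb * A a b. Proof. by apply: opsAcomm; ds. Qed.

Let r0e1 : opr 0 * ope 1 = A sa b * A a sb * opr 0.
Proof.
rewrite r0 e1 mulrA (@PtA _ _ sa b) //; try tp.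
by rewrite -mulrA (@PtA _ _ a sb) ?mulrA //; tp.
Qed.

Let e1r0 : ope 1 * opr 0 = opr 0 * (A sa b * A a sb).
Proof.
rewrite r0 e1 mulrA (@PtA _ _ a b) //; try tp.
by rewrite -[in RHS]mulrA (@PtA _ _ sa sb) ?mulrA //; tp.
Qed.

Lemma op_C2 : opr 1 * opr 0 * ope 1 = opr 0 * ope 1.
Proof.
rewrite -mulrA r0e1 mulrA r1; congr (_ * _).
have h : uniq [:: b; sa; a; sb] by ds.
by have := swap_arcs h; rewrite [A b sa]AC [tperm b a]tpermC.
Qed.

Lemma op_C7 : ope 1 * opr 0 * opr 1 = ope 1 * opr 0.
Proof.
rewrite e1r0 -mulrA r1; congr (_ * _).
have h : uniq [:: b; sa; a; sb] by ds.
by have := swap_arcs_r h; rewrite [A b sa]AC [tperm b a]tpermC.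
Qed.

(** The product becomes a transposition followed by two self-mirror arcs, the form on which
    [swap_arcs] and its right-hand version act. *)
Let e1e0 : ope 1 * ope 0 = P (tperm a sb) * (A sb b * A sa a).
Proof.
rewrite e1 e0 -mulrA [A a sa]AC; have h : uniq [:: sb; sa; a] by ds.
rewrite [A sa sb]AC AAr // mulrA [A sb sa]AC.
rewrite -mulrA -(@PtA _ _ sa sb sa a) ; [|tp|tp].
rewrite [tperm sb a]tpermC mulrA -(@PtA a sb a b sb b); [|tp|tp].
by rewrite mulrA.
Qed.

Lemma op_C8 : ope 1 * ope 0 * opr 1 = ope 1 * ope 0.
Proof.
rewrite e1e0 -mulrA r1; congr (_ * _).
have h : uniq [:: sb; b; sa; a] by ds.
by have := swap_arcs_r h; rewrite [tperm sb sa]tpermC [tperm b a]tpermC -r1 r1'.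
Qed.

Let r1e0 : opr 1 * ope 0 = A b sb * opr 1.
Proof. by rewrite /opr /= -/a -/sa -PA s_pred s_sg s_pred. Qed.

Lemma op_C3 : opr 1 * ope 0 * opr 1 * ope 0 = ope 0 * ope 1 * ope 0.
Proof.
rewrite r1e0 -(mulrA (A b sb) (opr 1)) op_rr mulr1 -mulrA e1e0 e0 mulrA.
rewrite -(@PtA _ _ a sa sb sa); [|tp|tp].
have h1 : uniq [:: sa; sb; b] by ds.
have h2 : uniq [:: sb; b; a; sa] by ds.
rewrite -mulrA [A sb sa * _]mulrA [A sb sa]AC (opsAAP ops) // -mulrA mulrA.
rewrite [tperm a sb]tpermC [tperm sa b]tpermC [A sa a]AC swap_arcs //.
by rewrite [A sb b]AC.
Qed.

Lemma op_C4 : opr 1 * opr 0 * opr 1 * ope 0 = ope 0 * opr 1 * opr 0 * opr 1.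
Proof.
pose u := (s 1%N * s 0%N * s 1%N)%g.
have E : opr 1 * opr 0 * opr 1 = P u by rewrite /opr !PM.
have h : u a = a by rewrite !permM s_S s_id // s_pred.
have hu : symp sg u by rewrite !sympM.
have hs : u sa = sa by rewrite /sa (sympP _ _ hu) h.
have -> : ope 0 * opr 1 * opr 0 * opr 1 = ope 0 * P u by rewrite -E !mulrA.
by rewrite E e0 -PA h hs.
Qed.

Lemma op_C5 : ope 1 * opr 0 * ope 1 = ope 1 *+ 2.
Proof.
have h : uniq [:: a; b; sa] by ds.
have k : A a b * A sa sb * (A sa b * A a sb) = (A a b * A sa sb) *+ 2 * P (tperm a sa).
  rewrite e1C -mulrA [A a b * _]mulrA [A sa b]AC AAr //.
  rewrite -(mulrA (A a b)) (@PtA _ _ sa sb) //; [|tp|tp].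
  rewrite !mulrA -e1C -(mulrA (A a b)) (opsAA ops) ?neqs //.
  by rewrite mulrnAr.
by rewrite -mulrA r0e1 e1 mulrA k r0 -mulrA PtK mulr1.
Qed.

Lemma op_C6 : ope 1 * ope 0 * ope 1 = ope 1 *+ 2.
Proof.
rewrite e1e0 e1.
have h1 : uniq [:: sa; a; b] by ds.
have h2 : uniq [:: a; b; sb; sa] by ds.
rewrite -!mulrA [A sa a * _]mulrA (opsAAP ops) // -!mulrA [A sb b * _]mulrA.
rewrite -(@PtA _ _ sb b sb sa); [|tp|tp].
rewrite -!mulrA [A sb sa]AC [A sa sb * (_ * _)]mulrA -e1C -mulrA (opsAA ops) ?neqs //.
rewrite !mulrnAr; congr (_ *+ 2).
by rewrite mulrA [tperm sa b]tpermC [A sa sb]AC swap_arcs.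
Qed.

End SmallIndices.
End BrauerOperators.

(** * Integer matrices indexed by colourings *)

Section Kernels.
Variable m : nat.
Notation Col := {ffun 'I_m -> bool}.
Implicit Types (K L : Col -> Col -> bool) (t c bo : Col).

Definition kmx K : 'M[int]_#|{: Col}| := \matrix_(i, j) (K (enum_val i) (enum_val j))%:R.

Lemma kmxM K L : kmx K * kmx L =
  \matrix_(i, j) #|[set c | K (enum_val i) c && L c (enum_val j)]|%:R.
Proof.
apply/matrixP => i j; rewrite -mulmxE !mxE.
rewrite -sum1_card natr_sum (reindex enum_rank) /=; last exact/onW_bij/enum_rank_bij.
rewrite [RHS]big_mkcond; apply: eq_bigr => c _; rewrite !mxE enum_rankK inE.
by case: (K _ _); case: (L _ _); rewrite ?mulr0 ?mul0r ?mulr1.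
Qed.

Lemma kmx_eq K L : K =2 L -> kmx K = kmx L.
Proof. by move=> h; apply/matrixP => i j; rewrite !mxE h. Qed.

Lemma kmx_natr K k t bo : (kmx K *+ k) (enum_rank t) (enum_rank bo) = (K t bo * k)%:R.
Proof. by rewrite mulmxnE mxE !enum_rankK natrM mulr_natr. Qed.

(** Where no loop is formed, the middle colouring of a product is forced and the entries stay 0 or
    1. *)
Let card_at (Q : pred Col) c0 : (forall c, Q c -> c = c0) -> #|[set c | Q c]| = Q c0.
Proof.
move=> h; case: (boolP (Q c0)) => h0.
  rewrite (_ : [set c | Q c] = [set c0]) ?cards1 //; apply/setP => c; rewrite !inE.
  by apply/idP/eqP => [/h|->].
by apply: eq_card0 => c; rewrite inE; apply: contraNF h0 => /[dup] /h ->.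
Qed.

Definition pcol (u : {perm 'I_m}) bo : Col := [ffun k => bo (u k)].
Definition permRel u t bo := t == pcol u bo.
Definition capRel x y t bo := [&& t x == t y, bo x == bo y &
  [forall k, (k != x) && (k != y) ==> (t k == bo k)]].

Let pcolK u t : pcol u (pcol u^-1 t) = t.
Proof. by apply/ffunP => k; rewrite !ffunE permK. Qed.
Let pcolKV u t : pcol u^-1 (pcol u t) = t.
Proof. by apply/ffunP => k; rewrite !ffunE permKV. Qed.

Let permRel_l u K : kmx (permRel u) * kmx K = kmx (fun t bo => K (pcol u^-1 t) bo).
Proof.
rewrite kmxM; apply/matrixP => i j; rewrite !mxE (card_at (c0 := pcol u^-1 (enum_val i))).
  by rewrite /permRel pcolK eqxx.
by move=> c /andP[/eqP -> _]; rewrite pcolKV.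
Qed.

Let permRel_r u K : kmx K * kmx (permRel u) = kmx (fun t bo => K t (pcol u bo)).
Proof.
rewrite kmxM; apply/matrixP => i j; rewrite !mxE (card_at (c0 := pcol u (enum_val j))).
  by rewrite /permRel eqxx andbT.
by move=> c /andP[_ /eqP].
Qed.

Let capP x y t bo : reflect [/\ t x = t y, bo x = bo y & forall k, k != x -> k != y -> t k = bo k]
  (capRel x y t bo).
Proof.
apply: (iffP and3P) => -[/eqP h1 /eqP h2 h3]; split=> //; try exact/eqP.
  by move=> k k1 k2; move/forallP: h3 => /(_ k); rewrite k1 k2 => /eqP.
by apply/forallP => k; apply/implyP => /andP[k1 k2]; rewrite h3.
Qed.

Let upd t (x y : 'I_m) (v w : bool) : Col := [ffun k => if k == x then v else if k == y then w else t k].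

Lemma brauer_ops_kmx : brauer_ops (fun u => kmx (permRel u)) (fun x y => kmx (capRel x y)).
Proof.
split.
- apply/matrixP => i j; rewrite !mxE /permRel (_ : pcol 1 _ = enum_val j) ?(inj_eq enum_val_inj) //.
  by apply/ffunP => k; rewrite ffunE perm1.
- move=> u v; rewrite permRel_r; apply: kmx_eq => t bo; rewrite /permRel; congr (_ == _).
  by apply/ffunP => k; rewrite !ffunE permM.
- move=> u a b; rewrite permRel_l permRel_r; apply: kmx_eq => t bo.
  apply/capP/capP => -[h1 h2 h3]; split.
  + by move: h1; rewrite !ffunE !permK.
  + by rewrite !ffunE.
  + by move=> k k1 k2; have := h3 (u k); rewrite !(inj_eq perm_inj) !ffunE permK => ->.
  + by rewrite !ffunE !permK.
  + by move: h2; rewrite !ffunE.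
  + move=> k k1 k2; rewrite ffunE h3 ?ffunE ?permKV //.
      by apply: contra k1 => /eqP <-; rewrite permKV.
    by apply: contra k2 => /eqP <-; rewrite permKV.
- move=> a b; apply: kmx_eq => t bo.
  by apply/capP/capP => -[h1 h2 h3]; split=> // k k1 k2; apply: h3.
- move=> a b hab; rewrite kmxM; apply/matrixP => i j; rewrite mulmxnE !mxE.
  set t := enum_val i; set bo := enum_val j.
  have ba : (b == a) = false by rewrite eq_sym; apply/negbTE.
  (* The middle loop through [a] and [b] has one free colour [v], which accounts for the factor
     2. *)
  have -> : [set c | capRel a b t c && capRel a b c bo] =
      if capRel a b t bo then [set upd t a b v v | v : bool] else set0.
    apply/setP => c; rewrite inE; case: ifP => hc; last first.
      rewrite inE; apply: contraFF hc => /andP[/capP[h1 h2 h3] /capP[h4 h5 h6]].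
      by apply/capP; split=> // k k1 k2; rewrite h3 // h6.
    have [h1 h2 h3] := capP _ _ _ _ hc.
    apply/andP/imsetP => [[/capP[_ h5 h6] _]|[v _ ->]].
      exists (c a) => //; apply/ffunP => k; rewrite ffunE.
      case: eqVneq => [->//|k1]; case: eqVneq => [->//|k2]; by rewrite h6.
    split; apply/capP; split=> //; rewrite ?ffunE ?eqxx ?ba //.
      by move=> k /negbTE k1 /negbTE k2; rewrite ffunE k1 k2.
    by move=> k k1 k2; rewrite ffunE (negbTE k1) (negbTE k2) h3.
  case: ifP => _; last by rewrite cards0 mul0rn.
  rewrite card_imset ?card_bool // => v w /ffunP/(_ a); by rewrite !ffunE eqxx.
- move=> a b; rewrite permRel_l; apply: kmx_eq => t bo; rewrite tpermV.
  apply/capP/capP => -[h1 h2 h3]; split=> //.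
  + by move: h1; rewrite !ffunE tpermL tpermR.
  + by move=> k k1 k2; rewrite -h3 // ffunE tpermD // eq_sym.
  + by rewrite !ffunE tpermL tpermR.
  + by move=> k k1 k2; rewrite ffunE tpermD ?h3 // eq_sym.
- move=> a b c /=; rewrite !inE negb_or => /and3P[/andP[ab ac] bc _].
  have [ba ca cb] : [/\ b != a, c != a & c != b] by split; rewrite eq_sym.
  rewrite permRel_l kmxM tpermV; apply/matrixP => i j; rewrite !mxE.
  set t := enum_val i; set bo := enum_val j.
  rewrite (card_at (c0 := upd t a b (t c) (t c))); last first.
    move=> c' /andP[/capP[h1 h2 h3] /capP[h4 h5 h6]]; apply/ffunP => k; rewrite ffunE.
    case: eqVneq => [->|k1]; first by rewrite h2 h4 -h3.
    case: eqVneq => [->|k2]; first by rewrite h4 -h3.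
    by rewrite h3.
  congr (nat_of_bool _)%:R; apply/andP/capP.
    move=> [/capP[h1 h2 h3] /capP[h4 h5 h6]]; split=> //.
      by rewrite !ffunE tpermR tpermD // h1.
    move=> k k1 k2; rewrite -h6 // !ffunE (negbTE k1).
    by case: eqVneq => [->|ka]; rewrite ?tpermL // tpermD // eq_sym.
  rewrite !ffunE tpermR tpermD // => -[h1 h2 h3]; split; apply/capP; split=> //.
  + by rewrite !ffunE !eqxx (negbTE ba).
  + by move=> k /negbTE k1 /negbTE k2; rewrite ffunE k1 k2.
  + by rewrite !ffunE eqxx (negbTE ba) (negbTE ca) (negbTE cb).
  + move=> k k1 k2; rewrite -h3 // !ffunE (negbTE k1).
    by case: eqVneq => [->|ka]; rewrite ?tpermL // tpermD // eq_sym.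
- move=> a b c d /=; rewrite !inE !negb_or => /and4P[/and3P[ab ac ad] /andP[bc bd] cd _].
  have [ba ca da cb] : [/\ b != a, c != a, d != a & c != b] by split; rewrite eq_sym.
  have [db dc] : d != b /\ d != c by split; rewrite eq_sym.
  have main x y z w t bo : x != z -> x != w -> y != z -> y != w ->
      #|[set e | capRel x y t e && capRel z w e bo]| =
      [&& t x == t y, t z == t w, bo x == bo y, bo z == bo w &
        [forall k, [&& k != x, k != y, k != z & k != w] ==> (t k == bo k)]].
    move=> xz xw yz yw.
    rewrite (card_at (c0 := upd t x y (bo x) (bo y))); last first.
      move=> e /andP[/capP[h1 h2 h3] /capP[h4 h5 h6]]; apply/ffunP => k; rewrite ffunE.
      case: eqVneq => [->|k1]; first by rewrite h6.
      case: eqVneq => [->|k2]; first by rewrite h6.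
      by rewrite h3.
    have [zx zy wx wy] : [/\ z != x, z != y, w != x & w != y] by split; rewrite eq_sym.
    congr nat_of_bool; apply/andP/and5P.
      move=> [/capP[h1 h2 h3] /capP[h4 h5 h6]].
      rewrite !ffunE !eqxx in h2; rewrite !ffunE ?(negbTE zx) ?(negbTE zy) ?(negbTE wx) ?(negbTE wy) in h4.
      split; try exact/eqP.
        by move: h2; case: eqVneq => [->|] // _ ->.
      apply/forallP => k; apply/implyP => /and4P[k1 k2 k3 k4].
      by rewrite -h6 // ffunE (negbTE k1) (negbTE k2).
    move=> [/eqP h1 /eqP h2 /eqP h3 /eqP h4 /forallP h5]; split; apply/capP; split=> //.
    + by rewrite !ffunE !eqxx; case: ifP => // _; rewrite h3.
    + by move=> k /negbTE k1 /negbTE k2; rewrite ffunE k1 k2.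
    + by rewrite !ffunE (negbTE zx) (negbTE zy) (negbTE wx) (negbTE wy).
    + move=> k k1 k2; rewrite ffunE; case: eqVneq => [->//|k3]; case: eqVneq => [->//|k4].
      by have := h5 k; rewrite k1 k2 k3 k4 => /eqP.
  rewrite !kmxM; apply/matrixP => i j; rewrite !mxE !main //.
  set t := enum_val i; set bo := enum_val j; congr (nat_of_bool _)%:R.
  rewrite (_ : [forall k, _] = [forall k, [&& k != c, k != d, k != a & k != b] ==> (t k == bo k)]).
    by case: (t a == t b); case: (t c == t d); case: (bo a == bo b); case: (bo c == bo d).
  apply: eq_forallb => k.
  by case: (k == a); case: (k == b); case: (k == c); case: (k == d).
Qed.

End Kernels.

Definition diagmx m (f : bfun m) := kmx (compat f).

Lemma diagmxM m (a b : bfun m) : is_diagram a -> is_diagram b ->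
  diagmx a * diagmx b = diagmx (compose a b) *+ (2 ^ nloops a b).
Proof.
move=> da db; rewrite kmxM; apply/matrixP => i j.
by rewrite mulmxnE !mxE card_middles // natrM mulr_natr.
Qed.

Lemma diagmx_inj m (f g : bfun m) k l : is_diagram f -> is_diagram g ->
  diagmx f *+ (2 ^ k) = diagmx g *+ (2 ^ l) -> f = g /\ k = l.
Proof.
move=> df dg /matrixP e1.
have e2 t bo : (compat f t bo * 2 ^ k = compat g t bo * 2 ^ l)%N.
  have := e1 (enum_rank t) (enum_rank bo); rewrite !kmx_natr => /eqP.
  by rewrite eqr_nat => /eqP.
split.
  apply: compat_inj => // t bo; have := e2 t bo.
  by case: (compat f t bo); case: (compat g t bo) => //=;
    rewrite ?mul1n ?mul0n => /eqP; rewrite ?expn_eq0 // eq_sym expn_eq0.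
(* Constant colourings are compatible with every diagram, so this entry shows the bare power of
   2. *)
pose z : {ffun 'I_m -> bool} := [ffun=> false].
have c0 (h : bfun m) : compat h z z.
  by apply/compatP => x; rewrite /dotcol !ffunE !if_same.
have := e2 z z; rewrite !c0 !mul1n => /eqP; rewrite eqn_exp2l // => /eqP //.
Qed.

(** * The diagrams of adjacent transpositions and arcs *)

Section ElementaryDiagrams.
Variables (m : nat) (x y : 'I_m).
Hypothesis xy : x.+1 = y :> nat.

Let ny : (x == y) = false.
Proof. by apply/negbTE/eqP => e1; move: xy; rewrite e1; lia. Qed.

Let tpE (k : 'I_m) : (if k.+1 == y :> nat then insubd k k.+1 else
  if k == y :> nat then insubd k k.-1 else k) = tperm x y k :> 'I_m.
Proof.
case: (tpermP x y k) => [->|->|/eqP kx /eqP ky].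
- by rewrite xy eqxx; apply: val_inj; rewrite val_insubd ltn_ord.
- rewrite eqxx ifN; last by apply/eqP; lia.
  apply: val_inj; rewrite val_insubd -xy /=; case: ifP => //.
  by have := ltn_ord x; lia.
- by rewrite !ifN //; apply: contra kx => /eqP e1; apply/eqP/val_inj; rewrite /=; lia.
Qed.

Lemma RfunE k e : Rfun m y (k, e) = (tperm x y k, ~~ e).
Proof. by rewrite ffunE /= -tpE; case: ifP => // _; case: ifP. Qed.

Lemma EfunE k e : Efun m y (k, e) = (tperm x y k, if (k == x) || (k == y) then e else ~~ e).
Proof.
rewrite ffunE /= -tpE -[k == x](inj_eq val_inj) -[k == y](inj_eq val_inj) /= -xy eqSS orbC.
by case: eqVneq => [->|h]; [case: eqVneq|case: eqVneq].
Qed.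

Lemma Rfun_diagram : is_diagram (Rfun m y).
Proof.
apply/diagramP; split=> -[k e]; rewrite !RfunE ?tpermK ?negbK //.
by apply/eqP => -[_]; case: e.
Qed.

Lemma Efun_diagram : is_diagram (Efun m y).
Proof.
apply/diagramP; split=> -[k e]; rewrite !EfunE.
  rewrite tpermK; case: tpermP => [->|->|/eqP kx /eqP ky]; rewrite ?eqxx ?orbT //.
  by rewrite (negbTE kx) (negbTE ky) negbK.
apply/eqP => -[]; case: tpermP => [-> e1|->|/eqP kx /eqP ky _]; rewrite ?eqxx ?orbT.
- by move: ny; rewrite e1 eqxx.
- by move=> e1; move: ny; rewrite e1 eqxx.
- by rewrite (negbTE kx) (negbTE ky); case: e.
Qed.

Lemma diagmx_Rfun : diagmx (Rfun m y) = kmx (permRel (tperm x y)).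
Proof.
apply: kmx_eq => t bo; apply/compatP/eqP => [h|-> [k []]].
- by apply/ffunP => k; have := h (k, true); rewrite RfunE /dotcol /= ffunE.
- by rewrite RfunE /dotcol /= ffunE.
- by rewrite RfunE /dotcol /= ffunE tpermK.
Qed.

Lemma diagmx_Efun : diagmx (Efun m y) = kmx (capRel x y).
Proof.
apply: kmx_eq => t bo; apply/compatP/and3P => [h|[/eqP h1 /eqP h2 /forallP h3] [k e]].
- split.
  + by have := h (x, true); rewrite EfunE tpermL eqxx /dotcol /= => ->.
  + by have := h (x, false); rewrite EfunE tpermL eqxx /dotcol /= => ->.
  + apply/forallP => k; apply/implyP => /andP[kx ky].
    have := h (k, true); rewrite EfunE (negbTE kx) (negbTE ky) tpermD 1?eq_sym // /dotcol /=.
    by move=> ->.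
- rewrite EfunE; case: tpermP => [->|->|/eqP kx /eqP ky]; rewrite ?eqxx ?orbT /dotcol /=.
  + by rewrite h1 h2.
  + by rewrite h1 h2.
  + rewrite (negbTE kx) (negbTE ky); have := h3 k; rewrite kx ky => /eqP e1.
    by case: e; rewrite /= e1.
Qed.

End ElementaryDiagrams.

Lemma Idfun_diagram m : is_diagram (Idfun m).
Proof.
apply/diagramP; split=> -[k e]; rewrite !ffunE /= ?negbK //.
by apply/eqP => -[]; case: e.
Qed.

Lemma diagmx_Idfun m : diagmx (Idfun m) = 1.
Proof.
rewrite -(opsP1 (brauer_ops_kmx m)); apply: kmx_eq => t bo.
have -> : permRel 1%g t bo = (t == bo).
  by congr (_ == _); apply/ffunP => k; rewrite ffunE perm1.
by apply/compatP/eqP => [h|-> [k e]]; [apply/ffunP => k; have := h (k, true)|]; rewrite ffunE /dotcol //=; case: e.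
Qed.

Definition mono m k (f : bfun m) : br m := bscale (delta ^+ k) (bunit f).

Lemma bmul_mono m k l (f g : bfun m) : is_diagram f -> is_diagram g ->
  bmul (mono k f) (mono l g) = mono (k + l + nloops f g) (compose f g).
Proof.
move=> df dg; apply/ffunP => d; rewrite !ffunE.
rewrite (bigD1 (exist _ f df : diagram m)) //= [X in _ + X]big1 ?addr0; last first.
  move=> a ha; apply: big1 => b _; rewrite !ffunE.
  by rewrite -(inj_eq val_inj) /= in ha; rewrite (negbTE ha) mulr0 !mul0r mulr0.
rewrite (bigD1 (exist _ g dg : diagram m)) //= [X in _ + X]big1 ?addr0; last first.
  move=> b hb; rewrite !ffunE.
  by rewrite -(inj_eq val_inj) /= in hb; rewrite (negbTE hb) !mulr0 mul0r mulr0.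
rewrite !ffunE !eqxx !mulr1 -!exprD mulrC eq_sym; congr (_ * _).
Qed.

Lemma bscale_mono m c k (f : bfun m) : bscale (delta ^+ c) (mono k f) = mono (c + k) f.
Proof. by apply/ffunP => d; rewrite !ffunE exprD mulrA. Qed.

(** * Words and their diagrams *)

Section Generators.
Variable n : nat.
Hypothesis n_gt1 : (1 < n)%N.
Notation T := 'I_n.*2.
Let sg : T -> T := @rev_ord _.

Lemma rev_ord_neq (x : T) : rev_ord x != x.
Proof. by apply/eqP => /(congr1 val) /=; have := ltn_ord x; lia. Qed.

Lemma double_gt0 : (0 < n.*2)%N. Proof. by lia. Qed.
(** The right half of the strands, counted from 0. The axis runs between [strand 0] and its mirror
    image, the two strands on which the elementary diagrams of index [n] act. *)
Definition strand i : T := insubd (Ordinal double_gt0) (n + i)%N.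
Notation p := strand.

Lemma strandE i : (i < n)%N -> p i = (n + i)%N :> nat.
Proof. by move=> hi; rewrite val_insubd; case: ifP => //; lia. Qed.

Lemma strand_rev i : (i < n)%N -> rev_ord (p i) = (n - i.+1)%N :> nat.
Proof. by move=> hi; rewrite /= strandE //; lia. Qed.

Lemma frame_strand : strand_frame (@rev_ord n.*2) n p.
Proof.
split=> [i j hi hj /(congr1 val) /=|i j hi hj|x].
- by rewrite !strandE //; lia.
- by apply/eqP => /(congr1 val) /=; rewrite !strandE //; lia.
- have hx := ltn_ord x; case: (leqP n x) => h.
    exists (x - n)%N; first by lia.
    by left; apply: ord_inj; rewrite strandE; lia.
  exists (n - x.+1)%N; first by lia.
  by right; apply: ord_inj; rewrite strand_rev; lia.
Qed.

Definition PK (u : {perm T}) := kmx (permRel u).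
Definition AK (x y : T) := kmx (capRel x y).
Lemma brauer_ops_PK : brauer_ops PK AK. Proof. exact: brauer_ops_kmx. Qed.
Notation ops := brauer_ops_PK.
Notation grr := (opr PK (@rev_ord n.*2) p).
Notation gee := (ope AK (@rev_ord n.*2) p).
Let sgK : involutive (@rev_ord n.*2) := @rev_ordK _.
Let sgN := rev_ord_neq.

Definition elem (b : bool) : nat -> bfun n.*2 := if b then @Efun n.*2 else @Rfun n.*2.
(* The loops created by the product defining [gimg g], and its underlying diagram. *)
Definition gev (g : gen n) : nat * bfun n.*2 :=
  let i := val g.1 in
  if i == 0%N then (0%N, elem g.2 n)
  else (nloops (elem g.2 (n - i)) (elem g.2 (n + i)), compose (elem g.2 (n - i)) (elem g.2 (n + i))).
Fixpoint wev (w : word n) : nat * bfun n.*2 :=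
  if w is g :: w' then
    ((gev g).1 + (wev w').1 + nloops (gev g).2 (wev w').2, compose (gev g).2 (wev w').2)%N
  else (0%N, Idfun n.*2).

Let elem_succ b (x y : T) : x.+1 = y :> nat ->
  is_diagram (elem b y) /\ diagmx (elem b y) = if b then AK x y else PK (tperm x y).
Proof.
move=> xy; case: b; split; [exact: Efun_diagram xy|exact: diagmx_Efun xy|
  exact: Rfun_diagram xy|exact: diagmx_Rfun xy].
Qed.

Let elem_center b : is_diagram (elem b n) /\
  diagmx (elem b n) = if b then AK (rev_ord (p 0)) (p 0) else PK (tperm (rev_ord (p 0)) (p 0)).
Proof.
have h : (rev_ord (p 0)).+1 = p 0 :> nat by rewrite strand_rev ?strandE; lia.
by have := elem_succ b h; rewrite strandE ?addn0; last lia.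
Qed.

Let elem_right b i : (i.+1 < n)%N -> is_diagram (elem b (n + i.+1)) /\
  diagmx (elem b (n + i.+1)) = if b then AK (p i) (p i.+1) else PK (tperm (p i) (p i.+1)).
Proof.
move=> hi; have h : (p i).+1 = p i.+1 :> nat by rewrite !strandE; lia.
by have := elem_succ b h; rewrite strandE.
Qed.

Let elem_left b i : (i.+1 < n)%N -> is_diagram (elem b (n - i.+1)) /\
  diagmx (elem b (n - i.+1)) = if b then AK (rev_ord (p i.+1)) (rev_ord (p i))
    else PK (tperm (rev_ord (p i.+1)) (rev_ord (p i))).
Proof.
move=> hi; have h : (rev_ord (p i.+1)).+1 = rev_ord (p i) :> nat by rewrite !strand_rev; lia.
by have := elem_succ b h; rewrite strand_rev; last lia.
Qed.

Lemma gev_diagram g : is_diagram (gev g).2.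
Proof.
case: g => -[[|i] hi] b; rewrite /gev /=; first by case: (elem_center b).
by apply: compose_diagram; [case: (elem_left b hi)|case: (elem_right b hi)].
Qed.

Lemma wev_diagram w : is_diagram (wev w).2.
Proof.
elim: w => [|g w IH] /=; first exact: Idfun_diagram.
by apply: compose_diagram => //; apply: gev_diagram.
Qed.

Definition gmat (g : gen n) := if g.2 then gee g.1 else grr g.1.
Definition wmat (w : word n) := \prod_(g <- w) gmat g.

Lemma gev_mat g : diagmx (gev g).2 *+ (2 ^ (gev g).1) = gmat g.
Proof.
have tC (x y : T) : tperm x y = tperm y x by exact: tpermC.
have AC (x y : T) : AK x y = AK y x by exact: (opsAC ops).
case: g => -[[|i] hi] b; rewrite /gev /gmat /=.
  have [_ ->] := elem_center b; rewrite mulr1n; case: b => /=; first exact: AC.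
  by rewrite /opr /srefl /= /refl eqxx tC.
have [dl el] := elem_left b hi; have [dr er] := elem_right b hi.
rewrite -diagmxM // el er; case: b {dl el dr er}.
  by rewrite [X in X * _]AC (opsAcomm ops) //= !inE -!(inj_eq val_inj) /= !strandE //; lia.
rewrite /opr /srefl /= /refl ifN; last first.
  by apply/eqP => /(congr1 val) /=; rewrite !strandE; lia.
by rewrite -(opsPM ops) tC; congr PK; rewrite conjgC tpermJ !tpermD //;
  apply/eqP => /(congr1 val) /=; rewrite ?strandE; lia.
Qed.

Lemma wev_mat w : diagmx (wev w).2 *+ (2 ^ (wev w).1) = wmat w.
Proof.
elim: w => [|g w IH] /=; first by rewrite /wmat big_nil mulr1n diagmx_Idfun.
rewrite /wmat big_cons -/(wmat w) -IH -gev_mat mulrnAl mulrnAr diagmxM //.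
- by rewrite -!mulrnA !expnD; congr (_ *+ _); lia.
- exact: gev_diagram.
- exact: wev_diagram.
Qed.

Lemma wmat_cat u v : wmat (u ++ v) = wmat u * wmat v.
Proof. exact: big_cat. Qed.

Lemma wev_eq w w' k : wmat w = wmat w' *+ (2 ^ k) ->
  (wev w).2 = (wev w').2 /\ (wev w).1 = ((wev w').1 + k)%N.
Proof.
rewrite -!wev_mat -mulrnA -expnD.
by apply: diagmx_inj; apply: wev_diagram.
Qed.

Lemma gimg_mono g : gimg g = mono (gev g).1 (gev g).2.
Proof.
have b1 f : bunit f = mono 0 f :> br n.*2 by apply/ffunP => d; rewrite !ffunE mul1r.
case: g => -[[|i] hi] b; rewrite /gimg /gev /=; first by case: b; rewrite b1.
have [dl _] := elem_left b hi; have [dr _] := elem_right b hi.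
by case: b dl dr => dl dr; rewrite !b1 bmul_mono.
Qed.

Lemma phiw_mono w : phiw w = mono (wev w).1 (wev w).2.
Proof.
elim: w => [|g w IH] /=; first by apply/ffunP => d; rewrite !ffunE mul1r.
by rewrite IH gimg_mono bmul_mono ?gev_diagram ?wev_diagram.
Qed.

(** Regrouping the concatenation could move loops from one product to another; the matrix product is
    associative and its matrices determine both the diagram and the number of loops. *)
Lemma phiw_cat (u v : word n) : phiw (u ++ v : word n) = bmul (phiw u) (phiw v).
Proof.
rewrite !phiw_mono bmul_mono ?wev_diagram //.
have := wev_mat (u ++ v); rewrite wmat_cat -!wev_mat mulrnAl mulrnAr.
rewrite diagmxM ?wev_diagram // -!mulrnA -!expnD => /diagmx_inj[||-> ->] //.
- exact: wev_diagram.
- by apply: compose_diagram; apply: wev_diagram.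
by congr mono; lia.
Qed.

(** Every defining relation equates a word with a power of [delta] times a word, so it can be tested
    at [delta = 2]. *)
Lemma Cn_rel_mat l r : Cn_rel l r -> exists w w' k,
  [/\ l = fw 1 w, r = fw (delta ^+ k) w' & wmat w = wmat w' *+ (2 ^ k)].
Proof.
have W2 g g' : wmat [:: g; g'] = gmat g * gmat g' by rewrite /wmat !big_cons big_nil mulr1.
have W3 g g' g'' : wmat [:: g; g'; g''] = gmat g * gmat g' * gmat g''.
  by rewrite /wmat !big_cons big_nil mulr1 mulrA.
have W4 g g' g'' h : wmat [:: g; g'; g''; h] = gmat g * gmat g' * gmat g'' * gmat h.
  by rewrite /wmat !big_cons big_nil mulr1 !mulrA.
have W1 g : wmat [:: g] = gmat g by rewrite /wmat big_cons big_nil mulr1.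
have [cc cb c1] := op_coxeter ops (srefl_coxeter sgK sgN frame_strand).
have d0 w w' : wmat w = wmat w' -> exists u u' k,
    [/\ fw 1 w = fw 1 u, fw 1 w' = fw (delta ^+ k) u' & wmat u = wmat u' *+ (2 ^ k)].
  by move=> e1; exists w, w', 0%N; rewrite expr0 mulr1n.
have E0 (i : 'I_n) : val i = 0%N -> gmat (ee i) = gee 0.
  by move=> h; rewrite /gmat /= (h : nat_of_ord i = 0%N).
have E1 (i : 'I_n) : val i = 1%N -> gmat (ee i) = gee 1.
  by move=> h; rewrite /gmat /= (h : nat_of_ord i = 1%N).
have R0 (i : 'I_n) : val i = 0%N -> gmat (rr i) = grr 0.
  by move=> h; rewrite /gmat /= (h : nat_of_ord i = 0%N).
have R1 (i : 'I_n) : val i = 1%N -> gmat (rr i) = grr 1.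
  by move=> h; rewrite /gmat /= (h : nat_of_ord i = 1%N).
have na (i j : 'I_n) : nadj i j -> (i.+1 < j)%N || (j.+1 < i)%N.
  by rewrite /nadj /adj negb_or -(inj_eq val_inj) /=; lia.
case.
- move=> i; apply: d0; rewrite W2 /wmat big_nil; exact: (op_rr ops sgK sgN).
- by move=> i; apply: d0; rewrite W2 W1; apply: (op_re ops frame_strand).
- by move=> i; apply: d0; rewrite W2 W1; apply: (op_er ops sgK sgN frame_strand).
- move=> i hi; exists [:: ee i; ee i], [:: ee i], 2%N; split=> //; rewrite W2 W1.
  exact: (op_ee ops sgK sgN frame_strand).
- move=> i hi; exists [:: ee i; ee i], [:: ee i], 1%N; split=> //; rewrite W2 W1 E0 // .
  exact: (op_ee0 ops sgN p).
- move=> i j /na hij; apply: d0; rewrite !W2 /gmat /=.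
  by case/orP: hij => h; [apply: cc|apply/esym/cc].
- move=> i j /na hij; apply: d0; rewrite !W2 /gmat /=.
  exact: (op_er_comm ops sgK sgN frame_strand).
- move=> i j /na hij; apply: d0; rewrite !W2 /gmat /=.
  by case/orP: hij => h; [|apply/esym]; apply: (op_ee_comm ops sgK frame_strand).
- move=> i j hij hi hj; apply: d0; rewrite !W3 /gmat /=.
  case/orP: hij => /eqP h; [rewrite -h; apply: cb|rewrite -h; apply/esym/cb] => //; by rewrite h.
- move=> i j hij hi hj; apply: d0; rewrite W3 W2 /gmat /=.
  exact: (op_rre ops sgK sgN frame_strand).
- move=> i j hij hi hj; apply: d0; rewrite !W3 /gmat /=.
  case/orP: hij => /eqP h; rewrite -h; [|apply/esym];
    by apply: (op_rer ops sgK sgN frame_strand); rewrite ?h.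
- move=> i0 i1 h0 h1; apply: d0; rewrite !W4 !(R0 _ h0) !(R1 _ h1); exact: c1.
- move=> i0 i1 h0 h1; apply: d0; rewrite W3 W2 !(R0 _ h0) !(R1 _ h1) !(E1 _ h1).
  exact: (op_C2 ops sgK sgN frame_strand).
- move=> i0 i1 h0 h1; apply: d0; rewrite W4 W3 !(R1 _ h1) !(E1 _ h1) !(E0 _ h0).
  exact: (op_C3 ops sgK sgN frame_strand).
- move=> i0 i1 h0 h1; apply: d0; rewrite !W4 !(R1 _ h1) !(R0 _ h0) !(E0 _ h0).
  exact: (op_C4 ops sgK sgN frame_strand).
- move=> i0 i1 h0 h1; exists [:: ee i1; rr i0; ee i1], [:: ee i1], 1%N; split=> //.
  by rewrite W3 W1 !(E1 _ h1) !(R0 _ h0); apply: (op_C5 ops sgK sgN frame_strand).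
- move=> i0 i1 h0 h1; exists [:: ee i1; ee i0; ee i1], [:: ee i1], 1%N; split=> //.
  by rewrite W3 W1 !(E1 _ h1) !(E0 _ h0); apply: (op_C6 ops sgK sgN frame_strand).
- move=> i0 i1 h0 h1; apply: d0; rewrite W3 W2 !(R0 _ h0) !(R1 _ h1) !(E1 _ h1).
  exact: (op_C7 ops sgK sgN frame_strand).
- move=> i0 i1 h0 h1; apply: d0; rewrite W3 W2 !(E0 _ h0) !(R1 _ h1) !(E1 _ h1).
  exact: (op_C8 ops sgK sgN frame_strand).
Qed.

End Generators.

Lemma delta_inv : exists d : laurent, delta * d = 1.
Proof.
have h : laurentb (tofrac 1 / tofrac ('X ^+ 1 : {poly int})).
  by apply/laurentbP; exists 1, 1%N.
exists (Laurent h); apply: val_inj.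
rewrite [LHS](_ : _ = tofrac 'X * (tofrac 1 / tofrac ('X ^+ 1 : {poly int}))) //.
by rewrite expr1 tofrac1 mul1r mulfV // -[X in tofrac X]expr1 Xk_neq0.
Qed.

(** * Words modulo the relation ideal *)

Section Ideal.
Local Open Scope quotient_scope.
Variable n : nat.
Implicit Types (f g : word n -> laurent) (u v w z : word n) (x y : fsum n).

(* Membership in the relation ideal only depends on coefficient functions, so it is
   handled on those. *)
Definition ideal f : Prop :=
  exists (N : nat) (c : 'I_N -> laurent) (u v : 'I_N -> word n) (l r : 'I_N -> fsum n),
    (forall i, Cn_rel (l i) (r i)) /\
    forall w, f w = \sum_(i < N) c i * (coef (fwrap (u i) (l i) (v i)) w
                                        - coef (fwrap (u i) (r i) (v i)) w).

Lemma ideal_ext f g : f =1 g -> ideal f -> ideal g.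
Proof.
move=> efg [N [c [u [v [l [r [h e1]]]]]]].
by exists N, c, u, v, l, r; split=> // w; rewrite -efg.
Qed.

Lemma ideal0 : ideal (fun=> 0).
Proof.
exists 0%N, (fun=> 0), (fun=> [::]), (fun=> [::]), (fun=> [::]), (fun=> [::]).
by split=> [[]//|w]; rewrite big_ord0.
Qed.

Lemma idealZ a f : ideal f -> ideal (fun w => a * f w).
Proof.
move=> [N [c [u [v [l [r [h e1]]]]]]].
exists N, (fun i => a * c i), u, v, l, r; split=> // w.
by rewrite e1 mulr_sumr; apply: eq_bigr => i _; rewrite mulrA.
Qed.

Lemma idealD f g : ideal f -> ideal g -> ideal (fun w => f w + g w).
Proof.
move=> [N [c [u [v [l [r [h e1]]]]]]] [N' [c' [u' [v' [l' [r' [h' e1']]]]]]].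
pose cat A (F : 'I_N -> A) (F' : 'I_N' -> A) (i : 'I_(N + N')) :=
  match split i with inl j => F j | inr j => F' j end.
exists (N + N')%N, (cat _ c c'), (cat _ u u'), (cat _ v v'), (cat _ l l'), (cat _ r r').
split=> [i|w]; first by rewrite /cat; case: split.
rewrite e1 e1' big_split_ord /=; congr (_ + _); apply: eq_bigr => i _; rewrite /cat.
  by case: split_ordP => j /eqP; rewrite ?(inj_eq (@lshift_inj _ _)) ?eq_lrshift // => /eqP->.
by case: split_ordP => j /eqP; rewrite ?(inj_eq (@rshift_inj _ _)) ?eq_rlshift // => /eqP->.
Qed.

Lemma coef_fw c w z : coef (fw c w) z = c * (w == z)%:R.
Proof. by rewrite /coef /fw big_cons big_nil /=; case: eqP => _; rewrite ?addr0 ?mulr1 ?mulr0. Qed.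

Lemma fsum_coefE x z : coef x z = \sum_(q <- x) q.1 * (q.2 == z)%:R.
Proof.
by rewrite /coef big_mkcond; apply: eq_bigr => q _; case: eqP => _; rewrite ?mulr1 ?mulr0.
Qed.

Lemma coef_cat x y z : coef (x ++ y) z = coef x z + coef y z.
Proof. exact: big_cat. Qed.

Lemma coef_fscale c x z : coef (fscale c x) z = c * coef x z.
Proof. by rewrite !fsum_coefE big_map mulr_sumr; apply: eq_bigr => q _; rewrite mulrA. Qed.

Lemma coef_fsub x y z : coef (fsub x y) z = coef x z - coef y z.
Proof. by rewrite coef_cat coef_fscale mulN1r. Qed.

Definition wrapped u v z := (take (size u) z == u) && (drop (size z - size v) z == v)
  && (size u + size v <= size z)%N.
Definition unwrap u v z : word n := take (size z - size u - size v) (drop (size u) z).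

Lemma wrapped_cat u w v : wrapped u v (u ++ w ++ v) /\ unwrap u v (u ++ w ++ v) = w.
Proof.
have e1 : (size (u ++ w ++ v) - size v)%N = size (u ++ w) by rewrite !size_cat; lia.
have e2 : (size (u ++ w) - size u)%N = size w by rewrite size_cat; lia.
rewrite /wrapped /unwrap [(_ - size u - _)%N]subnAC e1 e2 take_size_cat // eqxx.
have -> : drop (size (u ++ w)) (u ++ w ++ v) = v by rewrite catA drop_size_cat.
have -> : drop (size u) (u ++ w ++ v) = w ++ v by rewrite drop_size_cat.
by rewrite take_size_cat // eqxx !size_cat; split=> //; lia.
Qed.

Lemma cat_unwrap u v z : wrapped u v z -> u ++ unwrap u v z ++ v = z.
Proof.
case/andP=> /andP[/eqP h1 /eqP h2] h3; rewrite /unwrap; set k := (_ - _ - _)%N.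
have hv : v = drop k (drop (size u) z) by rewrite drop_drop -[LHS]h2; congr drop; lia.
by rewrite {1}hv cat_take_drop -{1}h1 cat_take_drop.
Qed.

(** Coefficients of a wrapped sum depend on the sum only through its coefficients; this is what lets
    [ideal_wrap] work with coefficient functions. *)
Lemma coef_fwrap u x v z :
  coef (fwrap u x v) z = if wrapped u v z then coef x (unwrap u v z) else 0.
Proof.
have key w : (u ++ w ++ v == z) = wrapped u v z && (w == unwrap u v z).
  apply/eqP/andP => [<-|[h /eqP ->]]; last exact: cat_unwrap.
  by have [h ->] := wrapped_cat u w v.
rewrite !fsum_coefE big_map /=; under eq_bigr => q _ do rewrite key.
by case: (wrapped u v z) => //; rewrite big1 // => q _; rewrite mulr0.
Qed.

Lemma fwrap_fwrap u v u' v' x : fwrap u (fwrap u' x v') v = fwrap (u ++ u') x (v' ++ v).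
Proof. by rewrite /fwrap -map_comp; apply: eq_map => q /=; rewrite !catA. Qed.

Lemma ideal_wrap u v x : ideal (coef x) -> ideal (coef (fwrap u x v)).
Proof.
move=> [N [c [u' [v' [l [r [h e1]]]]]]].
exists N, c, (fun i => u ++ u' i), (fun i => v' i ++ v), l, r; split=> // w.
rewrite coef_fwrap e1; case hw : (wrapped u v w).
  by apply: eq_bigr => i _; rewrite -!fwrap_fwrap !(coef_fwrap u) hw.
by rewrite big1 // => i _; rewrite -!fwrap_fwrap !(coef_fwrap u) hw subr0 mulr0.
Qed.

Lemma ideal_rel l r : Cn_rel l r -> ideal (fun z => coef l z - coef r z).
Proof.
move=> h; exists 1%N, (fun=> 1), (fun=> [::]), (fun=> [::]), (fun=> l), (fun=> r).
have nilwrap x : fwrap [::] x [::] = x.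
  by rewrite /fwrap -[RHS]map_id; apply: eq_map => -[c w] /=; rewrite cats0.
by split=> // w; rewrite big_ord1 mul1r !nilwrap.
Qed.

(** Equality up to a unit [c]; its inverse [d] is carried along to make the relation symmetric. *)
Definition weq w w' : Prop := exists c d, c * d = 1 /\
  ideal (fun z => (w == z)%:R - c * (w' == z)%:R).

Lemma weq_refl w : weq w w.
Proof.
by exists 1, 1; rewrite mulr1; split=> //; apply: ideal_ext ideal0 => z; rewrite mul1r subrr.
Qed.

Lemma weq_sym w w' : weq w w' -> weq w' w.
Proof.
move=> [c [d [cd h]]]; exists d, c; rewrite mulrC; split=> //.
apply: ideal_ext (idealZ (- d) h) => z; rewrite -[X in _ = X - _]mul1r -cd.
by ring.
Qed.

Lemma weq_trans w w' w'' : weq w w' -> weq w' w'' -> weq w w''.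
Proof.
move=> [c [d [cd h]]] [c' [d' [cd' h']]]; exists (c * c'), (d * d').
rewrite mulrACA cd cd' mulr1; split=> //.
apply: ideal_ext (idealD h (idealZ c h')) => z.
by rewrite mulrBr addrA mulrA subrK.
Qed.

Lemma weq_wrap u v w w' : weq w w' -> weq (u ++ w ++ v) (u ++ w' ++ v).
Proof.
move=> [c [d [cd h]]]; exists c, d; split=> //.
have h' : ideal (coef (fsub (fw 1 w) (fw c w'))).
  by apply: ideal_ext h => z; rewrite coef_fsub !coef_fw mul1r.
apply: ideal_ext (ideal_wrap u v h') => z.
rewrite (_ : fwrap u _ v = [:: (1, u ++ w ++ v); (-1 * c, u ++ w' ++ v)]) //.
by rewrite fsum_coefE !big_cons big_nil addr0 /= mul1r mulN1r mulNr.
Qed.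

Lemma weq_rel w w' k : Cn_rel (fw 1 w) (fw (delta ^+ k) w') -> weq w w'.
Proof.
move=> h; have [d hd] := delta_inv; exists (delta ^+ k), (d ^+ k).
rewrite -exprMn hd expr1n; split=> //.
by apply: ideal_ext (ideal_rel h) => z; rewrite !coef_fw mul1r.
Qed.

(** The quotient construction asks for a boolean relation, so [weq] is decided classically. *)
Definition weqb w w' : bool := if excluded_middle_informative (weq w w') then true else false.
Lemma weqbP w w' : reflect (weq w w') (weqb w w').
Proof. by rewrite /weqb; case: excluded_middle_informative => h; constructor. Qed.

Lemma weqb_refl : reflexive weqb. Proof. by move=> w; apply/weqbP/weq_refl. Qed.
Lemma weqb_sym : symmetric weqb.
Proof. by move=> w w'; apply/weqbP/weqbP => /weq_sym. Qed.
Lemma weqb_trans : transitive weqb.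
Proof. by move=> w' w w'' /weqbP h /weqbP h'; apply/weqbP/(weq_trans h h'). Qed.

Canonical weq_equiv := EquivRel weqb weqb_refl weqb_sym weqb_trans.

(* The monoid of words modulo the relations and modulo units of the base ring: loops
   become invisible, and the parameter is recovered afterwards through [phi]. *)
Definition wmon := {eq_quot weqb}.
HB.instance Definition _ := Choice.on wmon.
HB.instance Definition _ := Quotient.on wmon.
HB.instance Definition _ := EqQuotient.on wmon.

Definition wclass (w : word n) : wmon := \pi_wmon w.
Definition wmul (a b : wmon) : wmon := wclass (repr a ++ repr b).

Lemma wclass_eq w w' : wclass w = wclass w' <-> weq w w'.
Proof.
split; first by move/eqquotP/weqbP.
by move=> h; apply/eqquotP/weqbP.
Qed.

Lemma weq_repr w : weq (repr (wclass w)) w.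
Proof. by apply/wclass_eq; rewrite /wclass reprK. Qed.

Lemma weq_cat u u' v v' : weq u u' -> weq v v' -> weq (u ++ v) (u' ++ v').
Proof.
move=> hu hv; apply: (@weq_trans _ (u' ++ v)).
  exact: (weq_wrap [::] v hu).
by have := weq_wrap u' [::] hv; rewrite !cats0.
Qed.

Lemma wclass_cat u v : wmul (wclass u) (wclass v) = wclass (u ++ v).
Proof. by apply/wclass_eq/weq_cat; apply: weq_repr. Qed.

Lemma wclassP (a : wmon) : exists w, a = wclass w.
Proof. by exists (repr a); rewrite /wclass reprK. Qed.

Lemma wmulA : associative wmul.
Proof.
move=> a b c; have [u ->] := wclassP a; have [v ->] := wclassP b; have [w ->] := wclassP c.
by rewrite !wclass_cat catA.
Qed.
Lemma wmul1g : left_id (wclass [::]) wmul.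
Proof. by move=> a; have [u ->] := wclassP a; rewrite wclass_cat. Qed.
Lemma wmulg1 : right_id (wclass [::]) wmul.
Proof. by move=> a; have [u ->] := wclassP a; rewrite wclass_cat cats0. Qed.

HB.instance Definition _ := isMonoid.Build wmon wmulA wmul1g wmulg1.

End Ideal.

Lemma phiE n (x : fsum n) d : phi x d = \sum_(q <- x) q.1 * phiw q.2 d.
Proof. by rewrite /phi sum_ffunE; apply: eq_bigr => q _; rewrite ffunE. Qed.

(** Ideal membership constrains coefficients, while [phi] runs over a list with possible
    repetitions; collecting equal words links the two. *)
Lemma phi_coef n (x : fsum n) (s : seq (word n)) d : uniq s ->
  {subset [seq q.2 | q <- x] <= s} -> phi x d = \sum_(w <- s) coef x w * phiw w d.
Proof.
move=> us hs; rewrite phiE; under [RHS]eq_bigr => w _ do rewrite fsum_coefE mulr_suml.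
rewrite exchange_big /=; apply: eq_big_seq => q hq.
rewrite (bigD1_seq q.2) //=; last by apply: hs; apply/mapP; exists q.
rewrite eqxx mulr1 big1 ?addr0 // => w /negbTE hw.
by rewrite eq_sym hw mulr0 mul0r.
Qed.

Lemma phi_fwrap n (x : fsum n) u v : phi (fwrap u x v) = \sum_(q <- x) bscale q.1 (phiw (u ++ q.2 ++ v)).
Proof. by rewrite /phi /fwrap big_map. Qed.

Lemma bunit_neq0 m (f : bfun m) (df : is_diagram f) k : mono k f (exist _ f df) = delta ^+ k.
Proof. by rewrite !ffunE /= eqxx mulr1. Qed.

Lemma mono_neq m (f g : bfun m) (df : is_diagram f) k : g != f -> mono k g (exist _ f df) = 0.
Proof. by move=> h; rewrite !ffunE /= eq_sym (negbTE h) mulr0. Qed.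

Lemma deltaX_cancel k (c : laurent) : c * delta ^+ k = 0 -> c = 0.
Proof.
have [d hd] := delta_inv; move=> /(congr1 (fun x => x * d ^+ k)).
by rewrite mul0r -mulrA -exprMn hd expr1n mulr1.
Qed.

Lemma mono_diagram_inj m k l (f g : bfun m) : is_diagram f -> mono k f = mono l g -> f = g.
Proof.
move=> df /ffunP /(_ (exist _ f df)); rewrite bunit_neq0 => e1.
apply/eqP; apply: contraT => ne; move: e1; rewrite mono_neq 1?eq_sym // -[LHS]mul1r.
by move/deltaX_cancel/eqP; rewrite oner_eq0.
Qed.

Section Composition.
Variables (m : nat) (a b : bfun m).
Hypotheses (da : is_diagram a) (db : is_diagram b).
Implicit Types (j k l q : 'I_m).
Let aK : involutive a. Proof. by case/diagramP: da. Qed.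
Let bK : involutive b. Proof. by case/diagramP: db. Qed.

Lemma compose_top k l : a (k, true) = (l, true) -> compose a b (k, true) = (l, true).
Proof. by move=> h; rewrite ffunE /= h. Qed.

Lemma compose_bot k l : b (k, false) = (l, false) -> compose a b (k, false) = (l, false).
Proof. by move=> h; rewrite ffunE /= h. Qed.

Lemma compose_thru k l q : a (k, true) = (l, false) -> b (l, true) = (q, false) ->
  compose a b (k, true) = (q, false).
Proof. by move=> h1 h2; rewrite ffunE /= h1 /= h2. Qed.

Lemma compose_turn_top k l q j : a (k, true) = (l, false) -> b (l, true) = (q, true) ->
  a (j, true) = (q, false) -> compose a b (k, true) = (j, true).
Proof. by move=> h1 h2 h3; rewrite ffunE /= h1 /= h2 /= -h3 aK. Qed.

Lemma compose_turn_bot k l q j : b (k, true) = (l, false) -> a (k, false) = (q, false) ->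
  b (q, true) = (j, false) -> compose a b (l, false) = (j, false).
Proof. by move=> h1 h2 h3; rewrite ffunE /= -h1 bK /= h2 /= h3. Qed.
End Composition.

(** * The diagram of a class of words *)

Section Words.
Variable n : nat.
Hypothesis n_gt1 : (1 < n)%N.
Implicit Types (u v w : word n) (x y : fsum n).

Lemma bscale1 (X : br n.*2) : bscale 1 X = X.
Proof. by apply/ffunP => d; rewrite ffunE mul1r. Qed.

Lemma phi_rel (l r : fsum n) u v : Cn_rel l r -> phi (fwrap u l v) = phi (fwrap u r v).
Proof.
move=> /(Cn_rel_mat n_gt1) [w [w' [k [-> -> e1]]]].
rewrite !phi_fwrap !big_cons !big_nil !addr0 /= bscale1.
have : wmat n_gt1 (u ++ w ++ v) = wmat n_gt1 (u ++ w' ++ v) *+ (2 ^ k).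
  by rewrite !wmat_cat e1 mulrnAl mulrnAr.
by move/wev_eq => [e2 e3]; rewrite !(phiw_mono n_gt1) bscale_mono e2 e3 addnC.
Qed.

Lemma phi_ideal x : in_ideal x -> phi x = 0.
Proof.
move=> [N [c [u [v [l [r [h e1]]]]]]]; apply/ffunP => d.
pose yl i := fwrap (u i) (l i) (v i); pose yr i := fwrap (u i) (r i) (v i).
pose ws (y : fsum n) := [seq q.2 | q <- y].
(* A common finite list of words, large enough to evaluate [phi] on [x] and on all the wrapped
   relations. *)
pose s := undup (ws x ++ flatten [seq ws (yl i) ++ ws (yr i) | i <- enum 'I_N]).
have us : uniq s by apply: undup_uniq.
have sub i : {subset ws (yl i) ++ ws (yr i) <= s}.
  move=> w hw; rewrite mem_undup mem_cat; apply/orP; right.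
  by apply/flattenP; exists (ws (yl i) ++ ws (yr i)) => //; apply/mapP; exists i; rewrite ?mem_enum.
rewrite (@phi_coef _ x s) //; last by move=> w hw; rewrite mem_undup mem_cat hw.
under eq_bigr => w _ do rewrite e1 mulr_suml.
rewrite exchange_big /= ffunE big1 // => i _.
have -> : \sum_(w <- s) c i * (coef (fwrap (u i) (l i) (v i)) w - coef (fwrap (u i) (r i) (v i)) w) * phiw w d
   = c i * (phi (yl i) d - phi (yr i) d).
  rewrite !(@phi_coef _ _ s) //; try by move=> w hw; apply: (sub i); rewrite mem_cat hw ?orbT.
  by rewrite -sumrB mulr_sumr; apply: eq_bigr => w _; rewrite -mulrA mulrBl.
by rewrite /yl /yr (phi_rel _ _ (h i)) subrr mulr0.
Qed.

Lemma weq_phi w w' : weq w w' -> exists2 c, (exists d, c * d = 1) & phiw w = bscale c (phiw w').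
Proof.
move=> [c [d [cd h]]]; exists c; first by exists d.
have /phi_ideal : in_ideal (fsub (fw 1 w) (fw c w')).
  by apply: ideal_ext h => z; rewrite coef_fsub !coef_fw mul1r.
rewrite /phi /fsub !big_cat /= !big_cons !big_nil !addr0 /= bscale1 => e1.
apply/ffunP => z; move/ffunP/(_ z): e1; rewrite !ffunE => /eqP.
by rewrite mulN1r mulNr subr_eq0 => /eqP.
Qed.

(** Both images under [phi] are monomials, and a scalar factor cannot change the diagram on which a
    monomial is supported. *)
Lemma weq_wev w w' : weq w w' -> (wev w).2 = (wev w').2.
Proof.
move/weq_phi => [c _]; rewrite !(phiw_mono n_gt1).
have df := wev_diagram n_gt1 w; move/ffunP/(_ (exist (fun f => is_true (is_diagram f)) _ df)).
rewrite bunit_neq0 => e1; apply/eqP; apply: contraT => ne; move: e1.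
rewrite ffunE mono_neq 1?eq_sym // mulr0 -[LHS]mul1r.
by move/deltaX_cancel/eqP; rewrite oner_eq0.
Qed.

Lemma wev_cat u v : (wev (u ++ v)).2 = compose (wev u).2 (wev v).2.
Proof.
have := phiw_cat n_gt1 u v; rewrite !(phiw_mono n_gt1) bmul_mono ?wev_diagram //.
by apply: mono_diagram_inj; apply: wev_diagram.
Qed.

Notation M := (wmon n).
Definition dgm (m : M) : dot n.*2 -> dot n.*2 := (wev (repr m)).2.

Lemma dgm_class w : dgm (wclass w) = (wev w).2 :> (_ -> _).
Proof. by rewrite /dgm (weq_wev (weq_repr w)). Qed.

Lemma dgmM (m m' : M) : dgm (m * m')%g = compose (wev (repr m)).2 (wev (repr m')).2 :> (_ -> _).
Proof.
by rewrite -[(m * m')%g]/(wclass (repr m ++ repr m')) dgm_class wev_cat.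
Qed.

Lemma n_gt0 : (0 < n)%N. Proof. exact: ltnW. Qed.
Definition ix i : 'I_n := insubd (Ordinal n_gt0) i.
Lemma ixE i : (i < n)%N -> ix i = i :> nat.
Proof. by move=> hi; rewrite val_insubd hi. Qed.
Definition mr i : M := wclass [:: rr (ix i)].
Definition me i : M := wclass [:: ee (ix i)].

Lemma wmulE u v : (wclass u * wclass v)%g = wclass (u ++ v).
Proof. exact: wclass_cat. Qed.

(** The factors [delta] and [delta ^+ 2] are units and disappear in the quotient, which leaves the
    relations at parameter 1. *)
Lemma brauerC_wmon : brauerC n mr me.
Proof.
have rel1 w w' : Cn_rel (fw 1 w) (fw 1 w') -> wclass w = wclass w'.
  by move=> h; apply/wclass_eq; apply: (weq_rel (k := 0)).
have reld w w' : Cn_rel (fw 1 w) (fw delta w') -> wclass w = wclass w'.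
  by move=> h; apply/wclass_eq; apply: (weq_rel (k := 1)).
have reld2 w w' : Cn_rel (fw 1 w) (fw (delta ^+ 2) w') -> wclass w = wclass w'.
  by move=> h; apply/wclass_eq; apply: (weq_rel (k := 2)).
have ix0 : val (ix 0) = 0%N by rewrite /= ixE ?n_gt0.
have ix1 : val (ix 1) = 1%N by rewrite /= ixE.
have nad i j : (i < n)%N -> (j < n)%N -> (i.+1 < j)%N || (j.+1 < i)%N -> nadj (ix i) (ix j).
  by move=> hi hj hij; rewrite /nadj /adj -(inj_eq val_inj) /= !ixE //; lia.
have ad i : (i.+1 < n)%N -> adj (ix i) (ix i.+1).
  by move=> hi; rewrite /adj !ixE ?eqxx //; lia.
have ad' i : (i.+1 < n)%N -> adj (ix i.+1) (ix i).
  by move=> hi; rewrite /adj !ixE ?eqxx ?orbT //; lia.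
have ixp i : (0 < i)%N -> (i < n)%N -> (0 < val (ix i))%N by move=> h hi; rewrite /= ixE.
have W2 (g g' : gen n) : (wclass [:: g] * wclass [:: g'])%g = wclass [:: g; g'] by rewrite wmulE.
have W3 (g g' g'' : gen n) : (wclass [:: g] * wclass [:: g'] * wclass [:: g''])%g = wclass [:: g; g'; g''].
  by rewrite W2 wmulE.
have W4 (g g' g'' h : gen n) : (wclass [:: g] * wclass [:: g'] * wclass [:: g''] * wclass [:: h])%g =
    wclass [:: g; g'; g''; h] by rewrite (W3 g g' g'') wmulE.
split; rewrite /mr /me.
- split=> [i hi|i j hij hj|i hi hin|_].
  + by rewrite W2; apply: rel1; apply: rel_rr.
  + by rewrite !W2; apply: rel1; apply: rel_comm_rr; apply: nad; lia.
  + by rewrite !W3; apply: rel1; apply: rel_braid; [exact: ad|apply: ixp; lia|apply: ixp; lia].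
  + by rewrite !W4; apply: rel1; apply: rel_C1.
- by move=> i hi; rewrite W2; apply: rel1; apply: rel_re.
- by move=> i hi; rewrite W2; apply: rel1; apply: rel_er.
- move=> i hi; rewrite W2; have [->|i0] := eqVneq i 0%N; first by apply: reld; apply: rel_ee0.
  by apply: reld2; apply: rel_ee; apply: ixp; lia.
- by move=> i j hi hj hij; rewrite !W2; apply: rel1; apply: rel_comm_er; apply: nad.
- by move=> i j hi hj hij; rewrite !W2; apply: rel1; apply: rel_comm_ee; apply: nad; lia.
- move=> i hi hin; rewrite W3 W2; apply: rel1; apply: rel_rre; [exact: ad'|apply: ixp; lia|apply: ixp; lia].
- move=> i hi hin; rewrite !W3; apply: rel1; apply: rel_rer; [exact: ad|apply: ixp; lia|apply: ixp; lia].
- by rewrite W3 W2; apply: rel1; apply: rel_C2.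
- by rewrite W4 W3; apply: rel1; apply: rel_C3.
- by rewrite !W4; apply: rel1; apply: rel_C4.
- by rewrite W3; apply: reld; apply: rel_C5.
- by rewrite W3; apply: reld; apply: rel_C6.
- by rewrite W3 W2; apply: rel1; apply: rel_C7.
- by rewrite W3 W2; apply: rel1; apply: rel_C8.
Qed.

Notation sg := (@rev_ord n.*2).
Notation p := (strand n_gt1).
Let sgK : involutive sg := @rev_ordK _.
Let sgN := @rev_ord_neq n n_gt1.

Let wev1 (g : gen n) : (wev [:: g]).2 = compose (gev g).2 (Idfun n.*2). Proof. by []. Qed.

Let IdE k t : Idfun n.*2 (k, t) = (k, ~~ t). Proof. by rewrite ffunE. Qed.

Let dg1_thru (g : gen n) k l : (gev g).2 (k, true) = (l, false) ->
  dgm (wclass [:: g]) (k, true) = (l, false).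
Proof. by move=> h; rewrite dgm_class wev1; apply: (compose_thru h); rewrite IdE. Qed.

Let dg1_arc (g : gen n) k l t : (gev g).2 (k, t) = (l, t) ->
  dgm (wclass [:: g]) (k, t) = (l, t).
Proof.
case: t => h; rewrite dgm_class wev1; first exact: compose_top.
by apply: (compose_turn_bot (Idfun_diagram _) (k := k) (q := l)); rewrite ?IdE.
Qed.

Let near i : (i.+1 < n)%N -> (p i).+1 = p i.+1 :> nat.
Proof. by move=> hi; rewrite !strandE //; lia. Qed.
Let near_rev i : (i.+1 < n)%N -> (sg (p i.+1)).+1 = sg (p i) :> nat.
Proof. by move=> hi; rewrite !strand_rev //; lia. Qed.
Let near0 : (sg (p 0)).+1 = p 0 :> nat.
Proof. by rewrite strand_rev ?strandE ?n_gt0 //; lia. Qed.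

Let gev0 b : (gev ((ix 0, b) : gen n)).2 = elem n b (p 0).
Proof. by rewrite /gev /= ixE ?n_gt0 //= strandE ?n_gt0 // addn0. Qed.

Let gevS i b : (i.+1 < n)%N ->
  (gev ((ix i.+1, b) : gen n)).2 = compose (elem n b (sg (p i))) (elem n b (p i.+1)).
Proof. by move=> hi; rewrite strand_rev ?strandE; [|lia..]; rewrite /gev /= ixE. Qed.

Let sgp_p : [/\ sg (p 0) != p 0, p 1 != p 0, p 1 != sg (p 0), sg (p 1) != p 0
  & sg (p 1) != p 1].
Proof.
have h : (0 < n)%N by lia.
by split; apply/eqP => /(congr1 val) /=; rewrite ?strandE //; lia.
Qed.

Lemma dgm_rep : diagram_rep sg n p (@mr) (@me) (@dgm).
Proof.
have wd (m : M) := wev_diagram n_gt1 (repr m).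
have [n0 n1 n2 n3 n4] := sgp_p.
have sg_eq' (x y : 'I_n.*2) : (sg x == sg y) = (x == y) by exact: (inj_eq (inv_inj sgK)).
have off (x y k : 'I_n.*2) (t : bool) : x != k -> y != k ->
    (tperm x y k, if (k == x) || (k == y) then t else ~~ t) = (k, ~~ t).
  by move=> hx hy; rewrite tpermD // !(eq_sym k) (negbTE hx) (negbTE hy).
have n2' : sg (p 0) != p 1 by rewrite eq_sym.
have n1' : p 0 != p 1 by rewrite eq_sym.
have n2'' : p 0 != sg (p 1) by rewrite eq_sym.
split.
- by move=> m; case/diagramP: (wd m).
- by move=> a; rewrite -[1%g]/(wclass [::]) dgm_class IdE.
- by move=> m m' a b c; rewrite dgmM; apply: compose_thru.
- by move=> m m' a b; rewrite dgmM; apply: compose_top.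
- by move=> m m' a b; rewrite dgmM; apply: compose_bot.
- by move=> m m' a b c d; rewrite dgmM; apply: compose_turn_top.
- by move=> m m' a b c d; rewrite dgmM; apply: compose_turn_bot.
- move=> [|i] a hi; apply: dg1_thru.
    by rewrite gev0 /elem (RfunE near0) /srefl /= /refl eqxx tpermC.
  rewrite gevS //; apply: compose_thru; first by rewrite (RfunE (near_rev hi)).
  rewrite (RfunE (near hi)) /srefl /= /refl ifN.
    rewrite -permM; congr (_, _); congr (fun_of_perm _ _).
    rewrite tpermC conjgC tpermJ !tpermD // ;
    by apply/eqP => /(congr1 val) /=; rewrite !strandE //; lia.
  by apply/eqP => /(congr1 val) /=; rewrite !strandE //; lia.
- move=> t; apply: dg1_arc; rewrite gev0 /elem (EfunE near0).
  by rewrite tpermR eqxx orbT.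
- move=> a /andP[h1 h2]; apply: dg1_thru; rewrite gev0 /elem (EfunE near0).
  by rewrite off // eq_sym.
- move=> t; apply: dg1_arc; rewrite gevS // /elem.
  have e1 := EfunE (near n_gt1); have e2 := EfunE (near_rev n_gt1).
  case: t.
    apply: (compose_turn_top (Efun_diagram (near_rev n_gt1)) (l := p 0) (q := p 1)).
    + by rewrite e2 off.
    + by rewrite e1 eqxx tpermL.
    + by rewrite e2 off.
  by apply: compose_bot; rewrite e1 eqxx tpermL.
- move=> t; apply: dg1_arc; rewrite gevS // /elem.
  have e1 := EfunE (near n_gt1); have e2 := EfunE (near_rev n_gt1).
  case: t; first by apply: compose_top; rewrite e2 eqxx orbT tpermR.
  apply: (compose_turn_bot (Efun_diagram (near n_gt1)) (k := sg (p 0)) (q := sg (p 1))).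
  + by rewrite e1 off // eq_sym.
  + by rewrite e2 eqxx orbT tpermR.
  + by rewrite e1 off // eq_sym.
- move=> a /andP[h1 h2] /andP[h3 h4]; apply: dg1_thru; rewrite gevS // /elem.
  have e1 := EfunE (near n_gt1); have e2 := EfunE (near_rev n_gt1).
  apply: (compose_thru (l := a)).
    by rewrite e2 off // eq_sym.
  by rewrite e1 off // eq_sym.
Qed.

Notation NF := (is_NF sgK sgN (frame_strand n_gt1) (@mr) (@me)).

Lemma is_NF_all (m : M) : NF m.
Proof.
have [w ->] := wclassP m; elim: w => [|[i b] w IH]; first exact: is_NF1 brauerC_wmon.
have -> : wclass ((i, b) :: w) = ((if b then me i else mr i) * wclass w)%g.
  have ixi : ix i = i by apply: ord_inj; rewrite ixE.
  by case: b; rewrite /me /mr wmulE ixi.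
by case: b; [apply: (e_NF n_gt1 brauerC_wmon)|apply: (r_NF n_gt1 brauerC_wmon)].
Qed.

(** The heart of injectivity: every class has a normal form, and normal forms are separated by their
    diagrams. *)
Lemma wev_weq w w' : (wev w).2 = (wev w').2 -> weq w w'.
Proof.
move=> e1; apply/wclass_eq.
apply: (dg_inj n_gt1 brauerC_wmon dgm_rep (is_NF_all _) (is_NF_all _)) => x.
by rewrite !dgm_class e1.
Qed.

Lemma wev_symmetric w : is_symmetric (wev w).2.
Proof.
apply/forallP => -[a t]; rewrite -dgm_class.
by rewrite (dg_symmetric n_gt1 brauerC_wmon dgm_rep _ _ (is_NF_all _)).
Qed.

Lemma symmetric_wev (f : bfun n.*2) : is_diagram f -> is_symmetric f ->
  exists w, (wev w).2 == f.
Proof.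
move=> /diagramP[fK fN] /forallP fS.
have sm : symmetric_matching sg f by split=> // a t; rewrite (eqP (fS (a, t))).
have [m _ hm] := dg_surj sgK sgN (frame_strand n_gt1) n_gt1 brauerC_wmon dgm_rep sm.
by exists (repr m); apply/eqP/ffunP.
Qed.

End Words.

(** * Freeness and the isomorphism *)

Lemma phi_cat n (x y : fsum n) : phi (x ++ y : fsum n) = phi x + phi y.
Proof. exact: big_cat. Qed.

Lemma phi_fscale n c (x : fsum n) : phi (fscale c x) = bscale c (phi x).
Proof.
apply/ffunP => d; rewrite phiE big_map ffunE phiE mulr_sumr.
by apply: eq_bigr => q _; rewrite mulrA.
Qed.

Lemma phi_fsub n (x y : fsum n) d : phi (fsub x y) d = phi x d - phi y d.
Proof. by rewrite phi_cat phi_fscale !ffunE mulN1r. Qed.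

Lemma phi_fcomb n N c (b : 'I_N -> fsum n) d :
  phi (fcomb c b) d = \sum_(i < N) c i * phi (b i) d.
Proof.
rewrite phiE big_flatten big_map big_enum; apply: eq_bigr => i _.
by rewrite -phiE phi_fscale ffunE.
Qed.

Lemma coef_fcomb n N c (b : 'I_N -> fsum n) z :
  coef (fcomb c b) z = \sum_(i < N) c i * coef (b i) z.
Proof.
rewrite fsum_coefE big_flatten big_map big_enum; apply: eq_bigr => i _.
by rewrite -fsum_coefE coef_fscale.
Qed.

Lemma bmul_sum m (I J : Type) (s : seq I) (t : seq J) (F : I -> br m) (G : J -> br m) c e :
  bmul (\sum_(i <- s) bscale (c i) (F i)) (\sum_(j <- t) bscale (e j) (G j)) =
  \sum_(i <- s) \sum_(j <- t) bscale (c i * e j) (bmul (F i) (G j)).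
Proof.
apply/ffunP => d; rewrite ffunE sum_ffunE.
under [RHS]eq_bigr => i _ do rewrite sum_ffunE.
transitivity (\sum_a \sum_b \sum_(i <- s) \sum_(j <- t) c i * e j *
   ((compose (val a) (val b) == val d)%:R * (F i a * G j b * delta ^+ nloops (val a) (val b)))).
  apply: eq_bigr => a _; apply: eq_bigr => b _; rewrite !sum_ffunE.
  rewrite -mulrA mulr_suml mulr_sumr; apply: eq_bigr => i _.
  rewrite mulr_suml !mulr_sumr; apply: eq_bigr => j _; rewrite !ffunE.
  by move: (c i) (e j) (F i a) (G j b) (_ ^+ _) (_%:R) => *; ring.
rewrite pair_big exchange_big /=; apply: eq_bigr => i _.
rewrite exchange_big /=; apply: eq_bigr => j _; rewrite !ffunE mulr_sumr.
rewrite [RHS](eq_bigr _ (fun a _ => mulr_sumr _ _ _ _)).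
by rewrite pair_big.
Qed.

Section Basis.
Variable n : nat.
Hypothesis n_gt1 : (1 < n)%N.
Notation rank := (aseq n.*2).

Lemma phi_fmul (x y : fsum n) : phi (fmul x y) = bmul (phi x) (phi y).
Proof.
rewrite [in RHS]/phi bmul_sum [LHS]big_allpairs_dep.
by apply: eq_bigr => q _; apply: eq_bigr => q' _; rewrite /= (phiw_cat n_gt1).
Qed.

Lemma phi_fone : phi (fone n) = bone n.*2.
Proof. by rewrite /phi /fone /fw big_seq1 /= (bscale1 (n:=n)). Qed.

Lemma phi_in_SBr (x : fsum n) : in_SBr (phi x).
Proof.
move=> d; apply: contraNT => nsym; rewrite phiE big1 // => q _.
rewrite (phiw_mono n_gt1); set f := (wev q.2).2.
have ne : f != val d by apply: contraNneq nsym => <-; apply: wev_symmetric.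
by rewrite !ffunE eq_sym (negbTE ne) !mulr0.
Qed.

Notation D := {d : diagram n.*2 | is_symmetric (val d)}.

Let cardD : #|{: D}| = rank.
Proof. by rewrite card_sig -card_symmetric_diagrams; apply: eq_card => d; rewrite !inE. Qed.

Let sdiag (i : 'I_rank) : D := enum_val (cast_ord (esym cardD) i).
Let sindex (d : D) : 'I_rank := cast_ord cardD (enum_rank d).
Let sindexK : cancel sindex sdiag.
Proof. by move=> d; rewrite /sdiag /sindex cast_ordK enum_rankK. Qed.
Let sdiag_inj : injective sdiag.
Proof. by move=> i j /enum_val_inj/cast_ord_inj. Qed.

Let rep (i : 'I_rank) : word n :=
  xchoose (symmetric_wev n_gt1 (valP (val (sdiag i))) (valP (sdiag i))).
Let repE i : (wev (rep i)).2 = val (val (sdiag i)).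
Proof. exact: (eqP (xchooseP (symmetric_wev n_gt1 _ _))). Qed.

Let basis i : fsum n := fw 1 (rep i).

Let word_rep (w : word n) : exists i (c : laurent), ideal (fun z => (w == z)%:R - c * (rep i == z)%:R).
Proof.
pose d : D := exist _ (exist (fun f => is_true (is_diagram f)) _ (wev_diagram n_gt1 w))
  (wev_symmetric n_gt1 w).
have [c [_ [_ h]]] : weq w (rep (sindex d)).
  by apply: (wev_weq n_gt1); rewrite repE sindexK.
by exists (sindex d), c.
Qed.

Lemma span_basis (x : fsum n) : exists c, in_ideal (fsub x (fcomb c basis)).
Proof.
elim: x => [|[a w] x [c IH]].
  exists (fun=> 0); apply: ideal_ext (ideal0 n) => z.
  by rewrite coef_fsub coef_fcomb big1 ?subr0 // /coef ?big_nil // => i _; rewrite mul0r.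
have [i [b h]] := word_rep w.
exists (fun j => c j + (i == j)%:R * (a * b)).
apply: ideal_ext (idealD (idealZ a h) IH) => z.
rewrite !coef_fsub -cat1s coef_cat !coef_fcomb.
under [in RHS]eq_bigr => j _ do rewrite mulrDl.
rewrite big_split /= [X in _ = _ - (_ + X)](bigD1 i) //= [X in _ - (_ + (_ + X))]big1 => [|j].
  rewrite -[coef [:: _] z]/(coef (fw a w) z) !coef_fw eqxx !mul1r addr0 mulrBr mulrA.
  by rewrite [X in _ = _ - X]addrC opprD addrACA.
by rewrite eq_sym => /negbTE->; rewrite !mul0r.
Qed.

(** The representatives have distinct diagrams, so on them [phi] is diagonal with powers of [delta],
    which are units, as entries. *)
Lemma phi_comb_basis c i :
  phi (fcomb c basis) (val (sdiag i)) = c i * delta ^+ (wev (rep i)).1.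
Proof.
have phib j d : phi (basis j) d = mono (wev (rep j)).1 (val (val (sdiag j))) d.
  by rewrite /phi /basis big_seq1 (bscale1 (n:=n)) (phiw_mono n_gt1) repE.
rewrite phi_fcomb (bigD1 i) //= big1 => [|j ji].
  by rewrite addr0 phib !ffunE eqxx mulr1.
by rewrite phib !ffunE !(inj_eq val_inj) (inj_eq sdiag_inj) eq_sym (negbTE ji) !mulr0.
Qed.

Lemma basis_free c : phi (fcomb c basis) = 0 -> forall i, c i = 0.
Proof.
move=> /ffunP h i; apply: (@deltaX_cancel (wev (rep i)).1).
by rewrite -phi_comb_basis h ffunE.
Qed.

(** Modulo the ideal, [x] is a combination of representatives; when [phi] kills it, the diagonal
    form makes all its coefficients vanish. *)
Lemma phi_eq0 (x : fsum n) : phi x = 0 <-> in_ideal x.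
Proof.
split=> [x0|]; last exact: phi_ideal.
have [c h] := span_basis x; have /basis_free c0 : phi (fcomb c basis) = 0.
  apply/ffunP => d; have /ffunP/(_ d) := phi_ideal n_gt1 h.
  by rewrite phi_fsub x0 !ffunE add0r => /eqP; rewrite oppr_eq0 => /eqP.
apply: ideal_ext h => z; rewrite coef_fsub coef_fcomb big1 ?subr0 // => i _.
by rewrite c0 mul0r.
Qed.

Lemma phi_image (y : br n.*2) : in_SBr y <-> exists x : fsum n, phi x = y.
Proof.
split=> [ySBr|[x <-]]; last exact: phi_in_SBr.
have [b hb] := delta_inv.
(* The power of the inverse [b] compensates for the loops formed by the representative word. *)
pose c i := y (val (sdiag i)) * b ^+ (wev (rep i)).1.
pose x := fcomb c basis; exists x; apply/ffunP => d.
have [ds|nds] := boolP (is_symmetric (val d)).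
  have -> : d = val (sdiag (sindex (exist _ d ds))) by rewrite sindexK.
  by rewrite phi_comb_basis -mulrA -exprMn mulrC [b * _]mulrC hb expr1n mul1r.
have z0 (z : br n.*2) : in_SBr z -> z d = 0.
  by move=> /(_ d) h; apply: contraNeq nds.
by rewrite (z0 _ (@phi_in_SBr x)) (z0 _ ySBr).
Qed.

Lemma exists_basis : exists b : 'I_rank -> fsum n,
  (forall x, exists c, in_ideal (fsub x (fcomb c b))) /\
  (forall c, in_ideal (fcomb c b) -> forall i, c i = 0).
Proof.
exists basis; split; first exact: span_basis.
by move=> c /(phi_ideal n_gt1)/basis_free.
Qed.

End Basis.

Theorem theorem1p1 (n : nat) : (2 <= n)%N ->
  (* phi : Br(C_n) -> Br(A_{2n-1}) is well defined on the quotient by the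
     relation ideal and injective there *)
  (forall x : fsum n, phi x = 0 <-> in_ideal x) /\
  (* its image is exactly SBr(A_{2n-1}) *)
  (forall y : br n.*2, in_SBr y <-> exists x : fsum n, phi x = y) /\
  (* it is a homomorphism of unital algebras *)
  (forall x y : fsum n, phi (fmul x y) = bmul (phi x) (phi y)) /\
  phi (fone n) = bone n.*2 /\
  (* Br(C_n) is a free Z[delta^{+-1}]-module of rank a_{2n} *)
  (exists b : 'I_(aseq n.*2) -> fsum n,
     (forall x : fsum n, exists c : 'I_(aseq n.*2) -> laurent,
        in_ideal (fsub x (fcomb c b))) /\
     (forall c : 'I_(aseq n.*2) -> laurent,
        in_ideal (fcomb c b) -> forall i, c i = 0)).
Proof.
move=> n_gt1; split; first exact: phi_eq0.
split; first exact: phi_image.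
split; first exact: phi_fmul.
split; first exact: phi_fone.
exact: exists_basis.
Qed.
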